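(* Let $T:[0,1]\to[0,1]$ be a uniformly expanding map (as defined in the context), with absolutely continuous invariant probability measure $\nu$ having density $h$. Let $m_n=[Cn^{1/3}]$ for some constant $C>0$ (where $[\cdot]$ is the integer part), and for $x,y\in[0,1]$ let $$h_n(x,y)=\sum_{i=1}^{m_n}\alpha_{i,n}(y)\varphi_i(x),\qquad \varphi_i=\sqrt{m_n}\,\mathbf 1_{](i-1)/m_n,\,i/m_n]},\qquad \alpha_{i,n}(y)=\frac1n\sum_{k=1}^n\varphi_i(T^k(y)).$$ Then $$\int_0^1\int_0^1|h_n(x,y)-h(x)|\,\nu(dy)\,dx=O(n^{-1/3}).$$ Equivalently, if $\nu_n(y)$ denotes the probability measure with density $h_n(\cdot,y)$, then $\int_0^1\|\nu_n(y)-\nu\|\,\nu(dy)=O(n^{-1/3})$, where $\|\cdot\|$ is the variation norm.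
   Context: A map $T:[0,1]\to[0,1]$ is called uniformly expanding (mixing, with density bounded from below) if: (1) there is a finite or countable partition of $[0,1]$ into subintervals $I_n$ on each of which $T$ is strictly monotonic, with a $C^2$ extension to the closure $\overline{I_n}$, satisfying Adler's condition $|T''|/|T'|^2\le C$ and $|T'|\ge\lambda$, where $C>0$ and $\lambda>1$ do not depend on $I_n$; (2) the length of $T(I_n)$ is bounded from below (by a positive constant independent of $n$); (3) under these conditions $T$ has finitely many absolutely continuous invariant measures, each mixing up to a finite cycle; it is assumed that $T$ has a single absolutely continuous invariant probability measure $\nu$, and that $\nu$ is mixing; (4) the density $h$ of $\nu$ is bounded from below (by a positive constant) on its support. $T^k$ denotes the $k$-th iterate of $T$. *)

(* Defs.v *)
From HB Require Import structures.
From mathcomp Require Import all_boot all_order all_algebra.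
From mathcomp Require Import all_classical all_reals all_analysis.

Set Implicit Arguments.
Unset Strict Implicit.
Unset Printing Implicit Defensive.

Import Order.TTheory GRing.Theory Num.Theory.
Import numFieldNormedType.Exports.

Local Open Scope classical_set_scope.
Local Open Scope ring_scope.

(* A self-map of [0,1] is represented by a function [T : R -> R] preserving
   [`[0, 1]]; its values elsewhere are irrelevant, which is why preimages under
   [T] are always intersected with [`[0, 1]].  Measures on [0,1] are measures
   on [R] concentrated on [`[0, 1]]. *)

Definition strictly_monotone_on (R : realType) (A : set R) (f : R -> R) : Prop :=
  (forall x y, A x -> A y -> x < y -> f x < f y) \/
  (forall x y, A x -> A y -> x < y -> f y < f x).

(* Derivative relative to [A]: one-sided at the endpoints of an interval. *)
Definition derivative_within (R : realType) (A : set R) (f : R -> R)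
    (x l : R) : Prop :=
  ((f y - f x) / (y - x)) @[y --> within A x^'] --> l.

Definition C2_on (R : realType) (A : set R) (f f1 f2 : R -> R) : Prop :=
  [/\ (forall x, A x -> derivative_within A f x (f1 x)),
      (forall x, A x -> derivative_within A f1 x (f2 x)) &
      {within A, continuous f2}].

Definition expanding_branch (R : realType) (T : R -> R) (C lambda : R)
    (I : set R) : Prop :=
  strictly_monotone_on I T /\
  exists g g1 g2 : R -> R,
    [/\ C2_on (closure I) g g1 g2,
        (forall x, I x -> g x = T x),
        (forall x, I x -> `|g2 x| / `|g1 x| ^+ 2 <= C) &
        (forall x, I x -> lambda <= `|g1 x|)].

(* The partition may contain single points (they collect the endpoints and
   accumulation points that belong to no branch); the smoothness, expansion and
   large image conditions only concern the nondegenerate intervals. *)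
Definition piecewise_expanding (R : realType) (T : R -> R) : Prop :=
  (forall x, x \in `[0, 1] -> T x \in `[0, 1]) /\
  exists (D : set nat) (I : nat -> set R) (C lambda delta : R),
    [/\ partition D I `[0, 1]%classic,
        (forall n, D n -> is_interval (I n)),
        [/\ 0 < C, 1 < lambda & 0 < delta],
        (forall n, D n -> (I n)° !=set0 ->
           expanding_branch T C lambda (I n)) &
        (forall n, D n -> (I n)° !=set0 ->
           (delta%:E <= lebesgue_measure (T @` I n))%E)].

Definition invariant_measure (R : realType) (T : R -> R)
    (mu : probability (measurableTypeR R) R) : Prop :=
  forall A : set R, measurable A -> mu (`[0, 1]%classic `&` T @^-1` A) = mu A.

Definition acip (R : realType) (T : R -> R)
    (mu : probability (measurableTypeR R) R) : Prop :=
  [/\ mu `[0, 1]%classic = 1%E,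
      mu `<< (@lebesgue_measure R) &
      invariant_measure T mu].

Definition mixing (R : realType) (T : R -> R)
    (mu : probability (measurableTypeR R) R) : Prop :=
  forall A B : set R, measurable A -> measurable B ->
    mu (`[0, 1]%classic `&` (A `&` iter n T @^-1` B)) @[n --> \oo] -->
      (mu A * mu B)%E.

Definition density (R : realType) (mu : probability (measurableTypeR R) R)
    (h : R -> R) : Prop :=
  [/\ measurable_fun (`[0, 1]%classic : set R) h,
      (forall x, x \in `[0, 1] -> 0 <= h x) &
      forall A : set R, measurable A ->
        mu A = (\int[lebesgue_measure]_(x in A `&` `[0%R, 1%R]%classic) (h x)%:E)%E].

Definition uniformly_expanding (R : realType) (T : R -> R)
    (nu : probability (measurableTypeR R) R) (h : R -> R) : Prop :=
  [/\ piecewise_expanding T,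
      acip T nu,
      (forall mu : probability (measurableTypeR R) R, acip T mu ->
         forall A : set R, measurable A -> mu A = nu A),
      mixing T nu &
      density nu h /\
      exists c : R, 0 < c /\
        {ae lebesgue_measure, forall x, x \in `[0, 1] -> 0 < h x -> c <= h x}].

Section histogram.
Variable R : realType.

Definition bin_number (C : R) (n : nat) : nat :=
  Num.truncn (C * n%:R `^ (3%:R^-1)).

Definition bin_fun (m i : nat) (x : R) : R :=
  Num.sqrt m%:R * \1_(`](i%:R - 1) / m%:R, i%:R / m%:R]%classic) x.

Definition bin_coef (T : R -> R) (m i n : nat) (y : R) : R :=
  n%:R^-1 * \sum_(1 <= k < n.+1) bin_fun m i (iter k T y).

Definition histogram (T : R -> R) (m n : nat) (x y : R) : R :=
  \sum_(1 <= i < m.+1) bin_coef T m i n y * bin_fun m i x.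

Lemma integrable_histogram (T : R -> R) (m n : nat) (y : R) :
  (@lebesgue_measure R).-integrable [set: measurableTypeR R]
    (fun x => (histogram T m n x y)%:E).
Proof.
under eq_fun do rewrite -sumEFin.
apply: (@integrable_sum _ _ _ _ _ _ _ _ predT) => // i _.
under eq_fun do rewrite /bin_fun mulrA EFinM.
apply: integrableZl => //.
exact: integrable_indic_itv.
Qed.

Definition histogram_measure (T : R -> R) (m n : nat) (y : R)
  : {charge set (measurableTypeR R) -> \bar R} :=
  induced_charge (integrable_histogram T m n y).

End histogram.

(* Total mass of the variation |nu| = nu^+ + nu^-; it does not depend on the
   Hahn decomposition which is chosen. *)
Definition variation_norm d (X : measurableType d) (R : realType)
    (nu : {charge set X -> \bar R}) : \bar R :=
  let P := cid (Hahn_decomposition nu) in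
  let N := cid (projT2 P) in
  charge_variation (projT2 N) [set: X].

Definition charge_diff d (X : measurableType d) (R : realType)
    (mu nu : {charge set X -> \bar R}) : {charge set X -> \bar R} :=
  cadd mu (copp nu).

(* Main.v *)
Require Import Defs.
From mathcomp Require Import all_boot all_order all_algebra.
From mathcomp Require Import all_classical all_reals all_analysis.
From mathcomp Require Import measurable_realfun.
From mathcomp Require Import ring lra.
Import Order.TTheory GRing.Theory Num.Theory.
Import numFieldNormedType.Exports.
Local Open Scope classical_set_scope.
Local Open Scope ring_scope.

Set Implicit Arguments.
Unset Strict Implicit.
Unset Printing Implicit Defensive.

(** The error is the sum of a bias and a fluctuation. Replacing in the
    histogram the empirical frequency of each of the [m] bins by its
    [nu]-measure gives the average of [h] over the bins; as [h] has bounded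
    variation, this differs from [h] by [O(1/m)] in [L1]
    ([histogram_bias]). The number of visits of an orbit of length [n] to a bin
    has variance [O(n/m)] ([deviation_variance]): the correlations of the
    indicator of a bin decay exponentially, with a constant proportional to the
    width of the bin ([decay_of_correlations]). After normalization the
    fluctuation is [O(sqrt(m/n))] at each point. For [m] of order [n^(1/3)]
    both errors are [O(n^(-1/3))], and integrating over [x] first or over [y]
    first gives the two forms of the estimate.

    Both facts rest on a spectral gap for the transfer operator on functions of
    bounded variation, which is obtained by duality, without any transfer
    operator. A function [f] of bounded variation is replaced by the functional
    [psi |-> \int f psi], and its norm by the best [M] such that the functional
    is at most [M c] on every [psi] whose primitive is at most [c] in absolute
    value ([bv_dual], [prim_le]); the transfer operator becomes composition of
    [psi] with the map.

    The Lasota-Yorke inequality then says that [psi] composed with the map is a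
    function with a primitive multiplied by a small factor, plus a uniformly
    bounded remainder ([lasota_yorke]). It comes from the identity
    [psi(S) = (chi(S) w)' + chi(S) r] on a branch, where [chi' = psi],
    [w = 1/S'] and [r = - w' = S''/S'^2] ([inverse_branch]). Expansion makes
    [w] small, Adler's condition bounds [r], and the lower bound on the lengths
    of the images makes the suprema of [|w|] over the branches summable
    ([branch_weight_bound]), so that all but finitely many branches contribute
    little ([lasota_yorke_system]). The identity passes to compositions
    ([inverse_branch_comp]), which gives the inequality for all iterates with an
    exponentially small factor ([lasota_yorke_iter]).

    The decay of correlations follows by compactness ([bv_dual_contraction]).
    A functional with bounded dual norm is known up to a small error from its
    values on finitely many bins ([wv_step_bound]), so those of norm at most [1]
    form a totally bounded family, on which the convergence given by mixing is
    uniform ([net_uniform]). Combined with the Lasota-Yorke inequality, this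
    yields a power of the map that halves the dual norm of every functional
    concerned. Finally, applying the Lasota-Yorke inequality of high iterates to
    [nu] itself, which is invariant and absolutely continuous, shows that [nu]
    has finite dual norm ([invariant_bv]): this is the bounded variation of
    [h]. *)

(** * Bounded measurable functions and their integrals *)

(** The test functions: unlike continuous functions, they are stable under
    composition with a map that has jumps. *)
Definition bounded_measurable (R : realType) (f : R -> R) : Prop :=
  measurable_fun [set: R] f
  /\ exists K : R, forall x, `|f x| <= K.

Section bm.
Variable R : realType.
Notation bm := (@bounded_measurable R).
Implicit Types f g : R -> R.

Lemma bm_cst (c : R) : bm (fun=> c).
Proof. by split; [exact: measurable_cst|exists `|c|]. Qed.

Lemma bmD f g : bm f -> bm g -> bm (fun x => f x + g x).
Proof.
move=> [mf [K fK]] [mg [L gL]]; split; first exact: measurable_funD.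
by exists (K + L) => x; rewrite (le_trans (ler_normD _ _))// lerD.
Qed.

Lemma bmM f g : bm f -> bm g -> bm (fun x => f x * g x).
Proof.
move=> [mf [K fK]] [mg [L gL]]; split; first exact: measurable_funM.
by exists (K * L) => x; rewrite normrM ler_pM.
Qed.

Lemma bmZ (c : R) f : bm f -> bm (fun x => c * f x).
Proof. exact: (bmM (bm_cst c)). Qed.

Lemma bmN f : bm f -> bm (fun x => - f x).
Proof. by move/(bmZ (-1)); under eq_fun do rewrite mulN1r. Qed.

Lemma bmB f g : bm f -> bm g -> bm (fun x => f x - g x).
Proof. by move=> hf hg; apply: bmD => //; exact: bmN. Qed.

Lemma bm_norm f : bm f -> bm (fun x => `|f x|).
Proof.
move=> [mf [K fK]]; split; first exact: measurableT_comp.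
by exists K => x; rewrite normr_id.
Qed.

Lemma bm_comp f (S : R -> R) :
  measurable_fun [set: R] S -> bm f -> bm (fun x => f (S x)).
Proof.
move=> mS [mf [K fK]]; split; first exact: (measurableT_comp mf mS).
by exists K => x.
Qed.

Lemma bm_indic (A : set (measurableTypeR R)) : measurable A -> bm (\1_A : R -> R).
Proof.
move=> mA; split; first exact: measurable_indic.
by exists 1 => x; rewrite indicE; case: (_ \in _); rewrite ?normr1 ?normr0.
Qed.

Lemma bm_sum (I : Type) (s : seq I) (P : pred I) (F : I -> R -> R) :
  (forall i, bm (F i)) -> bm (fun x => \sum_(i <- s | P i) F i x).
Proof.
move=> bF; elim: s => [|i s ih].
  by under eq_fun do rewrite big_nil; exact: bm_cst.
under eq_fun do rewrite big_cons.
by case: (P i) => //; exact: bmD.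
Qed.

Section integration.
Variable mu : {measure set (measurableTypeR R) -> \bar R}.
Implicit Types A B : set (measurableTypeR R).

(** The sets over which every bounded measurable function is integrable. *)
Definition bm_set A := measurable A /\ (mu A < +oo)%E.

Lemma bm_setS A B : bm_set A -> measurable B -> B `<=` A -> bm_set B.
Proof.
move=> [mA fA] mB BA; split=> //; apply: le_lt_trans fA.
by apply: le_measure; rewrite ?inE.
Qed.

Lemma bm_integrable A f : bm_set A -> bm f -> mu.-integrable A (EFin \o f).
Proof.
move=> [mA fA] [mf [K fK]]; apply: measurable_bounded_integrable => //.
  exact: measurable_funTS.
exists K; split; rewrite ?num_real// => M KM x Ax /=.
exact: le_trans (fK x) (ltW KM).
Qed.

Lemma bm_intD A f g : bm_set A -> bm f -> bm g ->
  \int[mu]_(x in A) (f x + g x) =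
  \int[mu]_(x in A) f x + \int[mu]_(x in A) g x.
Proof.
by move=> sA bf bg; apply: RintegralD; [case: sA|exact: bm_integrable..].
Qed.

Lemma bm_intB A f g : bm_set A -> bm f -> bm g ->
  \int[mu]_(x in A) (f x - g x) =
  \int[mu]_(x in A) f x - \int[mu]_(x in A) g x.
Proof.
by move=> sA bf bg; apply: RintegralB; [case: sA|exact: bm_integrable..].
Qed.

Lemma bm_intZ A (c : R) f : bm_set A -> bm f ->
  \int[mu]_(x in A) (c * f x) = c * \int[mu]_(x in A) f x.
Proof.
by move=> sA bf; apply: RintegralZl; [case: sA|exact: bm_integrable].
Qed.

Lemma bm_int_sum A (I : Type) (s : seq I) (P : pred I) (F : I -> R -> R) :
  bm_set A -> (forall i, bm (F i)) ->
  \int[mu]_(x in A) (\sum_(i <- s | P i) F i x) =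
  \sum_(i <- s | P i) \int[mu]_(x in A) F i x.
Proof.
move=> sA bF; elim: s => [|i s ih].
  under eq_Rintegral do rewrite big_nil.
  by rewrite big_nil Rintegral_cst ?mul0r//; case: sA.
rewrite big_cons; under eq_Rintegral do rewrite big_cons.
case: (P i) => //; rewrite bm_intD// ?ih//; exact: bm_sum.
Qed.

Lemma bm_int_cst A (c : R) : bm_set A -> \int[mu]_(x in A) c = c * fine (mu A).
Proof. by move=> [mA _]; rewrite Rintegral_cst. Qed.

Lemma bm_le_int A f g : bm_set A -> bm f -> bm g ->
  (forall x, A x -> f x <= g x) ->
  \int[mu]_(x in A) f x <= \int[mu]_(x in A) g x.
Proof.
by move=> sA bf bg; apply: le_Rintegral; [case: sA|exact: bm_integrable..].
Qed.

Lemma bm_int_le_abs A f : bm_set A -> bm f ->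
  `|\int[mu]_(x in A) f x| <= \int[mu]_(x in A) `|f x|.
Proof.
by move=> sA bf; apply: le_normr_Rintegral; [case: sA|exact: bm_integrable].
Qed.

Lemma bm_int_bound A f (K : R) : bm_set A -> bm f ->
  (forall x, A x -> `|f x| <= K) ->
  `|\int[mu]_(x in A) f x| <= K * fine (mu A).
Proof.
move=> sA bf fK; apply: (le_trans (bm_int_le_abs sA bf)).
rewrite -bm_int_cst//; apply: bm_le_int => //; first exact: bm_norm.
exact: bm_cst.
Qed.

Lemma bm_int_setU A B f : bm_set A -> bm_set B -> bm f -> A `&` B = set0 ->
  \int[mu]_(x in A `|` B) f x =
  \int[mu]_(x in A) f x + \int[mu]_(x in B) f x.
Proof.
move=> [mA fA] [mB fB] bf AB0; apply: Rintegral_setU => //.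
  apply: bm_integrable => //; split; first exact: measurableU.
  by rewrite (le_lt_trans (measureU2 _ _ _))// lte_add_pinfty.
exact/disj_set2P.
Qed.

Lemma bm_int_setID A B f : bm_set A -> measurable B -> bm f ->
  \int[mu]_(x in A) f x =
  \int[mu]_(x in A `&` B) f x + \int[mu]_(x in A `\` B) f x.
Proof.
move=> sA mB bf; rewrite -[in LHS](setUIDK A B) bm_int_setU//.
- by apply: (bm_setS sA); [apply: measurableI => //; case: sA|exact: subIsetl].
- by apply: (bm_setS sA); [apply: measurableD => //; case: sA|exact: subDsetl].
- by apply/seteqP; split=> // x [[_ ?] []].
Qed.

Lemma bm_int_indic A B f : bm_set A -> measurable B ->
  \int[mu]_(x in A) (\1_B x * f x) = \int[mu]_(x in A `&` B) f x.
Proof.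
move=> sA mB; rewrite Rintegral_mkcondr; apply: eq_Rintegral => x _.
rewrite patchE indicE; case: (x \in B); by rewrite ?mul1r ?mul0r.
Qed.

End integration.
End bm.

(** * Measures of preimages under an expanding map *)

Section measure_comparison.
Import HBNNSimple.
Local Open Scope ereal_scope.
Context d (X : measurableType d) (R : realType).
Variables (m1 m2 : {measure set X -> \bar R}).
Variables (D : set X) (S : X -> X) (kappa : {nonneg R}).
Hypotheses (mD : measurable D) (mS : measurable_fun [set: X] S).
Hypothesis m12 : forall A, measurable A ->
  m1 (D `&` S @^-1` A) <= kappa%:num%:E * m2 A.

Let le_int_simple (g : {nnsfun X >-> R}) :
  \int[m1]_(x in D) (g (S x))%:E <= kappa%:num%:E * \int[m2]_x (g x)%:E.
Proof.
have mgS r : measurable (S @^-1` (g @^-1` [set r])).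
  by rewrite -[X in measurable X]setTI; exact: mS.
rewrite [leLHS](_ : _ = \sum_(r \in range g)
    \int[m1]_(x in D) (r * \1_(S @^-1` (g @^-1` [set r])) x)%:E); last first.
  under eq_integral do rewrite fimfunE -fsumEFin//.
  rewrite ge0_integral_fsum//.
    move=> r; apply/measurable_EFinP; apply: measurable_realfun.measurable_funM => //.
    exact: (measurable_indic (mgS r)).
  by move=> r x _; rewrite (nnfun_muleindic_ge0 g r (S x)).
rewrite [X in _ * X](_ : _ = \sum_(r \in range g)
    \int[m2]_x (r * \1_(g @^-1` [set r]) x)%:E); last first.
  under eq_integral do rewrite fimfunE -fsumEFin//.
  rewrite ge0_integral_fsum//.
    by move=> r; apply/measurable_EFinP; apply: measurable_realfun.measurable_funM.
  by move=> r x _; rewrite nnfun_muleindic_ge0.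
rewrite ge0_mule_fsumr; last first.
  by move=> r; apply: integral_ge0 => x _; rewrite nnfun_muleindic_ge0.
rewrite lee_fsum// => r [x _ <-].
have gx0 : (0 <= g x)%R by [].
rewrite !(integralZl_indic _ (fun r => S @^-1` (g @^-1` [set r])))//; last first.
  by move=> r0; rewrite preimage_nnfun0//.
rewrite !(integralZl_indic _ (fun r => (g @^-1` [set r])))//; last first.
  by move=> r0; rewrite preimage_nnfun0//.
rewrite !integral_indic// setIT muleCA; apply: lee_wpmul2l; first by rewrite lee_fin.
by rewrite setIC; exact: m12.
Qed.

(** The inequality between measures of preimages passes to integrals of simple
    functions, then to nonnegative measurable functions by monotone
    approximation. It is what makes composition with an expanding map continuous
    for the [L1] norm. *)
Lemma le_integral_comp (f : X -> \bar R) : measurable_fun [set: X] f ->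
  (forall x, 0 <= f x) ->
  \int[m1]_(x in D) f (S x) <= kappa%:num%:E * \int[m2]_x f x.
Proof.
move=> mf f0; pose f_ := nnsfun_approx measurableT mf.
have cf x : (f_ n x)%:E @[n --> \oo] --> f x.
  exact: (cvg_nnsfun_approx measurableT mf).
rewrite [leLHS](_ : _ = limn (fun n => \int[m1]_(x in D) (f_ n (S x))%:E)); last first.
  rewrite -monotone_convergence//.
  - by apply: eq_integral => x _; apply/esym/cvg_lim => //; exact: cf.
  - move=> n; apply/measurable_EFinP; apply: measurable_funTS.
    exact: (measurableT_comp _ mS).
  - by move=> n x _; rewrite lee_fin.
  - by move=> x _ m n mn; rewrite lee_fin; exact/lefP/nd_nnsfun_approx.
apply: lime_le.
  apply: ereal_nondecreasing_is_cvgn => m n mn; apply: ge0_le_integral => //.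
  - by move=> x _; rewrite lee_fin.
  - apply/measurable_EFinP; apply: measurable_funTS.
    exact: (measurableT_comp _ mS).
  - apply/measurable_EFinP; apply: measurable_funTS.
    exact: (measurableT_comp _ mS).
  - by move=> x _; rewrite lee_fin; exact/lefP/nd_nnsfun_approx.
apply: nearW => n; apply: (le_trans (le_int_simple _)).
apply: lee_wpmul2l; first by rewrite lee_fin.
apply: ge0_le_integral => //.
- by move=> x _; rewrite lee_fin.
- exact/measurable_EFinP.
move=> x _; rewrite -(cvg_lim _ (cf x))//; apply: lime_ge.
  by apply/cvg_ex; exists (f x); exact: cf.
by exists n => // m /= nm; rewrite lee_fin; exact/lefP/nd_nnsfun_approx.
Qed.
End measure_comparison.

Section interval_measure.
Variable R : realType.
Notation leb := (@lebesgue_measure R).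

Lemma lebesgue_measure_diam (E : set R) (d : R) : 0 <= d ->
  (forall s t, E s -> E t -> t - s <= d) -> (leb E <= d%:E)%E.
Proof.
move=> d0 Ed; have [->|/set0P[s0 Es0]] := eqVneq E set0; first by rewrite measure0.
have hE : has_inf E by split; [exists s0|exists (s0 - d) => t Et; move: (Ed t s0 Et Es0); lra].
apply: (@le_trans _ _ (leb `[inf E, inf E + d])).
  apply: le_outer_measure => t Et /=; rewrite in_itv/=; apply/andP; split.
    by apply: ge_inf => //; case: hE.
  rewrite -lerBlDr; apply: lb_le_inf; first by exists s0.
  by move=> s Es; move: (Ed s t Es Et); lra.
rewrite lebesgue_measure_itv/= lte_fin; case: ifPn => //.
by rewrite -EFinB lee_fin; lra.
Qed.

(** Covering [A] by open intervals reduces the claim to intervals, and the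
    preimage in [D] of an interval has diameter at most [kappa] times its
    length. *)
Lemma preimage_expanding_le (S : R -> R) (kappa : R) (D A : set R) :
  0 < kappa ->
  (forall s t, D s -> D t -> `|t - s| <= kappa * `|S t - S s|) ->
  measurable D -> measurable_fun [set: R] S ->
  measurable A -> (leb (D `&` S @^-1` A) <= kappa%:E * leb A)%E.
Proof.
move=> k0 Sk mD mS mA.
rewrite [X in (_ <= _ * X)%E](outer_measure_open_itv_cover A).
rewrite -ereal_inf_pZl//; apply: le_ereal_inf_tmp => _ [_ [F [oF AF] <-] <-].
apply: (@le_trans _ _ (leb (\bigcup_k (D `&` S @^-1` F k)))).
  by apply: le_outer_measure => x [Dx /AF[k _ Fk]]; exists k.
apply: (le_trans (outer_measure_sigma_subadditive leb _)).
rewrite -nneseriesZl; last by move=> k _; exact: wlength_ge0.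
apply: lee_nneseries => k _.
  by move=> ?; exact: outer_measure_ge0.
have [[a b] /= ->] := oF k; rewrite wlength_itv/= lte_fin.
case: ltP => ab; last first.
  rewrite set_itv_ge; last by rewrite -leNgt bnd_simp.
  by rewrite preimage_set0 setI0 mule0 outer_measure0.
rewrite -EFinD -EFinM; apply: lebesgue_measure_diam.
  by rewrite mulr_ge0 ?subr_ge0// ltW.
move=> s t [Ds /=]; rewrite in_itv/= => /andP[s1 s2] [Dt /=].
rewrite in_itv/= => /andP[t1 t2].
apply: (le_trans (ler_norm _)); apply: (le_trans (Sk _ _ Ds Dt)).
apply: ler_wpM2l; first exact: ltW.
by rewrite ler_norml; apply/andP; split; lra.
Qed.

End interval_measure.

(** * Integration by parts along a smooth branch *)

Section branch.
Variable R : realType.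
Notation leb := (@lebesgue_measure R).
Notation bm := (@bounded_measurable R).

Lemma bm_set_itv (i j : itv_bound R) (a b : R) : [set` Interval i j] `<=` `[a, b] ->
  bm_set leb [set` Interval i j].
Proof.
move=> ijab; apply: (@bm_setS _ _ `[a, b]) => //; split=> //.
by apply: compact_finite_measure; exact: segment_compact.
Qed.

Lemma bm_set_cc (a b : R) : bm_set leb `[a, b].
Proof. by apply: (@bm_set_itv _ _ a b). Qed.

Lemma fine_leb_cc (a b : R) : a <= b -> fine (leb `[a, b]) = b - a.
Proof.
rewrite lebesgue_measure_itv/= lte_fin; case: ltP => //= h1 h2.
by rewrite (_ : a = b) ?subrr; [|lra].
Qed.

Definition primitive_on01 (psi chi : R -> R) : Prop :=
  forall z z', 0 <= z -> z <= z' -> z' <= 1 ->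
    chi z' - chi z = \int[leb]_(t in `[z, z']) psi t.

(** The integrated form of [psi(S) = (chi(S) w)' + chi(S) r], which holds on a
    branch of [S] for [w = 1/S'] and [r = - w'] when [chi' = psi]. In this form
    it makes sense for [psi] merely bounded and measurable, it involves no
    derivative of [S], and it is stable under composition. The function [chi]
    is determined up to a constant only, and the identity for constants says
    that [w y - w x] is minus the integral of [r]. *)
Definition inverse_branch (S : R -> R) (J : set R) (w r : R -> R) : Prop :=
  forall x y psi chi, J x -> J y -> x <= y -> bm psi -> bm chi ->
    primitive_on01 psi chi ->
    \int[leb]_(t in `[x, y]) psi (S t) =
    chi (S y) * w y - chi (S x) * w x +
    \int[leb]_(t in `[x, y]) (chi (S t) * r t).

Lemma itv_chasles (f : R -> R) (a b c : R) : bm f -> a <= b -> b <= c ->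
  \int[leb]_(t in `[a, c]) f t =
  \int[leb]_(t in `[a, b]) f t + \int[leb]_(t in `[b, c]) f t.
Proof.
move=> bf ab bc.
have i1 : leb.-integrable `[a, c] (EFin \o f).
  exact: bm_integrable (bm_set_cc _ _) bf.
have := @Rintegral_itvB _ f (BLeft a) (BRight c) b i1.
rewrite !bnd_simp => /(_ ab bc).
have i2 : leb.-integrable `]b, c] (EFin \o f).
  by apply: integrableS i1 => //; apply: subset_itvr; rewrite bnd_simp.
by rewrite (Rintegral_itv_obnd_cbnd i2) => <-; rewrite addrC subrK.
Qed.

Definition clamp (a b x : R) : R := Num.max a (Num.min b x).

Lemma clamp_continuous (a b : R) : continuous (clamp a b).
Proof.
move=> x; apply: (@continuous_comp _ _ _ (fun x => Num.min b x) (fun x => Num.max a x)).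
  by apply: continuous_min; [exact: cvg_cst|exact: cvg_id].
by apply: continuous_max; [exact: cvg_cst|exact: cvg_id].
Qed.

Lemma clamp_in (a b x : R) : a <= b -> a <= clamp a b x <= b.
Proof. by move=> ab; rewrite /clamp le_max lexx/= ge_max ab ge_min lexx. Qed.

Lemma clamp_id (a b x : R) : a <= x <= b -> clamp a b x = x.
Proof. by move=> /andP[ax xb]; rewrite /clamp min_r// max_r. Qed.

Lemma bm_continuous_clamp (g : R -> R) : continuous g ->
  continuous (g \o clamp 0 1) /\ bm (g \o clamp 0 1).
Proof.
move=> cg; have cgc : continuous (g \o clamp 0 1).
  by move=> x; apply: continuous_comp; [exact: clamp_continuous|exact: cg].
split=> //; split; first exact: continuous_measurable_fun.
have [c1 _ c1P] := EVT_max ler01 (continuous_subspaceT cg).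
have cgN : {within `[0, 1], continuous (fun x => - g x)}.
  by apply: continuous_subspaceT => x; apply: continuousN; exact: cg.
have [c2 _ c2P] := EVT_max ler01 cgN.
exists (`|g c1| + `|g c2|) => x /=.
have xi : clamp 0 1 x \in `[0, 1] by rewrite in_itv/=; exact: clamp_in.
move: (c1P _ xi) (c2P _ xi).
have := ler_norm (g c1); have := ler_norm (- g c2); rewrite normrN.
have := normr_ge0 (g c1); have := normr_ge0 (g c2).
by move=> *; rewrite ler_norml; apply/andP; split; lra.
Qed.

(** The approximants given by density of continuous functions need not be bounded
    outside [0, 1]; composing them with [clamp] keeps them unchanged on
    [0, 1] and bounds them. *)
Lemma continuous_dense_L1 (psi : R -> R) (e : R) : bm psi -> 0 < e ->
  exists phi : R -> R, [/\ continuous phi, bm phi &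
    \int[leb]_(t in `[0, 1]) `|psi t - phi t| <= e].
Proof.
move=> bpsi e0; have s01 := bm_set_cc 0 1.
have [g [cg ig]] := approximation_continuous_integrable s01.1 s01.2
  (bm_integrable s01 bpsi).
move/fine_cvgP => [_ /cvgrPdist_lt /(_ _ e0) [N _ /(_ N (leqnn N))]] /=.
rewrite sub0r normrN => gN.
exists (g N \o clamp 0 1); have [cgc bgc] := bm_continuous_clamp (cg N).
split=> //.
apply: ltW; apply: le_lt_trans gN; apply: le_trans (ler_norm _).
rewrite le_eqVlt; apply/orP; left; apply/eqP.
congr fine; apply: eq_integral => z; rewrite inE/= in_itv/= => zi.
by rewrite clamp_id.
Qed.

Lemma small_eq0 (a K : R) : (forall e, 0 < e -> `|a| <= K * e) -> a = 0.
Proof.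
move=> h; apply/eqP; rewrite -normr_eq0 eq_le normr_ge0 andbT.
apply/ler_addgt0Pr => e e0; rewrite add0r.
have K1 : 0 < `|K| + 1 by rewrite ltr_wpDl.
apply: (le_trans (h (e / (`|K| + 1)) _)); first exact: divr_gt0.
rewrite mulrA ler_pdivrMr// mulrC ler_pM2l//.
by have := ler_norm K; lra.
Qed.

Section smooth_branch.
Variables (T w r : R -> R) (J : set R) (kappa : R).
Hypotheses (iJ : is_interval J) (k0 : 0 < kappa).
Hypotheses (mT : measurable_fun [set: R] T) (T01 : forall x, 0 <= T x <= 1).
Hypotheses (br : bm r).
Hypothesis HJ : forall x, J x -> [/\ w x != 0, is_derive x 1 T (w x)^-1,
  is_derive x 1 w (- r x), {for x, continuous r} & `|w x| <= kappa].

(** By the mean value theorem, since [1/w] is the derivative of [T]. *)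
Lemma smooth_branch_expanding s t : J s -> J t -> `|t - s| <= kappa * `|T t - T s|.
Proof.
suff H u v : J u -> J v -> u < v -> `|v - u| <= kappa * `|T v - T u|.
  move=> Js Jt; have [st|ts|->] := ltgtP s t; first exact: H.
    by rewrite distrC (distrC (T t)); exact: H.
  by rewrite !subrr normr0 mulr0.
move=> Ju Jv uv.
have Juv x : x \in `[u, v] -> J x by rewrite in_itv/=; exact: iJ.
have [c cuv ->] : exists2 c, c \in `]u, v[ & T v - T u = (w c)^-1 * (v - u).
  apply: (@MVT _ T (fun x => (w x)^-1)) => //.
    by move=> x xuv; have [] := HJ (Juv _ (subset_itv_oo_cc xuv)).
  apply: derivable_within_continuous => x xuv.
  by have [_ dT _ _ _] := HJ (Juv _ xuv); exact: ex_derive.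
have [w0 _ _ _ wk] := HJ (Juv _ (subset_itv_oo_cc cuv)).
rewrite normrM mulrA -[leLHS]mul1r; apply: ler_wpM2r => //.
by rewrite normfV ler_pdivlMr ?normr_gt0// mul1r.
Qed.

Let smooth_branch_continuous x y (phi : R -> R) (c : R) :
  J x -> J y -> x < y -> continuous phi -> bm phi ->
  let X (z : R) : R := c + \int[leb]_(t in `[-1, z]) phi t in
  leb.-integrable `[x, y] (EFin \o (fun t => X (T t) * r t)) /\
  \int[leb]_(t in `[x, y]) (phi (T t) - X (T t) * r t) =
  X (T y) * w y - X (T x) * w x.
Proof.
move=> Jx Jy xy cphi bphi X.
have Jxy t : t \in `[x, y] -> J t by rewrite in_itv/=; exact: iJ.
have dX (z : R) : -1 < z -> is_derive z 1 X (phi z).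
  move=> z1.
  have zu : z < z + 1 by lra.
  have [||] := @continuous_FTC1_closed _ phi (-1) z (z + 1) zu _ z1.
  - exact: bm_integrable (bm_set_cc _ _) bphi.
  - exact: cphi.
  move=> dI dE.
  rewrite -[phi z]add0r; apply: is_deriveD.
  by rewrite -dE derive1E; exact: derivableP.
have dXT (t : R) : t \in `[x, y] -> is_derive t 1 (X \o T) (phi (T t) * (w t)^-1).
  move=> txy; have [_ dT _ _ _] := HJ (Jxy _ txy).
  apply: is_derive1_comp; apply: dX.
  by have /andP[T0 _] := T01 t; lra.
have dF (t : R) : t \in `[x, y] ->
    is_derive t 1 ((X \o T) * w) (phi (T t) - X (T t) * r t).
  move=> txy; have [w0 dT dw _ _] := HJ (Jxy _ txy).
  have dXTt := dXT _ txy.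
  have := is_deriveM dXTt dw.
  rewrite (_ : _ + _ = phi (T t) - X (T t) * r t)//.
  by rewrite /GRing.scale/= mulrN mulrCA mulfV// mulr1 addrC.
have cT (t : R) : t \in `[x, y] -> {for t, continuous T}.
  move=> txy; have [_ dT _ _ _] := HJ (Jxy _ txy).
  exact/differentiable_continuous/derivable1_diffP/ex_derive.
have cXr (t : R) : t \in `[x, y] -> {for t, continuous (fun t => X (T t) * r t)}.
  move=> txy; have [_ _ _ cr _] := HJ (Jxy _ txy).
  apply: (@continuousM _ _ (X \o T) r) => //.
  have dXTt := dXT _ txy.
  exact/differentiable_continuous/derivable1_diffP/ex_derive.
split.
  apply: continuous_compact_integrable; first exact: segment_compact.
  by apply: continuous_in_subspaceT => t; rewrite inE/=; exact: cXr.
rewrite /Rintegral (@continuous_FTC2 _ _ ((X \o T) * w))//.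
- apply: continuous_in_subspaceT => t; rewrite inE/= => txy.
  apply: (@continuousB _ _ _ (phi \o T) (fun t => X (T t) * r t)); last exact: cXr.
  by apply: continuous_comp; [exact: cT|exact: cphi].
- have dd : forall t, t \in `[x, y] -> derivable ((X \o T) * w) t 1.
    by move=> t txy; have h := dF _ txy; exact: ex_derive.
  have cc : forall t, t \in `[x, y] -> {for t, continuous ((X \o T) * w)}.
    by move=> t txy; exact/differentiable_continuous/derivable1_diffP/dd.
  split.
  + by move=> t txy; apply: dd; exact: subset_itv_oo_cc.
  + by apply: cvg_at_right_filter; apply: cc; rewrite in_itv/= lexx ltW.
  + by apply: cvg_at_left_filter; apply: cc; rewrite in_itv/= lexx ltW.
- move=> t /subset_itv_oo_cc txy; rewrite derive1E.
  by have h := dF _ txy; exact: derive_val.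
Qed.

(** For continuous [psi] this is the fundamental theorem of calculus applied to
    [chi(T) w]. A bounded measurable [psi] is approximated in [L1] by continuous
    [phi]: the primitives are then uniformly close, and [phi(T)] is close to
    [psi(T)] in [L1] because [T] is expanding on [J]. *)
Lemma smooth_inverse_branch : inverse_branch T J w r.
Proof.
move=> x y psi chi Jx Jy xy bpsi bchi chiP.
have Jxy t : t \in `[x, y] -> J t by rewrite in_itv/=; exact: iJ.
have [xy'|yx] := ltP x y; last first.
  have -> : y = x by apply/eqP; rewrite eq_le xy yx.
  by rewrite !set_itv1 !Rintegral_set1 subrr addr0.
have sxy := bm_set_cc x y.
have [rM [M rMP]] := br.
have M0 : 0 <= M by exact: le_trans (rMP 0).
apply/eqP; rewrite -subr_eq0; apply/eqP.
apply: (@small_eq0 _ (kappa + 2 * kappa + M * (y - x))) => e e0.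
have [phi [cphi bphi phie]] := continuous_dense_L1 bpsi e0.
(* This constant makes the primitive [X] of [phi] agree with [chi] at [T x]. *)
pose c := chi (T x) - \int[leb]_(t in `[-1, T x]) phi t.
have := smooth_branch_continuous c Jx Jy xy' cphi bphi.
set X := fun z : R => c + _; move=> /= [iX XE].
have X_chi z : 0 <= z <= 1 -> `|X z - chi z| <= e.
  suff H u v : 0 <= u -> u <= v -> v <= 1 ->
      `|(X v - X u) - (chi v - chi u)| <= e.
    have /andP[t0 t1] := T01 x.
    have XTx : X (T x) = chi (T x) by rewrite /X /c subrK.
    move=> /andP[z0 z1]; have [zT|Tz] := leP z (T x).
      by have := H _ _ z0 zT t1; rewrite XTx distrC; congr (`|_| <= _); ring.
    by have := H _ _ t0 (ltW Tz) z1; rewrite XTx; congr (`|_| <= _); ring.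
  move=> u0 uv v1.
  have -> : X v - X u = \int[leb]_(t in `[u, v]) phi t.
    rewrite /X (@itv_chasles phi (-1) u v)//; [ring|lra].
  rewrite chiP// distrC -bm_intB//; last exact: bm_set_cc.
  apply: le_trans phie; apply: (le_trans (bm_int_le_abs (bm_set_cc _ _) _)).
    exact: bmB.
  rewrite (bm_int_setID (bm_set_cc 0 1) (measurable_itv `[u, v])); last first.
    by apply: bm_norm; exact: bmB.
  rewrite setIidr; last by apply: subset_itv; rewrite bnd_simp.
  by rewrite lerDl Rintegral_ge0.
set A := \int[leb]_(t in `[x, y]) psi (T t).
set B := \int[leb]_(t in `[x, y]) (chi (T t) * r t).
have bpT : bm (fun t => psi (T t)) by exact: bm_comp.
have bphT : bm (fun t => phi (T t)) by exact: bm_comp.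
have bcr : bm (fun t => chi (T t) * r t) by apply: bmM => //; exact: bm_comp.
have iphT : leb.-integrable `[x, y] (EFin \o (fun t => phi (T t))).
  exact: bm_integrable.
rewrite (RintegralB sxy.1 iphT iX) in XE.
set A' := \int[leb]_(t in `[x, y]) phi (T t) in XE.
set B' := \int[leb]_(t in `[x, y]) (X (T t) * r t) in XE.
have AA' : `|A - A'| <= kappa * e.
  rewrite -bm_intB//; apply: (le_trans (bm_int_le_abs sxy (bmB bpT bphT))).
  have k00 : 0 <= kappa := ltW k0.
  have mU : measurable `[(0:R), 1] by [].
  pose f t := `|psi t - phi t| * \1_`[(0:R), 1] t.
  have bf : bm f.
    by apply: bmM; [apply: bm_norm; exact: bmB|exact: bm_indic].
  have := @le_integral_comp _ _ _ leb leb `[x, y] T (NngNum k00) _ mT _ (EFin \o f).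
  move=> /(_ sxy.1) H.
  have {}H : (\int[leb]_(t in `[x, y]) (EFin \o f) (T t) <=
              kappa%:E * \int[leb]_(t in `[0%R, 1%R]) (`|psi t - phi t|%R)%:E)%E.
    apply: (le_trans (H _ _ _)).
    - move=> A0 mA0; apply: preimage_expanding_le => //.
      by move=> s t /Jxy Js /Jxy Jt; exact: smooth_branch_expanding.
    - by apply/measurable_EFinP; case: bf.
    - by move=> t; rewrite /= lee_fin mulr_ge0.
    rewrite [in leRHS]integral_mkcond; apply: lee_wpmul2l; first by rewrite lee_fin.
    rewrite le_eqVlt; apply/orP; left; apply/eqP; apply: eq_integral => t _.
    rewrite patchE /f /= indicE; case: (_ \in _); by rewrite ?mulr1 ?mulr0.
  have ->  : \int[leb]_(t in `[x, y]) `|psi (T t) - phi (T t)| =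
             \int[leb]_(t in `[x, y]) f (T t).
    apply: eq_Rintegral => t _; rewrite /f indicE mem_set ?mulr1//=.
    by rewrite in_itv/=.
  apply: le_trans (ler_wpM2l k00 phie).
  rewrite -lee_fin EFinM.
  rewrite /Rintegral !fineK//.
    by apply: integrable_fin_num => //; apply: bm_integrable (bm_set_cc _ _) _; apply: bm_norm; exact: bmB.
  by apply: integrable_fin_num => //; apply: (bm_integrable sxy (f := f \o T)); exact: bm_comp.
have BB' : `|B' - B| <= M * (y - x) * e.
  rewrite -RintegralB//; last exact: bm_integrable.
  have iD : leb.-integrable `[x, y] (EFin \o (fun t => X (T t) * r t - chi (T t) * r t)).
    under [X in _.-integrable _ X]eq_fun do rewrite /= EFinB.
    by apply: integrableB => //; exact: bm_integrable.
  apply: (le_trans (le_normr_Rintegral sxy.1 iD)).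
  have -> : M * (y - x) * e = \int[leb]_(t in `[x, y]) (e * M).
    by rewrite bm_int_cst// fine_leb_cc//; ring.
  apply: (le_Rintegral sxy.1).
  - exact: (integrable_norm iD).
  - by apply: bm_integrable => //; exact: bm_cst.
  move=> t txy; rewrite -mulrBl normrM ler_pM//.
  by apply: X_chi; exact: T01.
have [_ _ _ _ wx] := HJ Jx; have [_ _ _ _ wy] := HJ Jy.
have X1 : `|(X (T y) - chi (T y)) * w y| <= e * kappa.
  by rewrite normrM ler_pM// X_chi.
have X2 : `|(X (T x) - chi (T x)) * w x| <= e * kappa.
  by rewrite normrM ler_pM// X_chi.
rewrite (_ : _ - _ = (A - A') + (X (T y) - chi (T y)) * w y -
   (X (T x) - chi (T x)) * w x + (B' - B)); last first.
  have -> : A' = X (T y) * w y - X (T x) * w x + B' by rewrite -XE subrK.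
  by ring.
apply: (le_trans (ler_normD _ _)); apply: (le_trans (lerD (ler_normB _ _) BB')).
apply: (le_trans (lerD (lerD (ler_normD _ _) X2) (lexx _))).
apply: (le_trans (lerD (lerD (lerD AA' X1) (lexx _)) (lexx _))).
by rewrite le_eqVlt; apply/orP; left; apply/eqP; ring.
Qed.

End smooth_branch.
End branch.

(** * Systems of expanding branches and their composition *)

Section primitive.
Variable R : realType.
Notation leb := (@lebesgue_measure R).
Notation bm := (@bounded_measurable R).

(** The clamp makes the primitive a bounded function on the whole line. *)
Definition prim (psi : R -> R) (z : R) : R :=
  \int[leb]_(t in `[0, clamp 0 1 z]) psi t.

Lemma primE psi z : 0 <= z <= 1 -> prim psi z = \int[leb]_(t in `[0, z]) psi t.
Proof. by move=> z01; rewrite /prim clamp_id. Qed.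

Lemma primB psi z z' : bm psi -> 0 <= z -> z <= z' -> z' <= 1 ->
  prim psi z' - prim psi z = \int[leb]_(t in `[z, z']) psi t.
Proof.
move=> bpsi z0 zz' z'1; rewrite !primE; [|lra..].
by rewrite (@itv_chasles _ psi 0 z z')//; ring.
Qed.

Lemma prim_primitive psi : bm psi -> primitive_on01 psi (prim psi).
Proof. by move=> bpsi z z' *; exact: primB. Qed.

Lemma clamp_lip (a b x y : R) : a <= b -> `|clamp a b x - clamp a b y| <= `|x - y|.
Proof.
move=> ab; wlog xy : x y / x <= y.
  move=> H; have [/H//|/ltW/H] := leP x y.
  by rewrite distrC (distrC y).
rewrite distrC (distrC x) (ger0_norm (x := y - x)) ?subr_ge0//.
rewrite ger0_norm ?subr_ge0; rewrite /clamp;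
  case: (leP b x) => ?; case: (leP b y) => ?; case: (leP a b) => ?;
  case: (leP a x) => ?; case: (leP a y) => ?; lra.
Qed.

Lemma bm_prim psi : bm psi -> bm (prim psi).
Proof.
move=> bpsi; have [_ [K KP]] := bpsi.
have K0 : 0 <= K by exact: le_trans (KP 0).
have lip z z' : `|prim psi z - prim psi z'| <= K * `|z - z'|.
  wlog zz' : z z' / clamp 0 1 z' <= clamp 0 1 z.
    move=> H; have [/H//|/ltW/H] := leP (clamp 0 1 z') (clamp 0 1 z).
    by rewrite distrC (distrC z').
  have /andP[c0 c1] := @clamp_in R 0 1 z ler01.
  have /andP[d0 d1] := @clamp_in R 0 1 z' ler01.
  rewrite /prim (@itv_chasles _ psi 0 _ (clamp 0 1 z) bpsi d0 zz') addrC addKr.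
  apply: (le_trans (bm_int_bound (bm_set_cc _ _) bpsi (fun x _ => KP x))).
  rewrite fine_leb_cc// ler_wpM2l//; apply: le_trans (ler_norm _) _.
  exact: clamp_lip.
split.
  apply: continuous_measurable_fun => z; apply/cvgrPdist_lt => e e0.
  have K1 : 0 < K + 1 by rewrite ltr_wpDl.
  near=> z'; apply: (le_lt_trans (lip _ _)).
  apply: (@le_lt_trans _ _ ((K + 1) * `|z - z'|)).
    by rewrite ler_wpM2r// lerDl.
  rewrite mulrC -ltr_pdivlMr//; near: z'.
  exact: (nbhsx_ballx z (e / (K + 1)) (divr_gt0 e0 K1)).
exists K => z; rewrite -[K]mulr1.
have /andP[c0 c1] := @clamp_in R 0 1 z ler01.
apply: (le_trans (bm_int_bound (bm_set_cc _ _) bpsi (fun x _ => KP x))).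
by rewrite fine_leb_cc// ler_wpM2l// subr0.
Unshelve. all: by end_near. Qed.

(** An interval is exhausted, up to small measure, by compact subintervals with
    endpoints in it; this covers open and half-open intervals alike, where the
    branch identity is available only between points of the branch. *)
Lemma int_interval_bound (I : set R) (f : R -> R) (c : R) :
  is_interval I -> I `<=` `[0, 1] -> bm f -> 0 <= c ->
  (forall x y, I x -> I y -> x <= y -> `|\int[leb]_(t in `[x, y]) f t| <= c) ->
  `|\int[leb]_(t in I) f t| <= c.
Proof.
move=> iI I01 bf c0 fc; have [->|/set0P[p Ip]] := eqVneq I set0.
  by rewrite Rintegral_set0 normr0.
have mI : measurable I by exact: is_interval_measurable.
have sI : bm_set leb I by exact: (bm_setS (bm_set_cc 0 1)).
have [_ [K KP]] := bf.
have K0 : 0 <= K by exact: le_trans (KP 0).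
apply/ler_addgt0Pr => e e0.
have d0 : 0 < e / (2 * K + 1) by apply: divr_gt0 => //; lra.
set d := e / _ in d0.
have hi : has_inf I.
  by split; [exists p|exists 0 => t /I01/=; rewrite in_itv/= => /andP[]].
have hs : has_sup I.
  by split; [exists p|exists 1 => t /I01/=; rewrite in_itv/= => /andP[]].
have [x1 Ix1 x1d] := inf_adherent d0 hi.
have [y1 Iy1 y1d] := sup_adherent d0 hs.
have [x [y [Ix Iy xy xd yd]]] : exists x y, [/\ I x, I y, x <= y,
    x < inf I + d & sup I - d < y].
  have [xy|yx] := leP x1 y1; first by exists x1, y1.
  by exists y1, x1; split => //; lra.
have xyI : `[x, y] `<=` I by move=> t /=; rewrite in_itv/=; exact: iI.
rewrite (bm_int_setID sI (measurable_itv `[x, y]) bf) setIidr//.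
apply: (le_trans (ler_normD _ _)); apply: lerD; first exact: fc.
have IU : I `\` `[x, y] `<=` `[inf I, x] `|` `[y, sup I].
  move=> t [It /=]; rewrite !in_itv/= => nt.
  have ti : inf I <= t by apply: ge_inf => //; case: hi.
  have ts : t <= sup I by apply: ub_le_sup => //; case: hs.
  have [tx|xt] := leP t x; first by left; rewrite ti.
  right; rewrite ts andbT; move: nt; rewrite (ltW xt)/=.
  by case: leP => // /ltW.
have sD : bm_set leb (I `\` `[x, y]).
  by apply: (bm_setS sI); [exact: measurableD|exact: subDsetl].
apply: (le_trans (bm_int_bound sD bf (fun x _ => KP x))).
have H : fine (leb (I `\` `[x, y])) <= 2 * d.
  rewrite -lee_fin fineK ?ge0_fin_numE//; last by case: sD.
  apply: (@le_trans _ _ (leb (`[inf I, x] `|` `[y, sup I]))).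
    by apply: le_outer_measure.
  apply: (le_trans (outer_measureU2 _ _ _)).
  have xi : inf I <= x by apply: ge_inf => //; case: hi.
  have ys : y <= sup I by apply: ub_le_sup => //; case: hs.
  have L (u v : R) : u <= v -> v - u <= d -> (leb `[u, v] <= d%:E)%E.
    move=> uv vu; rewrite -(@fineK _ (leb `[u, v])).
      by rewrite lee_fin fine_leb_cc.
    by rewrite ge0_fin_numE//; case: (bm_set_cc u v).
  by rewrite mulr_natl mulr2n EFinD; apply: leeD; apply: L => //; lra.
apply: (le_trans (ler_wpM2l K0 H)).
rewrite /d !mulrA ler_pdivrMr; last lra.
by rewrite (mulrC K) [leRHS]mulrC ler_wpM2r//; lra.
Qed.

End primitive.

Section system.
Variable R : realType.
Notation leb := (@lebesgue_measure R).
Notation bm := (@bounded_measurable R).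

Definition selfmap01 (S : R -> R) : Prop :=
  measurable_fun [set: R] S /\ forall x, 0 <= S x <= 1.

(** A countable family of disjoint branches of [S] filling [0, 1] up to a null
    set, with common weights [w] and [r]. The numbers [beta k] bound [w] on each
    branch and are summable; the uniform bound [eta] measures the expansion. The
    conditions are chosen to be stable under composition. *)
Record branch_system (S : R -> R) (eta : R) (K : countType) (J : K -> set R)
    (w r : R -> R) (beta : K -> R) : Prop := BranchSystem {
  bs_bm_w : bm w;
  bs_bm_r : bm r;
  bs_interval : forall k, is_interval (J k);
  bs_sub01 : forall k, J k `<=` `[0, 1];
  bs_mono : forall k, strictly_monotone_on (J k) S;
  bs_inverse : forall k, inverse_branch S (J k) w r;
  bs_eta : forall k x, J k x -> `|w x| <= eta;
  bs_beta : forall k x, J k x -> `|w x| <= beta k;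
  bs_beta0 : forall k, 0 <= beta k;
  bs_disj : trivIset [set: K] J;
  bs_full : leb.-negligible (`[0, 1] `\` \bigcup_k J k);
  bs_sum : exists M : R, forall s : seq K, uniq s -> \sum_(k <- s) beta k <= M }.

Definition expanding_system (S : R -> R) (eta : R) : Prop :=
  exists K J w r beta, @branch_system S eta K J w r beta.

Lemma sum_sub_uniq (K : eqType) (s t : seq K) (b : K -> R) : uniq s -> uniq t ->
  {subset s <= t} -> (forall k, 0 <= b k) -> \sum_(k <- s) b k <= \sum_(k <- t) b k.
Proof.
move=> us ut st b0; rewrite (bigID (mem s) predT b (r := t))/=.
rewrite -[X in _ <= X + _]big_filter (_ : \sum_(k <- s) b k = \sum_(k <- [seq i <- t | i \in s]) b k).
  by rewrite lerDl sumr_ge0.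
apply: perm_big; apply: uniq_perm => //; first exact: filter_uniq.
by move=> k; rewrite mem_filter; case: (boolP (k \in s)) => // /st ->.
Qed.

Lemma is_interval_monotone_preimage (T : R -> R) (J J' : set R) :
  is_interval J -> is_interval J' -> strictly_monotone_on J T ->
  is_interval (J `&` T @^-1` J').
Proof.
move=> iJ iJ' mT x y [Jx J'x] [Jy J'y] z /andP[xz zy].
have Jz : J z by apply: iJ Jx Jy _ _; rewrite xz zy.
split => //=; have [<-//|xz'] := eqVneq x z; have [->//|zy'] := eqVneq z y.
have {}xz : x < z by rewrite lt_neqAle xz'.
have {}zy : z < y by rewrite lt_neqAle zy'.
case: mT => mT.
  by apply: iJ' J'x J'y _ _; rewrite !ltW// mT.
by apply: iJ' J'y J'x _ _; rewrite !ltW// mT.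
Qed.

(** With [chi] a primitive of [psi], the identity for [S] says that on [J'] the
    function [chi(S) w'] plus the primitive of [chi(S) r'] is a primitive of
    [psi(S)]. Applying the identity for [T] to this primitive, and once more to
    the primitive of [chi(S) r'] alone, yields the identity for the composition:
    the weights multiply, as in the chain rule. *)
Lemma inverse_branch_comp (T S : R -> R) (J J' : set R) (w r w' r' : R -> R) :
  selfmap01 T -> selfmap01 S -> bm r -> bm w' -> bm r' ->
  J' `<=` `[0, 1] ->
  is_interval (J `&` T @^-1` J') ->
  inverse_branch T J w r -> inverse_branch S J' w' r' ->
  inverse_branch (S \o T) (J `&` T @^-1` J') (fun t => w' (T t) * w t)
    (fun t => r' (T t) * 1 + w' (T t) * r t).
Proof.
move=> [mT T01] [mS S01] br bw' br' J'01 iJJ bT bS x y psi chi.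
move=> [Jx J'x] [Jy J'y] xy bpsi bchi chiP /=.
have bpS : bm (fun z => psi (S z)) by exact: bm_comp.
have bcS : bm (fun z => chi (S z)) by exact: bm_comp.
have bp3 : bm (fun z => chi (S z) * r' z) by exact: bmM.
pose chi3 z := prim (fun z => chi (S z) * r' z) z - prim (fun z => chi (S z) * r' z) (T x).
pose chi1 z := prim (fun z => psi (S z)) z - prim (fun z => psi (S z)) (T x)
  + chi (S (T x)) * w' (T x).
have bchi3 : bm chi3 by apply: bmB; [exact: bm_prim|exact: bm_cst].
have bchi1 : bm chi1.
  by apply: bmD; [apply: bmB; [exact: bm_prim|exact: bm_cst]|exact: bm_cst].
have chi3P : primitive_on01 (fun z => chi (S z) * r' z) chi3.
  by move=> z z' z0 zz' z'1; rewrite /chi3 -primB//; ring.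
have chi1P : primitive_on01 (fun z => psi (S z)) chi1.
  by move=> z z' z0 zz' z'1; rewrite /chi1 -primB//; ring.
(* Both primitives are normalized at [T x], where the two sides agree. *)
have chi1E z : J' z -> chi1 z = chi (S z) * w' z + chi3 z.
  have H u v : J' u -> J' v -> u <= v -> chi1 v - chi1 u =
      chi (S v) * w' v - chi (S u) * w' u + (chi3 v - chi3 u).
    move=> J'u J'v uv.
    have /andP[u0 u1] : 0 <= u <= 1 by have := J'01 _ J'u; rewrite /= in_itv.
    have /andP[v0 v1] : 0 <= v <= 1 by have := J'01 _ J'v; rewrite /= in_itv.
    by rewrite chi1P// chi3P//; exact: bS.
  have c1 : chi1 (T x) = chi (S (T x)) * w' (T x) by rewrite /chi1 subrr add0r.
  have c3 : chi3 (T x) = 0 by rewrite /chi3 subrr.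
  move=> J'z; have [zT|/ltW Tz] := leP z (T x).
    by have := H _ _ J'z J'x zT; rewrite c1 c3; lra.
  by have := H _ _ J'x J'z Tz; rewrite c1 c3; lra.
rewrite (bT x y _ chi1 Jx Jy xy bpS bchi1 chi1P).
have := bT x y _ chi3 Jx Jy xy bp3 bchi3 chi3P.
rewrite !chi1E//.
rewrite (_ : \int[leb]_(t in `[x, y]) (chi1 (T t) * r t) =
  \int[leb]_(t in `[x, y]) (chi (S (T t)) * (w' (T t) * r t) + chi3 (T t) * r t)); last first.
  apply: eq_Rintegral => t; rewrite inE/= in_itv/= => txy.
  have [_ J't] := iJJ _ _ (conj Jx J'x) (conj Jy J'y) t txy.
  by rewrite chi1E//; ring.
have sxy := bm_set_cc x y.
have bcST : bm (fun t => chi (S (T t))) by exact: (bm_comp mT bcS).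
have bw'T : bm (fun t => w' (T t)) by exact: bm_comp.
have br'T : bm (fun t => r' (T t)) by exact: bm_comp.
have bc3T : bm (fun t => chi3 (T t)) by exact: bm_comp.
rewrite (bm_intD sxy (bmM bcST (bmM bw'T br)) (bmM bc3T br)).
rewrite (_ : \int[leb]_(t in `[x, y]) (chi (S (T t)) * (r' (T t) * 1 + w' (T t) * r t)) =
  \int[leb]_(t in `[x, y]) (chi (S (T t)) * r' (T t) + chi (S (T t)) * (w' (T t) * r t))); last first.
  by apply: eq_Rintegral => t _; ring.
rewrite (bm_intD sxy (bmM bcST br'T) (bmM bcST (bmM bw'T br))).
lra.
Qed.

Lemma negligible_bigcup_count (K : countType) (F : K -> set R) :
  (forall k, leb.-negligible (F k)) -> leb.-negligible (\bigcup_k F k).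
Proof.
move=> nF; pose G n := if @pickle_inv K n is Some k then F k else set0.
apply: (@negligibleS _ _ _ leb (\bigcup_n G n)).
  move=> t [k _ Fk]; exists (pickle k) => //.
  by rewrite /G pickleK_inv.
apply: negligible_bigcup => n; rewrite /G; case: pickle_inv => //.
exact: negligible_set0.
Qed.

(** The branch identity for the indicator of a null set, whose primitive is
    constantly zero, shows that the preimage is null. *)
Lemma negligible_branch_preimage (T : R -> R) (J A : set R) (w r : R -> R) :
  measurable_fun [set: R] T -> is_interval J -> J `<=` `[0, 1] ->
  inverse_branch T J w r -> bm r -> leb.-negligible A ->
  leb.-negligible (J `&` T @^-1` A).
Proof.
move=> mT iJ J01 bT br [B [mB B0 AB]].
exists (J `&` T @^-1` B).
have mJ : measurable J by exact: is_interval_measurable.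
have mTB : measurable (T @^-1` B) by rewrite -[X in measurable X]setTI; exact: mT.
split; [exact: measurableI| |by apply: setIS; exact: preimage_subset].
have bf : bm (fun t => \1_B (T t) : R) by apply: bm_comp => //; exact: bm_indic.
have sJ : bm_set leb J by exact: (bm_setS (bm_set_cc 0 1)).
have nB (D : set R) : measurable D -> D `<=` B -> fine (leb D) = 0.
  move=> mD DB; suff -> : leb D = 0%E by [].
  by apply/eqP; rewrite -measure_le0 -B0; apply: le_outer_measure.
have : `|\int[leb]_(t in J) (\1_B (T t) : R)| <= 0.
  apply: int_interval_bound => // x y Jx Jy xy.
  rewrite (bT x y (\1_B) (fun=> 0) Jx Jy xy); last 3 first.
  - exact: bm_indic.
  - exact: bm_cst.
  - move=> z z' z0 zz' z'1; rewrite subrr.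
    under eq_Rintegral do rewrite -[\1_B _]mulr1.
    rewrite (@bm_int_indic _ leb _ _ (fun=> 1) (bm_set_cc _ _) mB).
    rewrite bm_int_cst; last first.
      apply: (bm_setS (bm_set_cc z z')); last exact: subIsetl.
      exact: measurableI.
    by rewrite nB ?mulr0//; exact: measurableI.
  under eq_Rintegral do rewrite mul0r.
  by rewrite !mul0r subrr add0r Rintegral_cst// mul0r normr0.
rewrite normr_le0 => /eqP.
rewrite (_ : (fun t => \1_B (T t) : R) = (fun t => \1_(T @^-1` B) t * 1)); last first.
  by apply/funext => t; rewrite mulr1.
rewrite (@bm_int_indic _ leb _ _ (fun=> 1) sJ mTB).
have sI : bm_set leb (J `&` T @^-1` B).
  by apply: (bm_setS sJ); [exact: measurableI|exact: subIsetl].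
rewrite bm_int_cst// mul1r => h.
by rewrite -(@fineK _ (leb (J `&` T @^-1` B))) ?h// ge0_fin_numE//; case: sI.
Qed.

(** The branches of the composition are the intersections of a branch of [T] with
    the preimage of a branch of [S]; the bounds [beta] multiply, so that their
    sums do too. *)
Lemma expanding_system_comp (T S : R -> R) (eta eta' : R) :
  selfmap01 T -> selfmap01 S ->
  expanding_system T eta -> expanding_system S eta' ->
  expanding_system (S \o T) (eta' * eta).
Proof.
move=> sT sS [K [J [w [r [b H]]]]] [K' [J' [w' [r' [b' H']]]]].
have [mT T01] := sT; have [mS S01] := sS.
pose JJ (p : K * K') := J p.1 `&` T @^-1` J' p.2.
exists (K * K')%type, JJ, (fun t => w' (T t) * w t),
  (fun t => r' (T t) * 1 + w' (T t) * r t), (fun p => b' p.2 * b p.1).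
have bw := bs_bm_w H; have br := bs_bm_r H.
have bw' := bs_bm_w H'; have br' := bs_bm_r H'.
have iJJ p : is_interval (JJ p).
  apply: is_interval_monotone_preimage.
  - exact: bs_interval H _.
  - exact: bs_interval H' _.
  - exact: bs_mono H _.
split.
- by apply: bmM => //; exact: (bm_comp mT bw').
- apply: bmD; apply: bmM => //.
  + exact: (bm_comp mT br').
  + exact: bm_cst.
  + exact: (bm_comp mT bw').
- exact: iJJ.
- by move=> p t [Jt _]; exact: (bs_sub01 H) Jt.
- move=> p; have [m|m] := bs_mono H p.1; have [m'|m'] := bs_mono H' p.2.
  + by left=> x y [Jx J'x] [Jy J'y] xy; apply: m' => //; exact: m.
  + by right=> x y [Jx J'x] [Jy J'y] xy; apply: m' => //; exact: m.
  + by right=> x y [Jx J'x] [Jy J'y] xy; apply: m' => //; exact: m.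
  + by left=> x y [Jx J'x] [Jy J'y] xy; apply: m' => //; exact: m.
- move=> p; apply: inverse_branch_comp => //.
  + exact: bs_sub01 H' _.
  + exact: iJJ.
  + exact: bs_inverse H _.
  + exact: bs_inverse H' _.
- move=> p t [Jt J't]; rewrite normrM ler_pM//.
    exact: (bs_eta H') J't.
  exact: (bs_eta H) Jt.
- move=> p t [Jt J't]; rewrite normrM ler_pM//.
    exact: (bs_beta H') J't.
  exact: (bs_beta H) Jt.
- by move=> p; apply: mulr_ge0; [exact: bs_beta0 H' _|exact: bs_beta0 H _].
- move=> [k1 k1'] [k2 k2'] _ _ [t [[/= J1 J1'] [/= J2 J2']]].
  have -> : k1 = k2 by apply: (bs_disj H) => //; exists t.
  by have -> : k1' = k2' by apply: (bs_disj H') => //; exists (T t).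
- apply: (@negligibleS _ _ _ leb ((`[0, 1] `\` \bigcup_k J k) `|`
    \bigcup_k (J k `&` T @^-1` (`[0, 1] `\` \bigcup_k J' k)))); last first.
    apply: negligibleU; first exact: bs_full H.
    apply: negligible_bigcup_count => k.
    apply: negligible_branch_preimage => //.
    + exact: bs_interval H _.
    + exact: bs_sub01 H _.
    + exact: bs_inverse H _.
    + exact: br.
    + exact: bs_full H'.
  move=> t [t01 nt]; have [[k _ Jt]|nJ] := pselect ((\bigcup_k J k) t); last by left.
  right; exists k => //; split=> //; split; first by rewrite /= in_itv/=.
  by move=> [k' _ J't]; apply: nt; exists (k, k').
- have [M MP] := bs_sum H; have [M' MP'] := bs_sum H'.
  exists (M' * M) => s us.
  pose s1 := undup (map fst s); pose s2 := undup (map snd s).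
  apply: (@le_trans _ _ (\sum_(p <- [seq (i, j) | i <- s1, j <- s2]) (b' p.2 * b p.1))).
    apply: sum_sub_uniq => //.
    + by rewrite allpairs_uniq ?undup_uniq// => -[? ?] [? ?] _ _ [-> ->].
    + move=> [i j] ijs; apply/allpairsP; exists (i, j); split => //=.
        by rewrite mem_undup; apply/mapP; exists (i, j).
      by rewrite mem_undup; apply/mapP; exists (i, j).
    + by move=> p; apply: mulr_ge0; [exact: bs_beta0 H' _|exact: bs_beta0 H _].
  rewrite big_allpairs/= exchange_big/=.
  under eq_bigr do rewrite -mulr_sumr.
  rewrite -mulr_suml; apply: ler_pM.
  + by apply: sumr_ge0 => k _; exact: bs_beta0 H' _.
  + by apply: sumr_ge0 => k _; exact: bs_beta0 H _.
  + by apply: MP'; rewrite undup_uniq.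
  + by apply: MP; rewrite undup_uniq.
Qed.

End system.

(** * The Lasota-Yorke inequality in dual form *)

Section lasota_yorke.
Variable R : realType.
Notation leb := (@lebesgue_measure R).
Notation bm := (@bounded_measurable R).

(** The norm dual to the variation: integration by parts bounds the integral of
    [f psi] by the total variation of [f], plus its end value, times this bound
    on the primitive of [psi]. *)
Definition prim_le (psi : R -> R) (c : R) : Prop :=
  forall x, 0 <= x <= 1 -> `|\int[leb]_(t in `[0, x]) psi t| <= c.

Lemma prim_le_ge0 psi c : prim_le psi c -> 0 <= c.
Proof. by move=> /(_ 0); rewrite lexx ler01 => /(_ isT); apply: le_trans. Qed.

Lemma prim_le_bound psi (K : R) : bm psi -> 0 <= K ->
  (forall x, 0 <= x <= 1 -> `|psi x| <= K) -> prim_le psi K.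
Proof.
move=> bpsi K0 pK x /andP[x0 x1].
have H : forall t, `[0, x]%classic t -> `|psi t| <= K.
  move=> t /=; rewrite in_itv/= => /andP[t0 tx].
  by apply: pK; rewrite t0 (le_trans tx).
apply: (le_trans (bm_int_bound (bm_set_cc _ _) bpsi H)).
by rewrite fine_leb_cc// subr0 ler_piMr.
Qed.

Lemma prim_leD psi phi (c d : R) : bm psi -> bm phi ->
  prim_le psi c -> prim_le phi d -> prim_le (fun x => psi x + phi x) (c + d).
Proof.
move=> b1 b2 h1 h2 x x01; rewrite bm_intD//; last exact: bm_set_cc.
by apply: (le_trans (ler_normD _ _)); rewrite lerD ?h1 ?h2.
Qed.

Lemma prim_leW psi (c d : R) : prim_le psi c -> c <= d -> prim_le psi d.
Proof. by move=> h cd x x01; apply: le_trans (h x x01) cd. Qed.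

(** The dual form of [Var(L f) <= theta Var(f) + B |f|_1]: when [f] is integrated
    against [psi(S)], the part [a] is controlled by the variation of [f] and the
    remainder by its [L1] norm. *)
Definition lasota_yorke (S : R -> R) (theta B : R) : Prop :=
  forall psi c, bm psi -> prim_le psi c -> exists a rem : R -> R,
    [/\ bm a, bm rem, (forall t, psi (S t) = a t + rem t),
        prim_le a (theta * c) & forall t, `|rem t| <= B * c].

(** A finite part of a countable partition leaves a remainder, which
    [cover_finite] makes small. *)
Lemma int_partition_finite (K : countType) (J : K -> set R) (s : seq K) (A : set R)
  (f : R -> R) : uniq s -> bm f -> bm_set leb A ->
  (forall k, measurable (J k)) -> trivIset [set: K] J ->
  \int[leb]_(t in A) f t = \sum_(k <- s) \int[leb]_(t in A `&` J k) f t +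
    \int[leb]_(t in A `\` \big[setU/set0]_(k <- s) J k) f t.
Proof.
move=> us bf sA mJ tJ; elim: s us => [_|k s ih /= /andP[ks us]].
  by rewrite !big_nil add0r setD0.
have mU : measurable (\big[setU/set0]_(k <- s) J k : set R).
  by apply: bigsetU_measurable => i _; exact: mJ.
rewrite ih// !big_cons; set U := \big[setU/set0]_(k <- s) J k in mU *.
have sAU : bm_set leb (A `\` U).
  by apply: (bm_setS sA); [apply: measurableD => //; case: sA|exact: subDsetl].
rewrite (bm_int_setID sAU (mJ k) bf) (addrC _ (\sum_(j <- s) _)) -addrA.
have kU t : J k t -> ~ U t.
  rewrite /U -bigcup_seq => Jt [j js Jj]; move: ks.
  by rewrite (tJ k j)//; [rewrite js|exists t].
congr (_ + (_ + _)).
  congr Rintegral; apply/seteqP; split=> [t [[]]//|t [At Jt]].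
  by split=> //; split=> //; exact: kU.
congr Rintegral; rewrite setDUr; apply/seteqP; split=> t.
  by move=> [[At Ut] Jt].
by move=> [[At Jt] [_ Ut]].
Qed.

Lemma cover_finite (K : countType) (J : K -> set R) (e : R) :
  (forall k, measurable (J k)) -> leb.-negligible (`[0, 1] `\` \bigcup_k J k) ->
  0 < e -> exists s : seq K, uniq s /\
    fine (leb (`[0, 1] `\` \big[setU/set0]_(k <- s) J k)) <= e.
Proof.
move=> mJ nJ e0.
pose s n := pmap (@pickle_inv K) (iota 0 n).
pose F n : set R := `[0, 1] `\` \big[setU/set0]_(k <- s n) J k.
have us n : uniq (s n).
  by apply: (pmap_uniq (g := pickle)); [exact: pickle_invK|exact: iota_uniq].
have mU n : measurable (\big[setU/set0]_(k <- s n) J k : set R).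
  by apply: bigsetU_measurable => i _; exact: mJ.
have mF n : measurable (F n) by apply: measurableD => //; exact: measurable_itv.
have sF n : bm_set leb (F n).
  by apply: (bm_setS (bm_set_cc 0 1) (mF n)); apply: subDsetl.
have bF : \bigcap_n F n `<=` `[0, 1] `\` \bigcup_k J k.
  move=> t Ft; split; first by have [] := Ft 0%N I.
  move=> [k _ Jt]; have [_] := Ft (pickle k).+1 I; apply.
  rewrite -bigcup_seq; exists k => //=; rewrite mem_pmap.
  by apply/mapP; exists (pickle k); rewrite ?mem_iota ?pickleK_inv// add0n /= ltnS.
have bF0 : leb (\bigcap_n F n) = 0%E.
  apply/eqP; rewrite -measure_le0; have [B [mB B0 FB]] := nJ.
  by rewrite -B0; apply: le_outer_measure; exact: subset_trans FB.
have h : leb (F n) @[n --> \oo] --> 0%E.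
  rewrite -bF0; apply: (nonincreasing_cvg_mu (sF 0%N).2 mF).
    by apply: bigcap_measurableType => k _; exact: mF.
  move=> n m nm; apply/subsetPset => t [t01 nt]; split=> //.
  rewrite -bigcup_seq => -[k /= kn Jt]; apply: nt.
  rewrite -bigcup_seq; exists k => //=; move: kn; rewrite !mem_pmap.
  move=> /mapP[i]; rewrite mem_iota/= add0n => ki ->; apply/mapP; exists i => //.
  by rewrite mem_iota/= add0n (leq_trans ki).
move/fine_cvgP: h => [_ /cvgrPdist_le /(_ _ e0) [N _ /(_ N (leqnn N))]] /=.
rewrite sub0r normrN => FN; exists (s N); split => //.
exact: le_trans (ler_norm _) FN.
Qed.

Lemma tail_small (K : eqType) (b : K -> R) (M e : R) :
  (forall k, 0 <= b k) -> (forall s, uniq s -> \sum_(k <- s) b k <= M) ->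
  0 < e -> exists s0 : seq K, uniq s0 /\
    forall s, uniq s -> (forall k, k \in s -> k \notin s0) -> \sum_(k <- s) b k <= e.
Proof.
move=> b0 bM e0.
pose E := [set \sum_(k <- s) b k | s in [set s : seq K | uniq s]].
have sE : has_sup E.
  split; first by exists 0, [::] => //; rewrite big_nil.
  by exists M => _ [s us <-]; exact: bM.
have [_ [s0 us0 <-] h] := sup_adherent e0 sE.
exists s0; split => // s us ss0.
have : E (\sum_(k <- s ++ s0) b k).
  exists (s ++ s0) => //=; rewrite cat_uniq us us0 andbT/=.
  by apply/hasPn => k ks0; apply/negP => /ss0; rewrite ks0.
move/(ub_le_sup (proj2 sE)); rewrite big_cat/=; lra.
Qed.

(** By the branch identity, [psi(S) - chi(S) r] has integral at most [2 c eta] over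
    any subinterval of a branch, and [chi(S) r] is bounded. A primitive over
    [0, x] however adds up the contributions of all the branches on the left of
    [x]. The branches outside a finite set [s0] contribute little because [beta]
    is summable. On each branch of [s0] a constant, its mean value, is moved to
    the remainder: complete branches then contribute nothing, and only the branch
    containing [x] is left, which counts [4 c eta]. The price is a constant [B]
    depending on the lengths of the finitely many branches in [s0]. *)
Theorem lasota_yorke_system (S : R -> R) (eta : R) : 0 < eta ->
  selfmap01 S -> expanding_system S eta ->
  exists2 B : R, 0 <= B & lasota_yorke S (5 * eta) B.
Proof.
move=> eta0 [mS S01] [K [J [w [r [beta H]]]]].
have [M MP] := bs_sum H.
have [s0 [us0 s0P]] := tail_small (bs_beta0 H) MP (divr_gt0 eta0 (ltr0n R 2)).
have [_ [C CP]] := bs_bm_r H.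
have C0 : 0 <= C by exact: le_trans (CP 0).
have etaP k x : J k x -> `|w x| <= eta by exact: (bs_eta H).
have betaP k x : J k x -> `|w x| <= beta k by exact: (bs_beta H).
have beta0 k : 0 <= beta k by exact: (bs_beta0 H).
have iJ k : is_interval (J k) by exact: (bs_interval H).
have JJ k l t : J k t -> J l t -> k = l.
  by move=> Jk Jl; apply: (bs_disj H) => //; exists t.
have eta0' := ltW eta0.
have mJ k : measurable (J k) by apply: is_interval_measurable; exact: bs_interval H _.
have sJ k : bm_set leb (J k).
  by apply: (bm_setS (bm_set_cc 0 1) (mJ k)) => t; exact: (bs_sub01 H).
have len0 k : 0 <= fine (leb (J k)) by exact: fine_ge0.
(* The first term bounds [chi(S) r], the second one the mean values on [s0]. *)
pose B := C + \sum_(k <- s0) (2 * eta / fine (leb (J k))).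
have sB0 : 0 <= \sum_(k <- s0) (2 * eta / fine (leb (J k))).
  by apply: sumr_ge0 => k _; rewrite divr_ge0// mulr_ge0// ltW.
exists B; first by rewrite addr_ge0.
move=> psi c bpsi psic; have c0 := prim_le_ge0 psic.
pose chi := prim psi.
have chic z : `|chi z| <= c by apply: psic; exact: clamp_in.
have bchi : bm chi by exact: bm_prim.
have br := bs_bm_r H.
have bcr : bm (fun t => chi (S t) * r t) by apply: bmM => //; exact: bm_comp.
pose f t := psi (S t) - chi (S t) * r t.
have bf : bm f by apply: bmB => //; exact: bm_comp.
have fxy k x y : J k x -> J k y -> x <= y ->
    \int[leb]_(t in `[x, y]) f t = chi (S y) * w y - chi (S x) * w x.
  move=> Jx Jy xy; rewrite /f bm_intB//; [|exact: bm_set_cc|exact: bm_comp].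
  rewrite (bs_inverse H Jx Jy xy bpsi bchi); first by rewrite addrK.
  exact: prim_primitive.
have fle k b I : 0 <= b -> (forall x, J k x -> `|w x| <= b) -> is_interval I ->
    I `<=` J k -> `|\int[leb]_(t in I) f t| <= 2 * c * b.
  move=> b0 wb iI IJ; apply: int_interval_bound => //.
  - by move=> t /IJ; exact: bs_sub01 H _ _.
  - by rewrite !mulr_ge0.
  - move=> x y /IJ Jx /IJ Jy xy; rewrite (fxy k)//.
    apply: (le_trans (ler_normB _ _)).
    rewrite (_ : 2 * c * b = c * b + c * b); last by ring.
    by rewrite lerD// normrM ler_pM// wb.
pose slope k := (\int[leb]_(t in J k) f t) / fine (leb (J k)).
pose g t := \sum_(k <- s0) slope k * \1_(J k) t.
have bg : bm g by apply: bm_sum => k; apply: bmZ; exact: (bm_indic (mJ k)).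
exists (fun t => f t - g t), (fun t => chi (S t) * r t + g t).
have ba : bm (fun t => f t - g t) by exact: bmB.
split => //.
- exact: bmD.
- by move=> t; rewrite /f; ring.
- have slope_le k : `|slope k| * fine (leb (J k)) <= 2 * c * eta.
    have fJ : `|\int[leb]_(t in J k) f t| <= 2 * c * eta.
      exact: (fle k eta (J k) eta0' (etaP k) (iJ k) (fun _ => id)).
    rewrite /slope normrM normfV (ger0_norm (len0 k)).
    have [->|n0] := eqVneq (fine (leb (J k))) 0.
      by rewrite mulr0 !mulr_ge0// ltW.
    by rewrite divfK.
  have aJ k t : k \notin s0 -> J k t -> f t - g t = f t.
    move=> ks0 Jt; rewrite /g big1_seq ?subr0// => i /andP[_ is0].
    rewrite indicE memNset ?mulr0// => Jit.
    move: ks0; by rewrite (JJ _ _ _ Jt Jit) is0.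
  have aJ' k t : k \in s0 -> J k t -> f t - g t = f t - slope k.
    move=> ks0 Jt; rewrite /g (bigD1_seq k)//= indicE mem_set// mulr1 big1_seq ?addr0//.
    move=> i /andP[ik is0]; rewrite indicE memNset ?mulr0// => Jit.
    move: ik; by rewrite (JJ _ _ _ Jit Jt) eqxx.
  move=> x /andP[x0 x1].
  have [_ [Ka KaP]] := ba.
  have Ka0 : 0 <= Ka by exact: le_trans (KaP 0).
  apply/ler_addgt0Pr => e e0.
  have e1 : 0 < e / (Ka + 1) by apply: divr_gt0 => //; lra.
  have [s [us sP]] := cover_finite mJ (bs_full H) e1.
  pose s1 := [seq k <- s | k \notin s0].
  have us1 : uniq (s1 ++ s0).
    rewrite cat_uniq us0 filter_uniq//= andbT; apply/hasPn => k ks0.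
    by rewrite mem_filter ks0.
  have s0x := bm_set_cc 0 x.
  rewrite (int_partition_finite us1 ba s0x mJ (bs_disj H)) big_cat/=.
  have mU : measurable (\big[setU/set0]_(k <- s1 ++ s0) J k : set R).
    by apply: bigsetU_measurable => i _; exact: mJ.
  have rest : `|\int[leb]_(t in `[0, x] `\` \big[setU/set0]_(k <- s1 ++ s0) J k)
      (f t - g t)| <= e.
    set A := _ `\` _.
    have sA : bm_set leb A.
      by apply: (bm_setS s0x); [apply: measurableD|exact: subDsetl].
    apply: (le_trans (bm_int_bound sA ba (fun t _ => KaP t))).
    apply: (@le_trans _ _ (Ka * (e / (Ka + 1)))).
      apply: ler_wpM2l => //; apply: le_trans sP.
      apply: fine_le.
      - by rewrite ge0_fin_numE//; case: sA.
      - rewrite ge0_fin_numE//; have [] // := @bm_setS _ leb _ (`[0, 1] `\` \big[setU/set0]_(k <- s) J k) (bm_set_cc 0 1).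
          apply: measurableD => //; apply: bigsetU_measurable => i _; exact: mJ.
      - apply: le_outer_measure => t [/= + nt]; rewrite in_itv/= => /andP[t0 tx].
        split; first by rewrite /= in_itv/= t0 (le_trans tx).
        rewrite -bigcup_seq => -[k /= ks Jt]; apply: nt.
        rewrite -bigcup_seq; exists k => //=; rewrite mem_cat mem_filter ks andbT.
        by case: (_ \in s0).
    rewrite mulrA ler_pdivrMr; last lra.
    by rewrite mulrC ler_pM2l//; lra.
  have i0x : is_interval `[0, x].
    exact: interval_is_interval.
  have iI k : is_interval (`[0, x] `&` J k).
    move=> u v [u1 u2] [v1 v2] z uzv; split; first exact: i0x u1 v1 z uzv.
    exact: iJ u2 v2 z uzv.
  have sI k : bm_set leb (`[0, x] `&` J k).
    by apply: (bm_setS s0x (measurableI _ _ s0x.1 (mJ k))); apply: subIsetl.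
  have S1 : `|\sum_(k <- s1) \int[leb]_(t in `[0, x] `&` J k) (f t - g t)| <= c * eta.
    apply: (le_trans (ler_norm_sum _ _ _)).
    apply: (@le_trans _ _ (\sum_(k <- s1) (2 * c * beta k))).
      rewrite big_seq [leRHS]big_seq; apply: ler_sum => k.
      rewrite mem_filter => /andP[ks0 _].
      rewrite (_ : \int[_]_(_ in _) _ = \int[leb]_(t in `[0, x] `&` J k) f t).
        exact: (fle k (beta k) _ (beta0 k) (betaP k) (iI k) (@subIsetr _ _ _)).
      by apply: eq_Rintegral => t; rewrite inE => -[_ Jt]; exact: aJ Jt.
    rewrite -mulr_sumr (_ : c * eta = 2 * c * (eta / 2)); last by field.
    apply: ler_wpM2l; first by rewrite mulr_ge0.
    apply: s0P; first exact: filter_uniq.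
    by move=> k; rewrite mem_filter => /andP[].
  have S0 : `|\sum_(k <- s0) \int[leb]_(t in `[0, x] `&` J k) (f t - g t)| <= 4 * (c * eta).
    (* A branch of [s0] not containing [x] lies on one side of it: it is
       missed altogether, or covered completely and then balanced by its slope. *)
    have zero k : k \in s0 -> ~ J k x ->
        \int[leb]_(t in `[0, x] `&` J k) (f t - g t) = 0.
      move=> ks0 nJx; rewrite (_ : \int[_]_(_ in _) _ =
        \int[leb]_(t in `[0, x] `&` J k) (f t - slope k)); last first.
        by apply: eq_Rintegral => t; rewrite inE => -[_ Jt]; exact: aJ' Jt.
      have [->|/set0P[u [u0x Ju]]] := eqVneq (`[0, x] `&` J k) set0.
        by rewrite Rintegral_set0.
      rewrite setIidr; last first.
        move=> v Jv; rewrite /= in_itv/=; apply/andP; split.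
          by have := bs_sub01 H Jv; rewrite /= in_itv/= => /andP[].
        rewrite leNgt; apply/negP => xv; apply: nJx.
        apply: iJ Ju Jv _ _; rewrite (ltW xv) andbT.
        by move: u0x; rewrite /= in_itv/= => /andP[].
      rewrite bm_intB//; last exact: bm_cst.
      rewrite bm_int_cst// /slope.
      have [l0|l0] := eqVneq (fine (leb (J k))) 0; last by rewrite divfK// subrr.
      rewrite l0 invr0 !mulr0 subr0.
      apply/eqP; rewrite -normr_le0.
      have [_ [Kf KfP]] := bf.
      apply: (le_trans (bm_int_bound (sJ k) bf (fun t _ => KfP t))).
      by rewrite l0 mulr0.
    have [[k [ks0 Jkx]]|nk] := pselect (exists k, k \in s0 /\ J k x); last first.
      rewrite big1_seq ?normr0 ?mulr_ge0// ?ltW// => k /andP[_ ks0].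
      by apply: zero => // Jx; apply: nk; exists k.
    rewrite (bigD1_seq k)//= big1_seq ?addr0; last first.
      move=> i /andP[ik is0]; apply: zero => // Jix; move: ik.
      by rewrite (JJ _ _ _ Jix Jkx) eqxx.
    rewrite (_ : \int[_]_(_ in _) _ =
        \int[leb]_(t in `[0, x] `&` J k) (f t - slope k)); last first.
      by apply: eq_Rintegral => t; rewrite inE => -[_ Jt]; exact: aJ' Jt.
    rewrite bm_intB//; last exact: bm_cst.
    rewrite bm_int_cst//; apply: (le_trans (ler_normB _ _)).
    rewrite (_ : 4 * (c * eta) = 2 * c * eta + 2 * c * eta); last by ring.
    apply: lerD.
      exact: (fle k eta _ eta0' (etaP k) (iI k) (@subIsetr _ _ _)).
    apply: le_trans (slope_le k); rewrite normrM; apply: ler_wpM2l => //.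
    rewrite ger0_norm ?fine_ge0//; apply: fine_le.
    - by rewrite ge0_fin_numE//; case: (sI k).
    - by rewrite ge0_fin_numE//; case: (sJ k).
    - by apply: le_outer_measure; exact: subIsetr.
  apply: (le_trans (ler_normD _ _)); apply: lerD => //.
  apply: (le_trans (ler_normD _ _)); apply: (le_trans (lerD S1 S0)).
  by rewrite le_eqVlt; apply/orP; left; apply/eqP; ring.
- move=> t; rewrite /B mulrDl; apply: (le_trans (ler_normD _ _)); apply: lerD.
    by rewrite normrM mulrC ler_pM.
  apply: (le_trans (ler_norm_sum _ _ _)); rewrite mulr_suml; apply: ler_sum => k _.
  rewrite normrM; apply: (@le_trans _ _ (`|slope k|)).
    rewrite ler_piMr// indicE; case: (_ \in _); by rewrite ?normr1 ?normr0.
  rewrite /slope normrM normfV (ger0_norm (len0 k)) mulrAC.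
  apply: ler_wpM2r; first by rewrite invr_ge0.
  rewrite (_ : 2 * eta * c = 2 * c * eta); last by ring.
  exact: (fle k eta (J k) eta0' (etaP k) (iJ k) (fun _ => id)).
Qed.

End lasota_yorke.

(** * The branches of a piecewise expanding map *)

Section interval_branch.
Variable R : realType.
Notation leb := (@lebesgue_measure R).
Notation bm := (@bounded_measurable R).

Lemma derivative_within_interior (A : set R) (f : R -> R) (x l : R) :
  A° x -> derivative_within A f x l -> is_derive x 1 f l.
Proof.
move=> Ax fl.
have phiP : h + x @[h --> 0^'] --> within A x^'.
  move=> P /= wP.
  have : nbhs x (fun y => y != x -> P y).
    have wP' : nbhs x (fun y => y != x -> A y -> P y) := wP.
    by apply: filterS2 wP' Ax => y yP Ay yx; exact: yP.
  move=> /nbhs_ballP[e /= e0 eP]; apply/nbhs_ballP; exists e => //= h.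
  rewrite /ball/= sub0r normrN => he h0; apply: eP.
    by rewrite /ball/= opprD addrC addrNK normrN.
  by rewrite -subr_eq0 addrK.
have H : (h^-1 *: ((f \o shift x) (h *: (1 : R)) - f x)) @[h --> 0^'] --> l.
  have := @cvg_comp _ _ _ (fun h => h + x) (fun y => (f y - f x) / (y - x)) _ _ _ phiP fl.
  apply: cvg_trans; apply: near_eq_cvg.
  near=> h; rewrite /= addrK mulrC; congr (_ * (f _ - _)).
  by rewrite /GRing.scale/= mulr1.
split; first by apply/cvg_ex; exists l.
by apply/cvg_lim => //; exact: norm_hausdorff.
Unshelve. all: by end_near. Qed.

Lemma continuous_within_interior (A : set R) (f : R -> R) (x : R) :
  A° x -> {within A, continuous f} -> {for x, continuous f}.
Proof.
move=> Ax /subspace_continuousP /(_ x (interior_subset Ax)).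
by rewrite /prop_for /continuous_at (within_interior Ax).
Qed.

Lemma is_interval_interior (I : set R) : is_interval I -> is_interval I°.
Proof.
move=> iI x y Ix Iy z /andP[xz zy].
have [->//|xz'] := eqVneq z x; have [->//|zy'] := eqVneq z y.
have {}xz : x < z by rewrite lt_neqAle eq_sym xz'.
have {}zy : z < y by rewrite lt_neqAle zy'.
have oI : open (`]x, y[%classic : set R) by exact: interval_open.
apply: (@filterS _ _ _ (`]x, y[%classic : set R)).
  move=> t /=; rewrite in_itv/= => /andP[xt ty].
  apply: (iI x y) => //; [exact: interior_subset|exact: interior_subset|].
  by rewrite !ltW.
by apply: oI; rewrite /= in_itv/= xz zy.
Qed.

(** In particular a partition into intervals is, up to countably many points, a
    family of disjoint open intervals. *)
Lemma interval_diff_interior (I : set R) : is_interval I -> I `<=` `[0, 1] ->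
  I `\` I° `<=` [set inf I; sup I].
Proof.
move=> iI I01 t [It nt].
have hi : has_inf I.
  by split; [exists t|exists 0 => u /I01/=; rewrite in_itv/= => /andP[]].
have hs : has_sup I.
  by split; [exists t|exists 1 => u /I01/=; rewrite in_itv/= => /andP[]].
have ti : inf I <= t by apply: ge_inf => //; case: hi.
have ts : t <= sup I by apply: ub_le_sup => //; case: hs.
have [->|ti'] := eqVneq t (inf I); first by left.
have [->|ts'] := eqVneq t (sup I); first by right.
exfalso; apply: nt.
have d1 : 0 < t - inf I by rewrite subr_gt0 lt_neqAle eq_sym ti'.
have d2 : 0 < sup I - t by rewrite subr_gt0 lt_neqAle ts'.
have [u Iu ut] := inf_adherent d1 hi; have [v Iv tv] := sup_adherent d2 hs.
have oI : open (`]u, v[%classic : set R) by exact: interval_open.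
apply: (@filterS _ _ _ (`]u, v[%classic : set R)).
  move=> z /=; rewrite in_itv/= => /andP[uz zv].
  by apply: (iI u v) => //; rewrite !ltW.
by apply: oI; rewrite /= in_itv/=; apply/andP; split; lra.
Qed.

Lemma leb_image_sub2 (T : R -> R) (A : set R) (a b : R) : A `<=` [set a; b] ->
  leb (T @` A) = 0%E.
Proof.
move=> Aab; apply/eqP; rewrite -measure_le0.
apply: (@le_trans _ _ (leb ([set T a] `|` [set T b]))).
  by apply: le_outer_measure => _ [t /Aab[->|->] <-]; [left|right].
apply: (le_trans (outer_measureU2 leb _ _)).
by rewrite [X in (X + _)%E](lebesgue_measure_set1 (T a))
  [X in (_ + X)%E](lebesgue_measure_set1 (T b)) adde0.
Qed.

(** The values of [T] outside [0, 1] are arbitrary, possibly not measurable; the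
    extension by zero is a measurable map of the line into [0, 1] with the same
    orbits in [0, 1]. *)
Definition extend01 (T : R -> R) (x : R) : R := if x \in `[0, 1] then T x else 0.

(** Adler's condition gives [|w'| <= C], so [w] varies by at most [C |I|] on [I]. If
    [|w|] exceeded [(C + 1/delta) |I|] at a point, it would exceed [|I| / delta]
    everywhere, and then [T], whose derivative is [1/w], would map [I] onto a set
    of measure less than [delta]. As the lengths [|I|] of the branches add up to
    at most [1], the suprema of [|w|] are summable. *)
Lemma branch_weight_bound (T w r : R -> R) (I : set R) (C delta : R) :
  is_interval I -> I `<=` `[0, 1] -> 0 < C -> 0 < delta ->
  (forall x, I° x -> [/\ w x != 0, is_derive x 1 T (w x)^-1,
    is_derive x 1 w (- r x) & `|r x| <= C]) ->
  (delta%:E <= leb (T @` I))%E ->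
  forall x, I° x -> `|w x| <= (C + delta^-1) * fine (leb I°).
Proof.
move=> iI I01 C0 d0 HI dI t0 It0; rewrite leNgt; apply/negP => wt0.
have iI' := is_interval_interior iI.
have mI' : measurable I° by exact: is_interval_measurable.
have sI' : bm_set leb I°.
  apply: (bm_setS (bm_set_cc 0 1) mI').
  by apply: subset_trans I01; exact: interior_subset.
set L := fine (leb I°) in wt0.
have L0 : 0 <= L by exact: fine_ge0.
have diam s t : I° s -> I° t -> `|t - s| <= L.
  wlog st : s t / s <= t.
    move=> H; have [/H//|/ltW/H h] := leP s t.
    by move=> Is It; rewrite distrC; exact: h.
  move=> Is It; rewrite ger0_norm ?subr_ge0// -fine_leb_cc//.
  apply: fine_le.
  - by rewrite ge0_fin_numE//; case: (bm_set_cc s t).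
  - by rewrite ge0_fin_numE//; case: sI'.
  - by apply: le_outer_measure => u /=; rewrite in_itv/=; exact: iI'.
have mvt (f df : R -> R) (K : R) : (forall x, I° x -> is_derive x 1 f (df x)) ->
    (forall x, I° x -> `|df x| <= K) ->
    forall s t, I° s -> I° t -> `|f t - f s| <= K * L.
  move=> fdf dfK s t; wlog st : s t / s < t.
    move=> H Is It; have [/H//|/H h|->] := ltgtP s t.
    - exact.
    - by rewrite distrC; exact: h.
    - rewrite subrr normr0 mulr_ge0//.
      exact: le_trans (normr_ge0 _) (dfK _ It).
  move=> Is It; have Ist x : x \in `[s, t] -> I° x by rewrite in_itv/=; exact: iI'.
  have [c cst ->] : exists2 c, c \in `]s, t[ & f t - f s = df c * (t - s).
    apply: (@MVT _ f df) => //.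
      by move=> x xst; apply: fdf; apply: Ist; exact: subset_itv_oo_cc.
    apply: derivable_within_continuous => x xst.
    by have h := fdf _ (Ist _ xst); exact: ex_derive.
  rewrite normrM ler_pM//; first by apply: dfK; apply: Ist; exact: subset_itv_oo_cc.
  exact: diam.
pose m := `|w t0| - C * L.
have mL : L / delta < m by rewrite /m; move: wt0; rewrite mulrDl (mulrC delta^-1); lra.
have m0 : 0 < m by apply: le_lt_trans mL; rewrite divr_ge0// ltW.
have wm t : I° t -> m <= `|w t|.
  move=> It; have := @mvt w (fun x => - r x) C _ _ t t0 It It0.
  move=> /(_ _ _)H; have {}H : `|w t0 - w t| <= C * L.
    by apply: H => x Ix; have [? ? ? ?] := HI x Ix; rewrite ?normrN.
  by have := lerB_dist (w t0) (w t); rewrite /m; lra.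
have TL s t : I° s -> I° t -> T t - T s <= L / m.
  move=> Is It; apply: (le_trans (ler_norm _)); rewrite mulrC.
  apply: (@mvt T (fun x => (w x)^-1)) => // x Ix.
    by have [] := HI x Ix.
  by rewrite normfV lef_pV2 ?posrE ?wm//; apply: lt_le_trans m0 (wm _ Ix).
have : (leb (T @` I) <= (L / m)%:E)%E.
  apply: (@le_trans _ _ (leb (T @` I° `|` T @` (I `\` I°)))).
    apply: le_outer_measure => _ [u Iu <-].
    have [Iu'|nIu] := pselect (I° u); first by left; exists u.
    by right; exists u.
  apply: (le_trans (outer_measureU2 _ _ _)).
  rewrite [X in (_ + X)%E](leb_image_sub2 _ (interval_diff_interior iI I01)) adde0.
  apply: lebesgue_measure_diam; first by rewrite divr_ge0// ltW.
  by move=> _ _ [s Is <-] [t It <-]; exact: TL.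
move/(le_trans dI); rewrite lee_fin ler_pdivlMr//.
by move: mL; rewrite ltr_pdivrMr// => mL; lra.
Qed.

End interval_branch.

Section base_system.
Variable R : realType.
Notation leb := (@lebesgue_measure R).
Notation bm := (@bounded_measurable R).

Lemma strictly_monotone_measurable (I : set R) (f : R -> R) :
  is_interval I -> strictly_monotone_on I f -> measurable_fun I f.
Proof.
move=> iI mf; have mI : measurable I by exact: is_interval_measurable.
apply: (measurability (@RGenCInfty.G R)) => [|/= _ [_] [r] -> <-].
  exact: RGenCInfty.measurableE.
apply: is_interval_measurable => x y [Ix /=].
rewrite !in_itv/= !andbT => fx [Iy] fy z /andP[xz zy].
split; first by apply: (iI x y) => //; rewrite xz zy.
have Iz : I z by apply: (iI x y) => //; rewrite xz zy.
have [->|xz'] := eqVneq z x; first by rewrite /= in_itv/= andbT.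
have [->|zy'] := eqVneq z y; first by rewrite /= in_itv/= andbT.
rewrite /= in_itv/= andbT.
case: mf => mf.
  by apply: (le_trans fx); apply/ltW/mf; rewrite // lt_neqAle eq_sym xz'.
by apply: (le_trans fy); apply/ltW/mf; rewrite // lt_neqAle zy'.
Qed.

Lemma bm_continuous_on_open (U : set R) (f : R -> R) (K : R) : open U ->
  (forall x, U x -> {for x, continuous f}) -> (forall x, ~ U x -> f x = 0) ->
  0 <= K -> (forall x, U x -> `|f x| <= K) -> bm f.
Proof.
move=> oU cf f0 K0 fK; split; last first.
  exists K => x; have [/fK//|/f0->] := pselect (U x).
  by rewrite normr0.
have -> : f = f \_ U.
  apply/funext => x; rewrite patchE; case: ifPn => //.
  by rewrite notin_setE => /f0.
apply/(measurable_restrictT _ (open_measurable oU)).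
by apply: open_continuous_measurable_fun => // x; rewrite inE; exact: cf.
Qed.

Lemma extend01E (T : R -> R) x : 0 <= x <= 1 -> extend01 T x = T x.
Proof. by move=> x01; rewrite /extend01 in_itv/= x01. Qed.

Section from_piecewise.
Variables (T : R -> R) (D : set nat) (I : nat -> set R) (C lambda delta : R).
Hypotheses (T01 : forall x, x \in `[0, 1] -> T x \in `[0, 1])
  (pDI : partition D I `[0, 1]%classic)
  (iI : forall n, D n -> is_interval (I n))
  (C0 : 0 < C) (lambda1 : 1 < lambda) (delta0 : 0 < delta)
  (brI : forall n, D n -> (I n)° !=set0 -> expanding_branch T C lambda (I n))
  (longI : forall n, D n -> (I n)° !=set0 ->
     (delta%:E <= lebesgue_measure (T @` I n))%E).

Let T' := extend01 T.

Let I01 n : D n -> I n `<=` `[0, 1].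
Proof. by move=> Dn; case: pDI => <- _ _; exact: bigcup_sup. Qed.

Let T'I n x : D n -> I n x -> T' x = T x.
Proof.
move=> Dn Inx; rewrite /T' extend01E//.
by have := I01 Dn Inx; rewrite /= in_itv.
Qed.

Let mono' n : D n -> strictly_monotone_on (I n) T'.
Proof.
move=> Dn; have [e|/set0P ne] := eqVneq (I n)° set0.
  left => x y Inx Iny xy; exfalso.
  have : (I n)° ((x + y) / 2).
    apply: (@filterS _ _ _ (`]x, y[%classic : set R)).
      move=> t /=; rewrite in_itv/= => /andP[xt ty].
      by apply: (iI Dn Inx Iny); rewrite !ltW.
    have oI : open (`]x, y[%classic : set R) by exact: interval_open.
    by apply: oI; rewrite /= in_itv/=; apply/andP; split; lra.
  by rewrite e.
have [m _] := brI Dn ne.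
case: m => m; [left|right] => x y Inx Iny xy; rewrite !(T'I Dn)//; exact: m.
Qed.

Lemma extend01_selfmap : selfmap01 T'.
Proof.
split; last first.
  move=> x; rewrite /T' /extend01; case: ifPn => [/T01|_]; first by rewrite in_itv.
  by rewrite lexx ler01.
pose E n := if `[< D n >] then I n else set0.
have mE n : measurable (E n).
  rewrite /E; case: ifPn => // /asboolP Dn; apply: is_interval_measurable.
  exact: iI.
have UE : `[0, 1]%classic = \bigcup_n E n.
  case: pDI => <- _ _; apply/seteqP; split => t [n].
    by move=> Dn Int; exists n => //; rewrite /E asboolT.
  by move=> _; rewrite /E; case: ifPn => // /asboolP Dn Int; exists n.
have -> : T' = T' \_ `[0, 1]%classic.
  apply/funext => x; rewrite patchE; case: ifPn => //.
  by rewrite notin_setE /T' /extend01 => /negP/negbTE ->.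
apply/(measurable_restrictT _ (measurable_itv `[0, 1])).
rewrite UE; apply/measurable_fun_bigcup => // n.
rewrite /E; case: ifPn => [/asboolP Dn|_].
  by apply: strictly_monotone_measurable; [exact: iI|exact: mono'].
exact: measurable_fun_set0.
Qed.

Let J n : set R := if `[< D n >] then (I n)° else set0.

Let JP n t : J n t -> D n /\ (I n)° t.
Proof. by rewrite /J; case: ifPn => // /asboolP Dn. Qed.

Let U : set R := \bigcup_n J n.

Let oJ n : open (J n).
Proof.
by rewrite /J; case: ifPn => _; [exact: open_interior|exact: open0].
Qed.

Let oU : open U.
Proof. by apply: bigcup_open => n _. Qed.

(** The weights are read off from the derivatives of the map itself, so that they
    do not depend on the choice of the smooth extensions of the branches. *)
Let w (t : R) : R := if `[< U t >] then (derive1 T' t)^-1 else 0.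
Let r (t : R) : R := if `[< U t >] then - derive1 w t else 0.

Let wrP n t : J n t -> [/\ w t != 0, is_derive t 1 T' (w t)^-1,
  is_derive t 1 w (- r t), {for t, continuous r} &
  `|w t| <= lambda^-1 /\ `|r t| <= C].
Proof.
move=> Jt; have [Dn Int] := JP Jt.
have [_ [g [g1 [g2 [[dg dg1 cg2] gT g2C g1l]]]]] := brI Dn (ex_intro _ _ Int).
have lambda0 : 0 < lambda by exact: lt_trans lambda1.
have JI s : J n s -> [/\ D n, I n s & (closure (I n))° s].
  move=> /JP[_ Is]; split => //; first exact: interior_subset.
  by apply: interiorS Is; exact: subset_closure.
have g1n0 s : J n s -> g1 s != 0.
  move=> /JI[_ Is _]; rewrite -normr_gt0; exact: lt_le_trans (g1l _ Is).
have nearJ s : J n s -> \near s, J n s.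
  by move=> Js; exact: (open_nbhs_nbhs (conj (@oJ n) Js)).
have dT s : J n s -> is_derive s 1 T' (g1 s).
  move=> Js; have [_ Is cIs] := JI s Js.
  have dgs : is_derive s 1 g (g1 s).
    by apply: (derivative_within_interior cIs); apply: dg; exact: interior_subset.
  apply: near_eq_is_derive dgs; near=> u.
  have Ju : J n u by near: u; exact: nearJ.
  have [_ Iu _] := JI u Ju; by rewrite gT// (T'I Dn).
have wE s : J n s -> w s = (g1 s)^-1.
  move=> Js; rewrite /w asboolT; last by exists n.
  by have h := dT _ Js; rewrite derive1E derive_val.
have dw s : J n s -> is_derive s 1 w (- (g2 s / g1 s ^+ 2)).
  move=> Js; have [_ Is cIs] := JI s Js.
  have dg1s : is_derive s 1 g1 (g2 s).
    by apply: (derivative_within_interior cIs); apply: dg1; exact: interior_subset.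
  have := is_deriveV (g1n0 _ Js) dg1s.
  rewrite (_ : _ *: _ = - (g2 s / g1 s ^+ 2)); last first.
    by rewrite /GRing.scale/= mulNr mulrC.
  apply: near_eq_is_derive; near=> u.
  by rewrite wE//; near: u; exact: nearJ.
have rE s : J n s -> r s = g2 s / g1 s ^+ 2.
  move=> Js; rewrite /r asboolT; last by exists n.
  by have h := dw _ Js; rewrite derive1E derive_val opprK.
have [_ It cIt] := JI t Jt.
split.
- by rewrite wE// invr_eq0 g1n0.
- by rewrite wE// invrK; exact: dT.
- by rewrite rE//; exact: dw.
- have c2 : {for t, continuous g2} by apply: continuous_within_interior cIt cg2.
  have dg1t : is_derive t 1 g1 (g2 t).
    by apply: (derivative_within_interior cIt); apply: dg1; exact: interior_subset.
  have c1 : {for t, continuous g1}.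
    by apply/differentiable_continuous/derivable1_diffP; exact: ex_derive.
  have c : {for t, continuous (fun s => g2 s / g1 s ^+ 2)}.
    apply: continuousM => //; apply: continuousV.
      by rewrite expf_neq0// g1n0.
    by apply: continuousM.
  rewrite /prop_for /continuous_at rE//; apply: cvg_trans c.
  apply: near_eq_cvg; near=> u; rewrite rE//; near: u; exact: nearJ.
- split.
    by rewrite wE// normfV lef_pV2 ?posrE ?g1l ?normr_gt0 ?g1n0.
  rewrite rE// normrM normfV normrX; exact: g2C.
Unshelve. all: by end_near. Qed.

Let beta n := (C + delta^-1) * fine (leb (J n)).

Let iJ n : is_interval (J n).
Proof.
rewrite /J; case: ifPn => [/asboolP Dn|_]; last by move=> x y [].
exact: is_interval_interior (iI Dn).
Qed.

Let J01 n : J n `<=` `[0, 1].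
Proof. by move=> t /JP[Dn /interior_subset]; exact: I01. Qed.

Let Jdisj : trivIset [set: nat] J.
Proof.
move=> i j _ _ [t [/JP[Di /interior_subset Ii] /JP[Dj /interior_subset Ij]]].
by case: pDI => _ tI _; apply: tI => //; exists t.
Qed.

(** The branches are the interiors of the intervals of the partition. Degenerate
    intervals and endpoints form a countable set, hence a null one. *)
Lemma expanding_system_extend01 : expanding_system T' lambda^-1.
Proof.
have lambda0 : 0 < lambda by exact: lt_trans lambda1.
have li0 : 0 <= lambda^-1 by rewrite invr_ge0 ltW.
have w0 t : ~ U t -> w t = 0 by move=> nUt; rewrite /w asboolF.
have r0 t : ~ U t -> r t = 0 by move=> nUt; rewrite /r asboolF.
have wrU t : U t -> [/\ {for t, continuous w}, {for t, continuous r},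
    `|w t| <= lambda^-1 & `|r t| <= C].
  move=> [n _ Jt]; have [_ _ dw cr [wl rC]] := wrP Jt; split => //.
  by apply/differentiable_continuous/derivable1_diffP; exact: ex_derive.
have bw : bm w.
  by apply: (bm_continuous_on_open oU _ w0 li0) => t /wrU[].
have br : bm r.
  by apply: (bm_continuous_on_open oU _ r0 (ltW C0)) => t /wrU[].
have mJ n : measurable (J n) by exact: open_measurable.
have C1 : 0 <= C + delta^-1 by rewrite addr_ge0 ?invr_ge0 ?ltW.
exists nat, J, w, r, beta; split.
- exact: bw.
- exact: br.
- exact: iJ.
- exact: J01.
- (* For indices outside [D] the branch is empty. *)
  move=> n; have [m|m] : strictly_monotone_on (J n) T' \/ forall t, ~ J n t.
    have [e|/set0P[t Jt]] := eqVneq (J n) set0; first by right => t; rewrite e.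
    left; have [Dn _] := JP Jt.
    have [m|m] := mono' Dn; [left|right] => x y /JP[_ /interior_subset Ix];
      by move=> /JP[_ /interior_subset Iy]; exact: m.
  exact: m.
  by left => x y /m.
- move=> n; apply: (@smooth_inverse_branch _ T' w r (J n) lambda^-1) => //.
  + by rewrite invr_gt0.
  + by case: extend01_selfmap.
  + by case: extend01_selfmap.
  + by move=> t /wrP[? ? ? ? []].
- by move=> n t /wrP[_ _ _ _ []].
- move=> n t Jt; have [Dn It] := JP Jt.
  rewrite /beta (_ : J n = (I n)°); last by rewrite /J asboolT.
  apply: (@branch_weight_bound _ T' w r (I n) C delta) => //.
  + exact: iI.
  + exact: I01.
  + move=> x Ix; have Jx : J n x by rewrite /J asboolT.
    by have [? ? ? ? []] := wrP Jx.
  + rewrite (_ : T' @` I n = T @` I n).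
      by apply: longI => //; exists t.
    by apply/seteqP; split => _ [x Ix <-]; exists x => //; rewrite (T'I Dn).
- by move=> n; rewrite /beta mulr_ge0// fine_ge0.
- exact: Jdisj.
- apply: (@negligibleS _ _ _ leb
    (\bigcup_n (if `[< D n >] then [set inf (I n); sup (I n)] else set0))).
    move=> t [t01 nU]; move: t01; case: pDI => <- _ _ [n Dn Int].
    exists n => //; rewrite asboolT//.
    apply: interval_diff_interior => //; [exact: iI|exact: I01|].
    split => // It; apply: nU; exists n => //; by rewrite /J asboolT.
  apply: negligible_bigcup => n; case: ifPn => _; last exact: negligible_set0.
  have n1 (a : R) : leb.-negligible [set a].
    exists [set a]; split => //; exact: lebesgue_measure_set1.
  by apply: negligibleU; exact: n1.
- exists (C + delta^-1) => s us.
  rewrite /beta -mulr_sumr -[leRHS]mulr1; apply: ler_wpM2l => //.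
  have s01 := bm_set_cc (0 : R) 1.
  have := @int_partition_finite _ _ J s `[0, 1] (fun=> 1) us (bm_cst 1) s01 mJ Jdisj.
  rewrite bm_int_cst// fine_leb_cc// mul1r subr0 => e1; rewrite [leRHS]e1.
  rewrite (_ : \sum_(_ <- _) _ = \sum_(k <- s) \int[leb]_(t in `[0, 1] `&` J k) 1); last first.
    apply: eq_bigr => k _; rewrite setIidr; last exact: (@J01 k).
    rewrite bm_int_cst ?mul1r//; exact: (bm_setS s01 (mJ k) (@J01 k)).
  by rewrite lerDl Rintegral_ge0.
Qed.

End from_piecewise.

(** The factor [5] of the inequality for one system does not accumulate: the
    iterate [s] is treated as a single system of branches with expansion
    [lambda ^ s], so [5 * eta ^ s] is small for large [s]. *)
Theorem lasota_yorke_iter (T : R -> R) : piecewise_expanding T ->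
  selfmap01 (extend01 T) /\ exists2 eta, 0 < eta < 1 &
  forall s, exists2 B, 0 <= B & lasota_yorke (iter s (extend01 T)) (5 * eta ^+ s) B.
Proof.
move=> [T01 [D [I [C [lambda [delta [pDI iI [C0 l1 d0] brI lI]]]]]]].
have sT := extend01_selfmap T01 pDI iI brI.
split; first exact: sT.
have l0 : 0 < lambda by exact: lt_trans l1.
exists lambda^-1; first by rewrite invr_gt0 l0 invf_lt1.
have sTs s : selfmap01 (iter s.+1 (extend01 T)).
  elim: s => [|s [mS S01]]; first exact: sT.
  have [mT T01'] := sT; split; last by move=> x /=; exact: T01'.
  exact: measurableT_comp.
have es := expanding_system_extend01 T01 pDI iI C0 l1 d0 brI lI.
have esS s : expanding_system (iter s.+1 (extend01 T)) (lambda^-1 ^+ s.+1).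
  elim: s => [|s ih]; first by rewrite expr1.
  rewrite exprS; apply: (expanding_system_comp (T := iter s.+1 (extend01 T)) (S := extend01 T)) => //.
case => [|s].
  exists 0 => // psi c bpsi psic; exists psi, (fun=> 0); split => //.
  - exact: bm_cst.
  - by move=> t; rewrite addr0.
  - by apply: (prim_leW psic); have := prim_le_ge0 psic; rewrite expr0; lra.
  - by move=> t; rewrite normr0 mul0r.
by apply: lasota_yorke_system => //; rewrite exprn_gt0// invr_gt0.
Qed.

End base_system.

(** * Step functions on equal bins *)

Section bins.
Variable R : realType.
Notation leb := (@lebesgue_measure R).
Notation bm := (@bounded_measurable R).

Definition bin (m i : nat) : set R := `](i%:R - 1) / m%:R, i%:R / m%:R].

Definition step (m : nat) (alpha : nat -> R) (x : R) : R :=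
  \sum_(1 <= i < m.+1) alpha i * \1_(bin m i) x.

Lemma bin_length m i : (0 < m)%N -> fine (leb (bin m i)) = m%:R^-1.
Proof.
move=> m0; have m0' : (0 : R) < m%:R by rewrite ltr0n.
rewrite /bin lebesgue_measure_itv/= lte_fin ltr_pM2r ?invr_gt0// ltrBlDr ltrDl ltr01.
by rewrite -EFinB/= -mulrBl opprB addrC subrK mul1r.
Qed.

Lemma bm_step m alpha : bm (step m alpha).
Proof. by apply: bm_sum => i; apply: bmZ; apply: bm_indic; exact: measurable_itv. Qed.

Lemma bin_inj m i j x : (0 < m)%N -> bin m i x -> bin m j x -> i = j.
Proof.
move=> m0; have m0' : (0 : R) < m%:R by rewrite ltr0n.
rewrite /bin /= !in_itv/= !ltr_pdivrMr// !ler_pdivlMr// => /andP[i1 i2] /andP[j1 j2].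
have h1 : (i%:R : R) < j.+1%:R by rewrite -[j.+1%:R]natr1; lra.
have h2 : (j%:R : R) < i.+1%:R by rewrite -[i.+1%:R]natr1; lra.
by apply/eqP; rewrite eqn_leq; apply/andP; split; rewrite -ltnS -(ltr_nat R).
Qed.

Lemma step_bin m alpha i x : (0 < m)%N -> (0 < i <= m)%N -> bin m i x ->
  step m alpha x = alpha i.
Proof.
move=> m0 im xi; rewrite /step (bigD1_seq i) ?iota_uniq//=; last first.
  by rewrite mem_index_iota ltnS.
rewrite indicE mem_set// mulr1 big1 ?addr0// => j ji.
rewrite indicE memNset ?mulr0// => xj; move: ji.
by rewrite (bin_inj m0 xj xi) eqxx.
Qed.

Lemma int_cc_oc (a b : R) f : bm f ->
  \int[leb]_(t in `[a, b]) f t = \int[leb]_(t in `]a, b]) f t.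
Proof.
move=> bf; rewrite Rintegral_itv_obnd_cbnd//.
by apply: (bm_integrable _ bf); apply: (@bm_set_itv _ _ _ a b); exact: subset_itv_oc_cc.
Qed.

(** Averaging over bins preserves the integral over each bin, so the primitive of
    the difference vanishes at every multiple of [1/m]; in between it can grow
    only over a length [1/m]. *)
Lemma prim_le_step (m : nat) (phi : R -> R) (K : R) : (0 < m)%N -> bm phi ->
  (forall x, `|phi x| <= K) ->
  prim_le (fun x => phi x -
    step m (fun i => m%:R * \int[leb]_(t in bin m i) phi t) x) (2 * K / m%:R).
Proof.
move=> m0 bphi phiK; set st := step m _.
have m0' : (0 : R) < m%:R by rewrite ltr0n.
have K0 : 0 <= K by exact: le_trans (phiK 0).
have bd : bm (fun x => phi x - st x) by apply: bmB => //; exact: bm_step.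
have sbin i : bm_set leb (bin m i).
  by apply: (@bm_set_itv _ _ _ ((i%:R - 1) / m%:R) (i%:R / m%:R)); exact: subset_itv_oc_cc.
have len i := bin_length i m0.
have stb i : `|m%:R * \int[leb]_(t in bin m i) phi t| <= K.
  rewrite normrM gtr0_norm//.
  apply: (le_trans (ler_wpM2l (ltW m0') (bm_int_bound (sbin i) bphi (fun t _ => phiK t)))).
  by rewrite len mulrCA mulfV ?gt_eqF// mulr1.
have piece (j : nat) (x : R) : (j < m)%N -> j%:R / m%:R <= x <= j.+1%:R / m%:R ->
    \int[leb]_(t in `[j%:R / m%:R, x]) (phi t - st t) =
    \int[leb]_(t in `]j%:R / m%:R, x]) (phi t -
       m%:R * \int[leb]_(t in bin m j.+1) phi t).
  move=> jm /andP[jx xj]; rewrite int_cc_oc//; apply: eq_Rintegral => t.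
  rewrite inE/= in_itv/= => /andP[jt tx].
  rewrite /st (@step_bin _ _ j.+1)//.
  rewrite /bin/= in_itv/= -natr1 addrK jt natr1; exact: le_trans xj.
(* The primitive vanishes at the endpoints of the bins. *)
have zero (j : nat) : (j <= m)%N -> \int[leb]_(t in `[0, j%:R / m%:R]) (phi t - st t) = 0.
  elim: j => [_|j ih jm]; first by rewrite mul0r set_itv1 Rintegral_set1.
  have jj : j%:R / m%:R <= j.+1%:R / m%:R :> R.
    by rewrite ler_pM2r ?invr_gt0// ler_nat.
  rewrite (@itv_chasles _ _ 0 (j%:R / m%:R))//.
  rewrite ih ?add0r; last exact: ltnW.
  rewrite piece//; last by rewrite jj lexx.
  have e : `]j%:R / m%:R, j.+1%:R / m%:R]%classic = bin m j.+1.
    by rewrite /bin -natr1 addrK.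
  rewrite e bm_intB//; last exact: bm_cst.
  by rewrite bm_int_cst// len mulrAC mulfV ?gt_eqF// mul1r subrr.
move=> x /andP[x0 x1].
have [-> | xm] := eqVneq x 1.
  rewrite -[X in `[0, X]](@divff _ (m%:R : R)) ?gt_eqF// zero// normr0.
  by rewrite divr_ge0// mulr_ge0.
have {}x1 : x < 1 by rewrite lt_neqAle xm.
pose j := Num.truncn (x * m%:R).
have /andP[j1 j2] : j%:R <= x * m%:R < j.+1%:R by apply: truncn_itv; rewrite mulr_ge0// ltW.
have jm : (j < m)%N.
  by rewrite -(ltr_nat R); apply: (le_lt_trans j1); rewrite -ltr_pdivlMr// divff// gt_eqF.
have jx : j%:R / m%:R <= x <= j.+1%:R / m%:R.
  by rewrite ler_pdivrMr// j1 ler_pdivlMr// ltW.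
have /andP[jx1 jx2] := jx.
rewrite (@itv_chasles _ _ 0 (j%:R / m%:R))//.
rewrite zero ?add0r; last exact: ltnW.
rewrite piece//.
set c := m%:R * _.
have sjx : bm_set leb `]j%:R / m%:R, x].
  by apply: (@bm_set_itv _ _ _ (j%:R / m%:R) x); exact: subset_itv_oc_cc.
have H : forall t, `]j%:R / m%:R, x]%classic t -> `|phi t - c| <= 2 * K.
  move=> t _; apply: (le_trans (ler_normB _ _)); rewrite mulr_natl mulr2n.
  by rewrite lerD// /c.
apply: (le_trans (bm_int_bound sjx (bmB bphi (bm_cst c)) H)).
apply: ler_wpM2l; first by rewrite mulr_ge0.
apply: (@le_trans _ _ (fine (leb (bin m j.+1)))); last by rewrite len.
apply: fine_le.
- by rewrite ge0_fin_numE//; case: sjx.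
- by rewrite ge0_fin_numE//; case: (sbin j.+1).
- apply: le_outer_measure => t; rewrite /bin /= !in_itv/= -natr1 addrK natr1.
  by move=> /andP[-> tx]/=; exact: le_trans jx2.
Qed.

End bins.

(** * Contraction of weakly vanishing functionals *)

Section functionals.
Variable R : realType.
Notation leb := (@lebesgue_measure R).
Notation bm := (@bounded_measurable R).
Implicit Types l : (R -> R) -> R.

Lemma measurable_iter (S : R -> R) j : selfmap01 S ->
  measurable_fun [set: R] (iter j S).
Proof.
move=> [mS _]; elim: j => [|j ih]; first exact: measurable_id.
exact: measurableT_comp.
Qed.

(** Each further iteration adds a remainder with a geometrically smaller bound, so
    the total remainder stays below [2 B]. *)
Lemma lasota_yorke_iterate (S : R -> R) (theta B : R) : selfmap01 S ->
  0 <= theta <= 1 / 2 -> 0 <= B -> lasota_yorke S theta B ->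
  forall j, lasota_yorke (iter j S) (theta ^+ j) (2 * B).
Proof.
move=> sS /andP[t0 t1] B0 ly; elim=> [|j ih] psi c bpsi psic.
  exists psi, (fun=> 0); split => //.
  - exact: bm_cst.
  - by move=> t; rewrite addr0.
  - by rewrite expr0 mul1r.
  - move=> t; rewrite normr0 !mulr_ge0//; exact: prim_le_ge0 psic.
have c0 := prim_le_ge0 psic.
have [a [rem [ba br e ac rc]]] := ly psi c bpsi psic.
have [a' [rem' [ba' br' e' ac' rc']]] := ih a _ ba ac.
exists a', (fun t => rem' t + rem (iter j S t)); split => //.
- by apply: bmD => //; apply: bm_comp => //; exact: measurable_iter.
- by move=> t /=; rewrite e e' addrA.
- by rewrite exprSr -mulrA.
- move=> t; apply: (le_trans (ler_normD _ _)).
  apply: (le_trans (lerD (rc' _) (rc _))).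
  have : 0 <= B * c by exact: mulr_ge0.
  have -> : 2 * B * (theta * c) = 2 * theta * (B * c) by ring.
  have -> : 2 * B * c = 2 * (B * c) by ring.
  by move=> Bc; nra.
Qed.

(** For integration against a function, the least such [M] is equivalent to its norm
    in the space of functions of bounded variation. *)
Definition bv_dual l (M : R) : Prop :=
  forall psi c, bm psi -> prim_le psi c -> `|l psi| <= M * c.

(** Integration of a function of zero mean for a mixing invariant measure has this
    property. Only the values on intervals are required to converge: a bound on
    the dual norm extends the convergence to all bounded measurable functions. *)
Record weakly_vanishing (S : R -> R) l : Prop := WeaklyVanishing {
  wv_add : forall f g, bm f -> bm g -> l (fun x => f x + g x) = l f + l g;
  wv_scale : forall (c : R) f, bm f -> l (fun x => c * f x) = c * l f;
  wv_cvg : forall a b : R, l (fun x => \1_(`]a, b]%classic) (iter k S x)) @[k --> \oo] --> (0 : R) }.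

Section fixed_map.
Variables (S : R -> R).
Hypothesis sS : selfmap01 S.
Notation wv := (weakly_vanishing S).

Lemma wv_comp l j : wv l -> wv (fun phi => l (fun x => phi (iter j S x))).
Proof.
have mS := measurable_iter j sS.
move=> [ladd lsc lcv]; split.
- by move=> f g bf bg; rewrite ladd//; exact: bm_comp.
- by move=> c f bf; rewrite lsc//; exact: bm_comp.
- move=> a b; have := lcv a b.
  move/(cvg_comp (addn^~ j) _ (cvg_addnr j)).
  apply: cvg_trans; apply: near_eq_cvg; near=> k => /=.
  by congr l; apply/funext => x; rewrite iterD.
Unshelve. all: by end_near. Qed.

Lemma wv_scal l (c : R) : wv l -> wv (fun phi => c * l phi).
Proof.
move=> [ladd lsc lcv]; split.
- by move=> f g bf bg; rewrite ladd// mulrDr.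
- by move=> d f bf; rewrite lsc// mulrCA.
- move=> a b; rewrite -[X in _ --> X](mulr0 c).
  by apply: cvgM; [exact: cvg_cst|exact: lcv].
Qed.

Lemma wv_sub l l' : wv l -> wv l' -> wv (fun phi => l phi - l' phi).
Proof.
move=> [ladd lsc lcv] [ladd' lsc' lcv']; split.
- by move=> f g bf bg; rewrite ladd// ladd'//; ring.
- by move=> d f bf; rewrite lsc// lsc'// mulrBr.
- move=> a b; rewrite -[X in _ --> X](subr0 (0 : R)).
  by apply: cvgB; [exact: lcv|exact: lcv'].
Qed.

Lemma bv_sub l l' M M' : bv_dual l M -> bv_dual l' M' ->
  bv_dual (fun phi => l phi - l' phi) (M + M').
Proof.
move=> lM lM' psi c bpsi psic; apply: (le_trans (ler_normB _ _)).
by rewrite mulrDl lerD ?lM ?lM'.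
Qed.

Lemma wv_lin0 l : wv l -> l (fun=> 0) = 0.
Proof.
by move=> h; have := wv_scale h 0 (bm_cst 0); rewrite !mul0r.
Qed.

Lemma wv_sum l (I : Type) (s : seq I) (F : I -> R -> R) : wv l ->
  (forall i, bm (F i)) ->
  l (fun x => \sum_(i <- s) F i x) = \sum_(i <- s) l (F i).
Proof.
move=> h bF; elim: s => [|i s ih].
  rewrite big_nil -[RHS](wv_lin0 h); congr l; apply/funext => x.
  by rewrite big_nil.
rewrite big_cons -ih -(wv_add h)//; last exact: bm_sum.
by congr l; apply/funext => x; rewrite big_cons.
Qed.

(** The part of [phi] orthogonal to the step functions has a primitive of order
    [1/m], so a functional of bounded dual norm nearly ignores it. *)
Lemma wv_step_bound l (M K : R) (m : nat) (phi : R -> R) : (0 < m)%N -> wv l ->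
  bv_dual l M -> bm phi -> (forall x, `|phi x| <= K) ->
  `|l phi| <= K * (\sum_(1 <= i < m.+1) `|l (\1_(@bin R m i))|) + M * (2 * K / m%:R).
Proof.
move=> m0 lv lM bphi phiK.
have m0' : (0 : R) < m%:R by rewrite ltr0n.
have K0 : 0 <= K by exact: le_trans (phiK 0).
have h := prim_le_step m0 bphi phiK.
set al := (fun i : nat => _) in h.
have bst : bm (step m al) by exact: bm_step.
have bbin i : bm (\1_(@bin R m i) : R -> R) by apply: bm_indic; exact: measurable_itv.
rewrite (_ : phi = (fun x => step m al x + (phi x - step m al x))); last first.
  by apply/funext => x; rewrite addrC subrK.
rewrite (wv_add lv)//; last exact: bmB.
apply: (le_trans (ler_normD _ _)); apply: lerD; last first.
  by apply: lM => //; exact: bmB.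
rewrite /step (wv_sum _ lv)//; last by move=> i; exact: bmZ.
apply: (le_trans (ler_norm_sum _ _ _)); rewrite mulr_sumr; apply: ler_sum => i _.
rewrite (wv_scale lv)// normrM ler_wpM2r// /al normrM gtr0_norm//.
have sbin : bm_set leb (@bin R m i).
  by apply: (@bm_set_itv _ _ _ ((i%:R - 1) / m%:R) (i%:R / m%:R)); exact: subset_itv_oc_cc.
apply: (le_trans (ler_wpM2l (ltW m0') (bm_int_bound sbin bphi (fun t _ => phiK t)))).
by rewrite bin_length// mulrCA mulfV ?gt_eqF// mulr1.
Qed.

Variables (theta B : R).
Hypotheses (theta0 : 0 <= theta <= 1 / 2) (B0 : 0 <= B).
Hypothesis ly : forall j, lasota_yorke (iter j S) (theta ^+ j) B.

(** The bound is uniform in [j], which is what allows the compactness argument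
    below to run along the whole orbit. *)
Lemma bv_comp l M j : 0 <= M -> wv l -> bv_dual l M ->
  bv_dual (fun phi => l (fun x => phi (iter j S x))) (M * (1 + B)).
Proof.
move=> M0 lv lM psi c bpsi psic; have c0 := prim_le_ge0 psic.
have [a [rem [ba br e ac rc]]] := ly j bpsi psic.
rewrite (_ : (fun x => _) = (fun x => a x + rem x)); last by apply/funext => x.
rewrite (wv_add lv)//; apply: (le_trans (ler_normD _ _)).
rewrite mulrDr mulr1 mulrDl -mulrA; apply: lerD.
  apply: (le_trans (lM _ _ ba ac)); apply: ler_wpM2l => //.
  rewrite ler_piMl// exprn_ile1//; case/andP: theta0 => // _ t1.
  by apply: (le_trans t1); lra.
apply: lM => //; apply: prim_le_bound => //.
by rewrite mulr_ge0.
Qed.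

Lemma nat_large (x : R) : exists m : nat, (0 < m)%N /\ x < m%:R.
Proof.
exists (Num.truncn x).+1; split => //; exact: truncnS_gt.
Qed.

(** Uniformity is over all functions bounded by [K], that is, convergence in
    total variation and not only weakly. *)
Lemma wv_uniform_cvg l M (e : R) : 0 <= M -> wv l -> bv_dual l M -> 0 < e ->
  exists k0, forall k, (k0 <= k)%N -> forall phi K, bm phi ->
    (forall x, `|phi x| <= K) -> `|l (fun x => phi (iter k S x))| <= e * K.
Proof.
move=> M0 lv lM e0.
have [m [m0 mM]] := nat_large (4 * M * (1 + B) / e).
have m0' : (0 : R) < m%:R by rewrite ltr0n.
have H : \forall k \near \oo,
    \sum_(1 <= i < m.+1) `|l (fun x => \1_(@bin R m i) (iter k S x))| <= e / 2.
  have : (\sum_(1 <= i < m.+1) `|l (fun x => \1_(@bin R m i) (iter k S x))|) @[k --> \oo] --> (0 : R).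
    rewrite [X in _ --> X](_ : 0 = \sum_(1 <= i < m.+1) `|(0 : R)|); last first.
      by rewrite big1// => i _; rewrite normr0.
    apply: cvg_big => [|i _]; first exact: add_continuous.
    rewrite -[X in _ --> X]/(`|(0 : R)|); apply: cvg_norm; exact: (wv_cvg lv).
  move/cvgrPdist_le => /(_ (e / 2)) []; first exact: divr_gt0.
  move=> N _ NP; exists N => // k /NP /=; rewrite sub0r normrN.
  exact: le_trans (ler_norm _).
case: H => N _ NP; exists N => k Nk phi K bphi phiK.
have K0 : 0 <= K by exact: le_trans (phiK 0).
have := wv_step_bound m0 (wv_comp k lv) (@bv_comp l M k M0 lv lM) bphi phiK.
move/le_trans; apply.
have {}NP := NP k Nk.
have H1 := ler_wpM2l K0 NP.
have H2 : M * (1 + B) * (2 * K / m%:R) <= e / 2 * K.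
  move: mM; rewrite ltr_pdivrMr// => mM.
  rewrite mulrA ler_pdivrMr//.
  have : 4 * M * (1 + B) * K <= m%:R * e * K by apply: ler_wpM2r => //; exact: ltW.
  lra.
apply: (le_trans (lerD H1 H2)); lra.
Qed.

(** The values of a functional on the [m] bins, rounded to multiples of [1/m^2],
    take finitely many values. Two functionals with the same rounded values differ
    by a small amount, uniformly over functions bounded by [K]. A time that suits
    one representative of each class therefore suits all functionals. *)
Lemma net_uniform (e : R) : 0 < e ->
  exists k, forall l, wv l -> bv_dual l 1 -> forall phi K, bm phi ->
    (forall x, `|phi x| <= K) -> `|l (fun x => phi (iter k S x))| <= e * K.
Proof.
move=> e0.
have [m [m0 me]] := nat_large (10 / e).
have m0' : (0 : R) < m%:R by rewrite ltr0n.
pose Q := (2 * m ^ 2).+1.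
pose code l (i : 'I_m) : 'I_Q :=
  inord (Num.truncn ((l (\1_(@bin R m i.+1)) + 1) * (m ^ 2)%:R)).
have bbin i : bm (\1_(@bin R m i) : R -> R) by apply: bm_indic; exact: measurable_itv.
have l1 l i : bv_dual l 1 -> `|l (\1_(@bin R m i))| <= 1.
  move=> lM; rewrite -[leRHS]mul1r; apply: lM => //.
  apply: prim_le_bound => // x _; rewrite indicE.
  by case: (_ \in _); rewrite ?normr1 ?normr0.
(* The values lie in [-1, 1]; shifting them by [1] makes them nonnegative
   before rounding, and [Q] counts the possible results. *)
have codeP l l' (i : 'I_m) : bv_dual l 1 -> bv_dual l' 1 -> code l i = code l' i ->
    `|l (\1_(@bin R m i.+1)) - l' (\1_(@bin R m i.+1))| <= (m ^ 2)%:R^-1.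
  move=> lM lM' /(congr1 val) /=.
  have m2 : (0 : R) < (m ^ 2)%:R by rewrite ltr0n expn_gt0 m0.
  have B1 (x : R) : `|x| <= 1 -> 0 <= (x + 1) * (m ^ 2)%:R /\
      (Num.truncn ((x + 1) * (m ^ 2)%:R) < Q)%N.
    rewrite ler_norml => /andP[x1 x2].
    have x0 : 0 <= (x + 1) * (m ^ 2)%:R by rewrite mulr_ge0//; lra.
    split => //; rewrite /Q ltnS -(ler_nat R).
    have /andP[t1 _] := truncn_itv x0.
    apply: (le_trans t1); rewrite natrM; apply: ler_wpM2r; [exact: ltW|lra].
  have [x0 xQ] := B1 _ (l1 l i.+1 lM); have [y0 yQ] := B1 _ (l1 l' i.+1 lM').
  rewrite /code !inordK// => tt.
  have /andP[t1 t2] := truncn_itv x0.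
  have /andP[u1 u2] := truncn_itv y0.
  rewrite tt in t1 t2.
  rewrite -[X in _ <= X]mul1r ler_pdivlMr// -[X in _ * X]gtr0_norm// -normrM.
  by rewrite ler_norml; apply/andP; split; rewrite mulrBl; rewrite -natr1 in t2 u2; lra.
have uni (c : {ffun 'I_m -> 'I_Q}) : exists k0, forall l, wv l -> bv_dual l 1 ->
    finfun (code l) = c -> forall k, (k0 <= k)%N -> forall phi K, bm phi ->
    (forall x, `|phi x| <= K) -> `|l (fun x => phi (iter k S x))| <= e * K.
  have [[l0 [lv0 lM0 lc0]]|no] := pselect (exists l0, [/\ wv l0, bv_dual l0 1 &
      finfun (code l0) = c]); last first.
    by exists 0%N => l lv lM lc; exfalso; apply: no; exists l.
  have [k0 k0P] := wv_uniform_cvg ler01 lv0 lM0 (divr_gt0 e0 (ltr0n R 2)).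
  exists k0 => l lv lM lc k kk phi K bphi phiK.
  have K0 : 0 <= K by exact: le_trans (phiK 0).
  set phik := fun x => phi (iter k S x).
  have bphik : bm phik by apply: bm_comp => //; exact: measurable_iter.
  have phikK x : `|phik x| <= K by exact: phiK.
  have := wv_step_bound m0 (wv_sub lv lv0) (bv_sub lM lM0) bphik phikK.
  rewrite /= => H.
  have H1 : \sum_(1 <= i < m.+1) `|l (\1_(@bin R m i)) - l0 (\1_(@bin R m i))| <= m%:R^-1.
    apply: (@le_trans _ _ (\sum_(1 <= i < m.+1) (m ^ 2)%:R^-1)).
      apply: ler_sum_nat => i /andP[i1 i2].
      have im : (i.-1 < m)%N by rewrite -ltnS prednK.
      have := @codeP l l0 (Ordinal im) lM lM0; rewrite /= prednK//; apply.
      have : finfun (code l) = finfun (code l0) by rewrite lc lc0.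
      by move/(congr1 (fun f : {ffun _ -> _} => f (Ordinal im))); rewrite !ffunE.
    rewrite big_const_nat iter_addr_0 subn1/= natrX expr2 invfM -[_ *+ m]mulr_natl.
    by rewrite mulrA mulfV ?mul1r// gt_eqF.
  rewrite (_ : l phik = l0 phik + (l phik - l0 phik)); last by rewrite addrC subrK.
  apply: (le_trans (ler_normD _ _)).
  have H2 := k0P k kk phi K bphi phiK.
  apply: (le_trans (lerD H2 H)).
  have H3 := ler_wpM2l K0 H1.
  have H4 : (1 + 1) * (2 * K / m%:R) = 4 * (K * m%:R^-1) by ring.
  have H5 : 10 * (K * m%:R^-1) <= e * K.
    have : 10 <= e * m%:R by move: me; rewrite ltr_pdivrMr// mulrC => /ltW.
    by move=> h; rewrite mulrA ler_pdivrMr// mulrAC; apply: ler_wpM2r.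
  rewrite H4; lra.
have [ks ksP] := choice uni.
exists (\max_c ks c) => l lv lM phi K bphi phiK.
apply: (ksP _ l lv lM erefl) => //; exact: leq_bigmax.
Qed.

Lemma net_uniform_scaled (e : R) : 0 < e ->
  exists k, forall l M, wv l -> 0 < M -> bv_dual l M -> forall phi K, bm phi ->
    (forall x, `|phi x| <= K) -> `|l (fun x => phi (iter k S x))| <= e * M * K.
Proof.
move=> e0; have [k kP] := net_uniform e0; exists k => l M lv M0 lM phi K bphi phiK.
have := kP (fun phi => M^-1 * l phi) (wv_scal _ lv) _ phi K bphi phiK.
move=> h; have {}h : `|M^-1 * l (fun x => phi (iter k S x))| <= e * K.
  apply: h => psi c bpsi psic; rewrite normrM gtr0_norm ?invr_gt0// mul1r.
  by rewrite mulrC ler_pdivrMr// mulrC; exact: lM.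
move: h; rewrite normrM gtr0_norm ?invr_gt0// mulrC ler_pdivrMr//.
by rewrite mulrAC.
Qed.

Lemma exp_half_small (x e : R) : 0 <= x -> 0 < e -> exists j, x * theta ^+ j <= e.
Proof.
move=> x0 e0.
have [t0 t1] := andP theta0.
have c : (fun j => x * theta ^+ j) @ \oo --> (0 : R).
  rewrite -[X in _ --> X](mulr0 x); apply: cvgM; first exact: cvg_cst.
  by apply: cvg_expr; rewrite ger0_norm//; apply: (le_lt_trans t1); lra.
move/cvgrPdist_le : c => /(_ e e0) [N _ /(_ N (leqnn N))] /=.
rewrite sub0r normrN => h; exists N; exact: le_trans (ler_norm _) h.
Qed.

(** After [j] steps the Lasota-Yorke decomposition leaves a part whose primitive is
    divided by a large factor, which a further composition spoils by at most
    [1 + B], and a bounded remainder, on which the functional becomes small after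
    the uniform time [k] given by total boundedness. Each part is made a quarter
    of the original bound. *)
Theorem bv_dual_contraction : exists2 p, (0 < p)%N & forall l M, wv l -> 0 <= M -> bv_dual l M ->
  bv_dual (fun phi => l (fun x => phi (iter p S x))) (M / 2).
Proof.
have B1p : 0 < B + 1 by exact: ltr_wpDl.
have e0 : 0 < (4 * (B + 1))^-1 by rewrite invr_gt0 mulr_gt0.
have [k kP] := net_uniform_scaled e0.
have B1 : 0 <= 1 + B by lra.
have q0 : 0 < 1 / 4 :> R by lra.
have [j0 jP0] := exp_half_small B1 q0.
pose j := j0.+1.
have jP : (1 + B) * theta ^+ j <= 1 / 4.
  apply: le_trans jP0; rewrite /j; apply: ler_wpM2l => //.
  have [t0 t1] := andP theta0.
  by rewrite exprS ler_piMl// ?exprn_ge0//; lra.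
exists (j + k)%N => // l M lv M0 lM psi c bpsi psic.
have c0 := prim_le_ge0 psic.
have [a [rem [ba br e ac rc]]] := ly j bpsi psic.
have mk := measurable_iter k sS.
rewrite (_ : (fun x => _) = (fun x => a (iter k S x) + rem (iter k S x))); last first.
  by apply/funext => x; rewrite iterD e.
rewrite (wv_add lv)//; [|exact: bm_comp..].
have h1 : `|l (fun x => a (iter k S x))| <= M * c / 4.
  have := @bv_comp l M k M0 lv lM a (theta ^+ j * c) ba ac; move/le_trans; apply.
  have : (1 + B) * theta ^+ j * (M * c) <= 1 / 4 * (M * c).
    by apply: ler_wpM2r => //; exact: mulr_ge0.
  lra.
have h2 : `|l (fun x => rem (iter k S x))| <= M * c / 4.
  (* The net is stated for functionals scaled by a positive constant. *)
  have [M00|M0'] := eqVneq M 0.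
    have := @bv_comp l M k M0 lv lM rem (B * c) br.
    rewrite M00 !mul0r; apply; apply: prim_le_bound => //; exact: mulr_ge0.
  have Mp : 0 < M by rewrite lt_neqAle eq_sym M0'.
  have := kP l M lv Mp lM rem (B * c) br rc; move/le_trans; apply.
  rewrite -mulrA mulrC ler_pdivrMr; last lra.
  have : M * (B * c) <= M * ((B + 1) * c).
    by apply: ler_wpM2l => //; apply: ler_wpM2r => //; lra.
  lra.
apply: (le_trans (ler_normD _ _)); apply: (le_trans (lerD h1 h2)); lra.
Qed.

End fixed_map.
End functionals.

(** * Measures with a density *)

Section step_density.
Variable R : realType.
Notation leb := (@lebesgue_measure R).
Notation bm := (@bounded_measurable R).

Lemma bin_cover (m : nat) (x : R) : (0 < m)%N -> 0 < x <= 1 ->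
  exists i, (0 < i <= m)%N /\ bin m i x.
Proof.
move=> m0 /andP[x0 x1]; have m0' : (0 : R) < m%:R by rewrite ltr0n.
have exi : exists i : nat, x * m%:R <= i%:R.
  by exists m; rewrite ler_piMl// ltW.
pose i := ex_minn exi.
have : x * m%:R <= i%:R /\ forall j : nat, x * m%:R <= j%:R -> (i <= j)%N.
  by rewrite /i; case: ex_minnP => n ? ?; split.
move=> [xi mini]; exists i.
have i0 : (0 < i)%N.
  rewrite lt0n; apply/eqP => i0; move: xi; rewrite i0 leNgt.
  by rewrite mulr_gt0.
split.
  by rewrite i0 mini// ler_piMl// ltW.
rewrite /bin/= in_itv/= ltr_pdivrMr// ler_pdivlMr// xi andbT.
rewrite ltNge; apply/negP => h; have := mini i.-1.
rewrite -subn1 natrB// => /(_ h); rewrite subn1.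
by case: (i) i0 => //= k _; rewrite ltnn.
Qed.

Lemma step_approx_continuous (g : R -> R) (e : R) : continuous g -> bm g -> 0 < e ->
  exists m alpha, [/\ (0 < m)%N &
    \int[leb]_(t in `]0, 1]) `|g t - step m alpha t| <= e].
Proof.
move=> cg bg e0.
have [_ [K gK]] := bg.
pose al m i := g (i%:R / m%:R).
have soc : bm_set leb `]0, 1].
  by apply: (@bm_set_itv _ _ _ 0 1); exact: subset_itv_oc_cc.
pose f n (x : R) := (`|g x - step n.+1 (al n.+1) x|)%:E.
have bf n : bm (fun x => `|g x - step n.+1 (al n.+1) x|).
  by apply: bm_norm; apply: bmB => //; exact: bm_step.
have fx n x : 0 < x <= 1 -> exists i, bin n.+1 i x /\ step n.+1 (al n.+1) x = al n.+1 i.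
  move=> x01; have [i [im xi]] := bin_cover (ltn0Sn n) x01.
  by exists i; rewrite (step_bin _ (ltn0Sn n) im xi).
have : (\int[leb]_(x in `]0%R, 1%R]) f n x)%E @[n --> \oo] -->
    (\int[leb]_(x in `]0%R, 1%R]) (cst 0 x))%E.
  apply: (@dominated_cvg _ _ _ _ _ _ _ _ (cst (2 * K)%:E)) => //.
  - by move=> n; apply/measurable_EFinP; apply: measurable_funTS; case: (bf n).
  - move=> x /=; rewrite in_itv/= => x01.
    apply/fine_cvgP; split; first by apply: nearW => n; rewrite /f.
    apply/cvgrPdist_lt => d d0 /=.
    have /cvgrPdist_lt/(_ d d0) := cg x.
    move=> /nbhs_ballP[r /= r0 rP].
    near=> n.
    have [i [xi ->]] := fx n x x01.
    rewrite sub0r normrN normr_id; apply: (rP (i%:R / n.+1%:R)).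
    move: xi; rewrite /bin/ball/= in_itv/= => /andP[x1 x2].
    have nr : (n.+1%:R)^-1 < r by near: n; exact: near_infty_natSinv_lt (PosNum r0).
    rewrite distrC ger0_norm ?subr_ge0//; apply: le_lt_trans nr.
    by move: x1; rewrite mulrBl mul1r ltrBlDr => /ltW; rewrite lerBlDr addrC.
  - exact: (bm_integrable soc (bm_cst (2 * K))).
  - move=> n x /=; rewrite in_itv/= => x01; rewrite /f lee_fin normr_id.
    have [i [_ ->]] := fx n x x01.
    by apply: (le_trans (ler_normB _ _)); rewrite mulr_natl mulr2n lerD ?gK//; exact: gK.
rewrite integral0 => /fine_cvgP[_] /cvgrPdist_le /(_ e e0) [N _ /(_ N (leqnn N))] /=.
rewrite sub0r normrN => H; exists N.+1, (al N.+1); split => //.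
exact: le_trans (ler_norm _) H.
Unshelve. all: by end_near. Qed.

Lemma prim_le_itv (psi : R -> R) (c a b : R) : bm psi -> prim_le psi c ->
  0 <= a -> a <= b -> b <= 1 -> `|\int[leb]_(t in `]a, b]) psi t| <= 2 * c.
Proof.
move=> bpsi psic a0 ab b1; rewrite -int_cc_oc//.
have := @itv_chasles _ psi 0 a b bpsi a0 ab.
have ha := psic a; have hb := psic b.
have {}ha : `|\int[leb]_(t in `[0, a]) psi t| <= c by apply: ha; lra.
have {}hb : `|\int[leb]_(t in `[0, b]) psi t| <= c by apply: hb; lra.
move=> e; have -> : \int[leb]_(t in `[a, b]) psi t =
  \int[leb]_(t in `[0, b]) psi t - \int[leb]_(t in `[0, a]) psi t by rewrite e; ring.
by apply: (le_trans (ler_normB _ _)); lra.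
Qed.

(** Step functions have bounded variation; this is the corresponding bound on their
    dual norm. *)
Lemma int_step_small m alpha (a : R -> R) (c : R) : (0 < m)%N -> bm a -> prim_le a c ->
  `|\int[leb]_(t in `]0, 1]) (a t * step m alpha t)| <=
  (2 * \sum_(1 <= i < m.+1) `|alpha i|) * c.
Proof.
move=> m0 ba ac; have m0' : (0 : R) < m%:R by rewrite ltr0n.
have soc : bm_set leb `]0, 1].
  by apply: (@bm_set_itv _ _ _ 0 1); exact: subset_itv_oc_cc.
have bbin i : bm (\1_(@bin R m i) : R -> R) by apply: bm_indic; exact: measurable_itv.
under eq_Rintegral => t _ do rewrite /step mulr_sumr.
rewrite bm_int_sum//; last by move=> i; apply: bmM => //; exact: bmZ.
apply: (le_trans (ler_norm_sum _ _ _)); rewrite mulr_sumr mulr_suml.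
apply: ler_sum_nat => i /andP[i0 im].
under eq_Rintegral => t _ do rewrite mulrCA (mulrC (a t)).
rewrite bm_intZ//; last exact: bmM.
rewrite bm_int_indic//; last exact: measurable_itv.
have i1 : 0 <= (i%:R - 1) / m%:R :> R.
  by rewrite divr_ge0// subr_ge0 ler1n.
have i2 : (i%:R - 1) / m%:R <= i%:R / m%:R :> R.
  by rewrite ler_pM2r ?invr_gt0//; lra.
have i3 : i%:R / m%:R <= 1 :> R by rewrite ler_pdivrMr// mul1r ler_nat.
rewrite setIidr; last first.
  move=> t; rewrite /bin /= !in_itv/= => /andP[t1 t2].
  by rewrite (le_lt_trans i1 t1) (le_trans t2 i3).
rewrite normrM mulrAC mulrC; apply: ler_wpM2r => //.
exact: prim_le_itv.
Qed.

End step_density.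

Lemma bm_set_prob (R : realType) (nu : probability (measurableTypeR R) R) (A : set R) :
  measurable A -> bm_set nu A.
Proof.
move=> mA; split=> //; apply: (@le_lt_trans _ _ 1%E); last exact: ltry.
exact: probability_le1.
Qed.

Section density_measure.
Variable R : realType.
Notation leb := (@lebesgue_measure R).
Notation bm := (@bounded_measurable R).
Variables (nu : probability (measurableTypeR R) R) (h : R -> R).
Hypotheses (dnu : density nu h) (nu01 : nu `[0, 1]%classic = 1%E).

Lemma integrable_density : leb.-integrable `[0, 1] (EFin \o h).
Proof.
have [mh h0 hE] := dnu.
apply/integrableP; split; first exact/measurable_EFinP.
have := hE `[0, 1]%classic (measurable_itv _); rewrite setIid nu01 => e.
rewrite (_ : (\int[_]_(_ in _) _)%E = 1%E) ?ltry// e.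
apply: eq_integral => x; rewrite inE/= in_itv/= => x01.
by rewrite ger0_norm// h0// in_itv.
Qed.

Let dom : nu `<< leb.
Proof.
apply/null_content_dominatesP => A mA A0; have [mh h0 hE] := dnu.
rewrite hE//; apply: null_set_integral => //.
- by apply: measurableI => //; exact: measurable_itv.
- apply/measurable_EFinP; apply: measurable_funS mh; first exact: measurable_itv.
  exact: subIsetr.
- apply/eqP; rewrite -measure_le0 -A0; apply: le_outer_measure; exact: subIsetl.
Qed.

(** The density agrees almost everywhere with the Radon-Nikodym derivative, for
    which the change of variables is known. *)
Lemma expectation_density f : bm f ->
  \int[nu]_x f x = \int[leb]_(x in `[0, 1]) (f x * h x).
Proof.
move=> bf; have [mf _] := bf; have [mh h0 hE] := dnu.
rewrite /Rintegral; congr fine.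
have snu := bm_set_prob nu measurableT.
rewrite -(Radon_Nikodym_change_of_variables dom measurableT (bm_integrable snu bf)).
rewrite [RHS]integral_mkcond.
have mh' : measurable_fun [set: R] (h \_ `[0, 1]).
  by apply/(measurable_restrictT _ (measurable_itv `[0, 1])).
rewrite (_ : (fun x => _) \_ _ = (fun x => (f x)%:E * ((h \_ `[0, 1]) x)%:E)%E); last first.
  by apply/funext => x; rewrite !patchE; case: ifPn => // _; rewrite mule0.
apply: ae_eq_integral => //.
- apply: emeasurable_funM; first exact/measurable_EFinP.
  by apply: (measurable_int leb); exact: Radon_Nikodym_integrable.
- by apply: emeasurable_funM; exact/measurable_EFinP.
- apply: ae_eqe_mul2l; apply: integral_ae_eq => //.
  + exact: Radon_Nikodym_integrable.
  + exact/measurable_EFinP.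
  + move=> A _ mA; rewrite -Radon_Nikodym_integral//.
    rewrite [LHS]hE// integral_mkcondr.
    by apply: eq_integral => x _; rewrite !patchE; case: ifPn.
Qed.

(** An integrable density is approximated in [L1] by a continuous function and then
    by a step function, whose dual norm is at most [M]. *)
Lemma weak_smallness (e : R) : 0 < e -> exists2 M, 0 <= M &
  forall (a : R -> R) (K c : R), bm a -> (forall x, `|a x| <= K) -> prim_le a c ->
    `|\int[nu]_x a x| <= e * K + M * c.
Proof.
move=> e0; have e2 : 0 < e / 2 by exact: divr_gt0.
have s01 := bm_set_cc (0 : R) 1.
have [g [cg ig]] := approximation_continuous_integrable s01.1 s01.2 integrable_density.
move/fine_cvgP => [_ /cvgrPdist_lt /(_ _ e2) [N _ /(_ N (leqnn N))]] /=.
rewrite sub0r normrN => gN.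
have [gc [cgc bgc gcE]] : exists gc : R -> R, [/\ continuous gc, bm gc &
    forall x, 0 <= x <= 1 -> gc x = g N x].
  exists (g N \o clamp 0 1); have [cgc bgc] := bm_continuous_clamp (cg N).
  by split => // x x01 /=; rewrite clamp_id.
have [m [al [m0 stP]]] := step_approx_continuous cgc bgc e2.
exists (2 * \sum_(1 <= i < m.+1) `|al i|); first by rewrite mulr_ge0// sumr_ge0.
move=> a K c ba aK ac; rewrite expectation_density//.
have K0 : 0 <= K by exact: le_trans (aK 0).
have soc : bm_set leb `]0, 1].
  by apply: (@bm_set_itv _ _ _ 0 1); exact: subset_itv_oc_cc.
have bst : bm (step m al) by exact: bm_step.
have igc : leb.-integrable `[0, 1] (EFin \o gc) by exact: bm_integrable.
have iD : leb.-integrable `[0, 1] (EFin \o (fun x => h x - gc x)).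
  under [X in _.-integrable _ X]eq_fun do rewrite /= EFinB.
  by apply: integrableB => //; exact: integrable_density.
have mm (f : R -> R) : leb.-integrable `[0, 1] (EFin \o f) ->
    leb.-integrable `[0, 1] (EFin \o (fun x => a x * f x)).
  move=> iF; apply: (@le_integrable _ _ _ leb _ s01.1 _ (fun x => (K * `|f x|)%:E)).
  - apply/measurable_EFinP; apply: measurable_realfun.measurable_funM.
      by apply: measurable_funTS; case: ba.
    by apply/measurable_EFinP; exact: (measurable_int leb).
  - move=> x _ /=; rewrite lee_fin !normrM normr_id; apply: ler_wpM2r => //.
    by apply: (le_trans (aK x)); exact: ler_norm.
  - exact: (integrableZl s01.1 K (integrable_norm iF)).
have -> : \int[leb]_(x in `[0, 1]) (a x * h x) =
    \int[leb]_(x in `[0, 1]) (a x * (h x - gc x)) +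
    \int[leb]_(x in `[0, 1]) (a x * (gc x - step m al x)) +
    \int[leb]_(x in `[0, 1]) (a x * step m al x).
  rewrite -addrA -bm_intD//; [|exact: bmM (bmB _ _)|exact: bmM].
  rewrite -RintegralD//.
  - by apply: eq_Rintegral => x _; ring.
  - exact: mm.
  - apply: bm_integrable => //; apply: bmD; apply: bmM => //; exact: bmB.
apply: (le_trans (ler_normD _ _)); apply: lerD; last first.
  rewrite int_cc_oc//; first exact: int_step_small.
  exact: bmM.
apply: (le_trans (ler_normD _ _)).
rewrite (_ : e * K = K * (e / 2) + K * (e / 2)); last by field.
apply: lerD.
  apply: (le_trans (le_normr_Rintegral s01.1 (mm _ iD))).
  apply: (@le_trans _ _ (\int[leb]_(x in `[0, 1]) (K * `|h x - gc x|))).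
    apply: (le_Rintegral s01.1).
    - exact: (integrable_norm (mm _ iD)).
    - exact: (integrableZl s01.1 K (integrable_norm iD)).
    - by move=> x _; rewrite normrM ler_wpM2r.
  rewrite RintegralZl//; last exact: (integrable_norm iD).
  apply: ler_wpM2l => //; apply: ltW; apply: le_lt_trans gN.
  apply: le_trans (ler_norm _).
  rewrite le_eqVlt; apply/orP; left; apply/eqP.
  congr fine; apply: eq_integral => z; rewrite inE/= in_itv/= => zi.
  by rewrite gcE.
have bgs : bm (fun x => gc x - step m al x) by exact: bmB.
rewrite int_cc_oc; last exact: bmM.
apply: (le_trans (bm_int_le_abs soc (bmM ba bgs))).
apply: (@le_trans _ _ (\int[leb]_(x in `]0, 1]) (K * `|gc x - step m al x|))).
  apply: bm_le_int => //.
  - by apply: bm_norm; exact: bmM.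
  - by apply: bmZ; exact: bm_norm.
  - by move=> x _; rewrite normrM ler_wpM2r.
rewrite bm_intZ//; last exact: bm_norm.
by apply: ler_wpM2l.
Qed.

End density_measure.

(** * Decay of correlations and variance of the number of visits *)

Section invariant_density.
Variable R : realType.
Notation leb := (@lebesgue_measure R).
Notation bm := (@bounded_measurable R).
Variables (T : R -> R) (nu : probability (measurableTypeR R) R) (h : R -> R).
Hypotheses (dnu : density nu h) (nu01 : nu `[0, 1]%classic = 1%E)
  (inu : invariant_measure T nu) (mnu : mixing T nu)
  (T01 : forall x, x \in `[0, 1] -> T x \in `[0, 1]).
Let tau := extend01 T.
Hypothesis stau : selfmap01 tau.
Variable eta : R.
Hypothesis eta01 : 0 < eta < 1.
Hypothesis lytau : forall s, exists2 B, 0 <= B & lasota_yorke (iter s tau) (5 * eta ^+ s) B.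

Let mtau j : measurable_fun [set: R] (iter j tau).
Proof. exact: measurable_iter. Qed.

Let snu := bm_set_prob nu measurableT.

Lemma measure_inter01 (A : set R) : measurable A -> nu (`[0, 1]%classic `&` A) = nu A.
Proof.
move=> mA; have m01 : measurable (`[0, 1]%classic : set R) by exact: measurable_itv.
rewrite [RHS](measureDI nu mA m01) setIC.
suff h0 : nu (A `\` `[0, 1]%classic) = 0%E.
  by rewrite [X in _ = (X + _)%E]h0 add0e.
apply/eqP; rewrite -measure_le0.
apply: (@le_trans _ _ (nu (~` `[0, 1]%classic))).
  by apply: le_measure; rewrite ?inE//; [exact: measurableD|exact: measurableC].
by rewrite probability_setC// nu01 subee.
Qed.

Lemma iter_extend01 j x : x \in `[0, 1] -> iter j tau x = iter j T x /\ iter j T x \in `[0, 1].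
Proof.
move=> x01; elim: j => [|j [e j01]] //=.
by rewrite e /tau /extend01 j01; split => //; exact: T01.
Qed.

Lemma mtau_preimage j (A : set R) : measurable A -> measurable (iter j tau @^-1` A).
Proof. by move=> mA; rewrite -[X in measurable X]setTI; exact: mtau. Qed.

Lemma invariant_extend01 (A : set R) : measurable A -> nu (tau @^-1` A) = nu A.
Proof.
move=> mA; rewrite -(inu mA) -measure_inter01; last exact: (@mtau_preimage 1%N).
congr (nu _); apply/seteqP; split => x [x01 /=]; have [e _] := iter_extend01 1%N x01;
  by move: e => /= ->.
Qed.

Lemma expectation_invariant f j : bm f ->
  \int[nu]_x f (iter j tau x) = \int[nu]_x f x.
Proof.
move=> bf; elim: j => //= j ih; rewrite -[RHS]ih.
have bfj : bm (fun x => f (iter j tau x)) by exact: bm_comp.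
under eq_Rintegral => x _ do rewrite -iterS iterSr.
rewrite /Rintegral; congr fine.
have mt : measurable_fun [set: measurableTypeR R]
  (tau : measurableTypeR R -> measurableTypeR R) by exact: (mtau 1).
have H := @integral_pushforward _ _ (measurableTypeR R) (measurableTypeR R) R tau mt nu
  setT (fun x => (f (iter j tau x))%:E).
rewrite preimage_setT in H.
apply: (etrans (esym (H _ _ measurableT))).
- by apply/measurable_EFinP; case: bfj.
- exact: (bm_integrable snu (bm_comp (mtau 1) bfj)).
by apply: eq_measure_integral => A mA _; rewrite /pushforward; exact: invariant_extend01.
Qed.

Lemma mixing_extend01 (A B : set R) : measurable A -> measurable B ->
  (\int[nu]_x (\1_A x * \1_B (iter n tau x))) @[n --> \oo] -->
  fine (nu A) * fine (nu B).
Proof.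
move=> mA mB.
have nufin (X : set R) : measurable X -> nu X \is a fin_num by move=> mX; exact: fin_num_measure.
rewrite -fineM; [|exact: nufin..].
have : fine (nu (`[0, 1]%classic `&` (A `&` iter n T @^-1` B))) @[n --> \oo] --> fine (nu A * nu B)%E.
  apply: fine_cvg; rewrite fineK; last by rewrite fin_numM// nufin.
  exact: mnu.
apply: cvg_trans; apply: near_eq_cvg; near=> n.
under eq_Rintegral => x _ do rewrite -[X in _ * X]mulr1.
have b1 : bm (fun x => \1_B (iter n tau x) * 1 : R).
  by apply: bmM; [apply: (bm_comp (mtau n)); exact: bm_indic|exact: bm_cst].
rewrite (bm_int_indic (fun x => \1_B (iter n tau x) * 1) snu mA) setTI.
have sA := bm_set_prob nu mA.
rewrite (@bm_int_indic _ nu A (iter n tau @^-1` B) (fun=> 1) sA (mtau_preimage n mB)).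
have mAB : measurable (A `&` iter n tau @^-1` B).
  by apply: measurableI => //; exact: mtau_preimage.
rewrite bm_int_cst; last exact: bm_set_prob.
rewrite mul1r; congr fine; rewrite -[RHS]measure_inter01//; congr (nu _).
apply/seteqP; split => x [x01 [Ax Bx]]; have [e _] := iter_extend01 n x01.
  by split => //; split => //; move: Bx => /=; rewrite e.
by split => //; split => //; move: Bx => /=; rewrite e.
Unshelve. all: by end_near. Qed.

Lemma exists_power_small (d : R) : 0 < d -> exists2 s, (0 < s)%N & 5 * eta ^+ s <= d.
Proof.
move=> d0; have /andP[e0 e1] := eta01.
have c : (fun j => 5 * eta ^+ j) @ \oo --> (0 : R).
  rewrite -[X in _ --> X](mulr0 5); apply: cvgM; first exact: cvg_cst.
  by apply: cvg_expr; rewrite ger0_norm// ltW.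
move/cvgrPdist_le : c => /(_ d d0) [N _ /(_ N.+1 (leqnSn N))] /=.
rewrite sub0r normrN => H; exists N.+1 => //; exact: le_trans (ler_norm _) H.
Qed.

(** By invariance [psi] may be replaced by its composition with a high iterate, that
    is by [a + rem] with [rem] bounded by [2 B c] and the primitive of [a]
    arbitrarily small, while [a] itself stays bounded. Absolute continuity makes
    the integral of such an [a] arbitrarily small, so only the contribution of
    [rem] is left. This is the dual form of the fact that the invariant density
    has bounded variation. *)
Lemma invariant_bv : exists2 B', 0 <= B' & bv_dual (fun psi => \int[nu]_x psi x) B'.
Proof.
have half0 : 0 < 1 / 2 :> R by lra.
have [s s0 st] := exists_power_small half0.
have [B B0 ly] := lytau s.
have /andP[e0 e1] := eta01.
have t0 : 0 <= 5 * eta ^+ s <= 1 / 2 by rewrite st mulr_ge0// exprn_ge0// ltW.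
have sS : selfmap01 (iter s tau).
  split; first exact: mtau.
  by case: s s0 {st ly t0} => // s _ x /=; case: stau => _; exact.
have lyj := lasota_yorke_iterate sS t0 B0 ly.
exists (2 * B); first by rewrite mulr_ge0.
move=> psi c bpsi psic; have c0 := prim_le_ge0 psic.
have [_ [K psiK]] := bpsi.
have K0 : 0 <= K by exact: le_trans (psiK 0).
have Bc0 : 0 <= 2 * B * c by rewrite !mulr_ge0.
apply/ler_addgt0Pr => e ee0.
have KB : 0 < K + 2 * B * c + 1 by lra.
have d0 : 0 < e / 2 / (K + 2 * B * c + 1) by rewrite !divr_gt0.
have [M M0 MP] := weak_smallness dnu nu01 d0.
have Mc0 : 0 <= M * c by exact: mulr_ge0.
have ee2 : 0 < e / 2 by exact: divr_gt0.
have [j jP] := exp_half_small t0 Mc0 ee2.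
have [a [rem [ba br eq ac rc]]] := lyj j psi c bpsi psic.
have -> : \int[nu]_x psi x = \int[nu]_x (a x + rem x).
  rewrite -(expectation_invariant (j * s) bpsi); apply: eq_Rintegral => x _.
  by rewrite iterM eq.
rewrite bm_intD//; apply: (le_trans (ler_normD _ _)); rewrite addrC; apply: lerD.
  have := bm_int_bound snu br (fun x _ => rc x).
  by rewrite [X in fine X]probability_setT mulr1.
have aK x : `|a x| <= K + 2 * B * c.
  have -> : a x = psi (iter j (iter s tau) x) - rem x by rewrite eq addrK.
  by apply: (le_trans (ler_normB _ _)); rewrite lerD.
apply: (le_trans (MP a _ _ ba aK ac)).
set X := K + 2 * B * c in KB *.
have h1 : e / 2 / (X + 1) * X <= e / 2.
  rewrite -mulrA; apply: ler_piMr; first exact: ltW.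
  by rewrite mulrC ler_pdivrMr// mul1r lerDl.
have h2 : M * ((5 * eta ^+ s) ^+ j * c) <= e / 2.
  by rewrite mulrA mulrAC.
lra.
Qed.

(** Centring the indicator is what makes the functional vanish along the orbit. *)
Definition cov_functional (a b : R) (phi : R -> R) : R :=
  \int[nu]_x ((\1_(`]a, b]%classic) x - fine (nu `]a, b]%classic)) * phi x).

Let bitv (a b : R) : bm (\1_(`]a, b]%classic) : R -> R).
Proof. by apply: bm_indic; exact: measurable_itv. Qed.

Let bcent (a b : R) :
  bm (fun x => \1_(`]a, b]%classic) x - fine (nu `]a, b]%classic) : R).
Proof. by apply: bmB; [exact: bitv|exact: bm_cst]. Qed.

Lemma integral_indic_prob (A : set R) : measurable A ->
  \int[nu]_x \1_A x = fine (nu A).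
Proof.
move=> mA; under eq_Rintegral => x _ do rewrite -[\1_A x]mulr1.
rewrite (@bm_int_indic _ nu setT A (fun=> 1) snu mA) setTI bm_int_cst ?mul1r//.
exact: bm_set_prob.
Qed.

Lemma cov_functional_vanishing a b s : (0 < s)%N ->
  weakly_vanishing (iter s tau) (cov_functional a b).
Proof.
move=> s0; split.
- move=> f g bf bg; rewrite /cov_functional -bm_intD//; [|exact: bmM..].
  by apply: eq_Rintegral => x _; rewrite mulrDr.
- move=> c f bf; rewrite /cov_functional -bm_intZ//; last exact: bmM.
  by apply: eq_Rintegral => x _; rewrite mulrCA.
- move=> u v.
  have mab : measurable (`]a, b]%classic : set R) by exact: measurable_itv.
  have muv : measurable (`]u, v]%classic : set R) by exact: measurable_itv.
  have H : (cov_functional a b (fun x => \1_(`]u, v]%classic) (iter n tau x))) @[n --> \oo] --> (0 : R).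
    rewrite -[X in _ --> X](subrr (fine (nu `]a, b]%classic) * fine (nu `]u, v]%classic))).
    rewrite (_ : (fun n => _) = (fun n =>
      \int[nu]_x (\1_(`]a, b]%classic) x * \1_(`]u, v]%classic) (iter n tau x)) -
      fine (nu `]a, b]%classic) * fine (nu `]u, v]%classic))); last first.
      apply/funext => n; rewrite /cov_functional.
      have bn : bm (fun x => \1_(`]u, v]%classic) (iter n tau x)).
        by apply: (bm_comp (mtau n)); exact: bitv.
      under eq_Rintegral => x _ do rewrite mulrBl.
      rewrite bm_intB//; [|exact: bmM (bitv _ _) _|exact: bmZ].
      rewrite bm_intZ// (expectation_invariant n (bitv u v)).
      by rewrite integral_indic_prob.
    by apply: cvgB; [exact: mixing_extend01|exact: cvg_cst].
  have cs : (n * s)%N @[n --> \oo] --> \oo.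
    move=> P [N _ NP]; exists N => // n /= Nn; apply: NP => /=.
    by rewrite (leq_trans Nn)// leq_pmulr.
  have := cvg_comp _ _ cs H; apply: cvg_trans; apply: near_eq_cvg.
  near=> n => /=; congr (cov_functional _ _ _); apply/funext => x.
  by rewrite iterM.
Unshelve. all: by end_near. Qed.

Variable B' : R.
Hypotheses (B'0 : 0 <= B') (nu_bv : bv_dual (fun psi => \int[nu]_x psi x) B').

Lemma prim_le_indic_mul (a b c : R) (psi : R -> R) : 0 <= a -> a <= b -> b <= 1 ->
  bm psi -> prim_le psi c ->
  prim_le (fun x => \1_(`]a, b]%classic) x * psi x) (2 * c).
Proof.
move=> a0 ab b1 bpsi psic x /andP[x0 x1]; have c0 := prim_le_ge0 psic.
rewrite bm_int_indic//; last exact: bm_set_cc.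
have [xa|ax] := leP x a.
  rewrite (_ : _ `&` _ = set0) ?Rintegral_set0 ?normr0 ?mulr_ge0//.
  apply/seteqP; split=> // t [] /=; rewrite !in_itv/= => /andP[_ tx] /andP[at_ _].
  by move: (lt_le_trans at_ (le_trans tx xa)); rewrite ltxx.
rewrite (_ : _ `&` _ = `]a, Num.min x b]%classic).
  apply: prim_le_itv => //; first by rewrite le_min (ltW ax).
  by rewrite ge_min x1.
apply/seteqP; split => t /=; rewrite !in_itv/= le_min.
  by move=> [/andP[_ ->] /andP[-> ->]].
move=> /andP[at_ /andP[tx tb]]; rewrite at_ tx tb; split => //.
by rewrite andbT ltW// (le_lt_trans a0).
Qed.

(** The product of a function of bounded variation by the indicator of an interval
    has bounded variation. *)
Lemma cov_functional_bv a b : 0 <= a -> a <= b -> b <= 1 ->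
  bv_dual (cov_functional a b) (3 * B').
Proof.
move=> a0 ab b1 psi c bpsi psic; have c0 := prim_le_ge0 psic.
have p01 : `|fine (nu `]a, b]%classic)| <= 1.
  rewrite ger0_norm ?fine_ge0// -lee_fin fineK; first exact: probability_le1.
  exact: fin_num_measure.
have -> : 3 * B' * c = B' * (2 * c + 1 * c) by ring.
apply: nu_bv; first exact: bmM.
rewrite (_ : (fun x => _) = (fun x => \1_(`]a, b]%classic) x * psi x +
  (- fine (nu `]a, b]%classic)) * psi x)); last first.
  by apply/funext => x; rewrite mulrBl mulNr.
apply: prim_leD => //.
- by apply: bmM => //; exact: bitv.
- exact: bmZ.
- exact: prim_le_indic_mul.
- move=> x x01; rewrite bm_intZ//; last exact: bm_set_cc.
  by rewrite normrM normrN ler_pM// psic.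
Qed.

Lemma prim_le_indic a b : 0 <= a -> a <= b -> b <= 1 ->
  prim_le (\1_(`]a, b]%classic) : R -> R) (b - a).
Proof.
move=> a0 ab b1 x /andP[x0 x1].
have mab : measurable (`]a, b]%classic : set R) by exact: measurable_itv.
under eq_Rintegral => t _ do rewrite -[\1_(`]a, b]%classic) t]mulr1.
rewrite (@bm_int_indic _ leb _ _ (fun=> 1) (bm_set_cc 0 x) mab).
have sx : bm_set leb (`[0, x]%classic `&` `]a, b]%classic).
  apply: (bm_setS (bm_set_cc 0 x)); last exact: subIsetl.
  by apply: measurableI => //; exact: measurable_itv.
rewrite bm_int_cst// mul1r ger0_norm ?fine_ge0// -fine_leb_cc//.
apply: fine_le.
- by rewrite ge0_fin_numE//; case: sx.
- by rewrite ge0_fin_numE//; case: (bm_set_cc a b).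
- apply: le_outer_measure => t [_] /=; rewrite !in_itv/= => /andP[at_ ->].
  by rewrite ltW.
Qed.

(** The contraction acts on the covariance functional along multiples of a period
    [P], and the remaining [k %% P] steps are absorbed by the Lasota-Yorke
    inequality. The factor [b - a] comes from the test function: the primitive of
    the indicator is at most [b - a]. It is essential, since with a
    constant bound the variance of the visits to a bin would be of order [n]
    rather than [n/m]. *)
Theorem decay_of_correlations : exists C1 P, [/\ 0 <= C1, (0 < P)%N &
  forall a b k, 0 <= a -> a <= b -> b <= 1 ->
  `|cov_functional a b (fun x => \1_(`]a, b]%classic) (iter k tau x))| <=
  C1 * (1 / 2) ^+ (k %/ P) * (b - a)].
Proof.
have half0 : 0 < 1 / 2 :> R by lra.
have [s s0 st] := exists_power_small half0.
have /andP[e0 e1] := eta01.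
have [Bf BfP] : exists Bf : nat -> R, forall t, 0 <= Bf t /\ lasota_yorke (iter t tau) (5 * eta ^+ t) (Bf t).
  have [Bf BfP] := choice (fun t => let: ex_intro2 B b0 ly := lytau t in
    ex_intro (fun B => 0 <= B /\ lasota_yorke (iter t tau) (5 * eta ^+ t) B) B (conj b0 ly)).
  by exists Bf.
have t0 : 0 <= 5 * eta ^+ s <= 1 / 2 by rewrite st mulr_ge0// exprn_ge0// ltW.
have sS : selfmap01 (iter s tau).
  split; first exact: mtau.
  by case: s s0 {st t0} => // s _ x /=; case: stau => _; exact.
have [Bs0 lys] := BfP s.
have lyj := lasota_yorke_iterate sS t0 Bs0 lys.
have Bs0' : 0 <= 2 * Bf s by exact: mulr_ge0.
have [p p0 pP] := bv_dual_contraction sS t0 Bs0' lyj.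
pose P := (p * s)%N.
have P0 : (0 < P)%N by rewrite muln_gt0 p0.
pose Bm := \sum_(0 <= t < P) Bf t.
have Bm0 : 0 <= Bm by apply: sumr_ge0 => t _; case: (BfP t).
exists (3 * B' * (5 + Bm)), P; split => //.
  by rewrite !mulr_ge0// addr_ge0.
move=> a b k a0 ab b1.
have lv := cov_functional_vanishing a b s0.
have lb := cov_functional_bv a0 ab b1.
(* Each period halves the dual norm of the functional. *)
have iterq q : weakly_vanishing (iter s tau)
      (fun phi => cov_functional a b (fun x => phi (iter (q * P) tau x))) /\
    bv_dual (fun phi => cov_functional a b (fun x => phi (iter (q * P) tau x)))
      (3 * B' * (1 / 2) ^+ q).
  elim: q => [|q [ihv ihb]]; first by rewrite mul0n/= expr0 mulr1.
  have e : (fun phi : R -> R => cov_functional a b (fun x => phi (iter (q.+1 * P) tau x))) =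
    (fun phi => cov_functional a b (fun x => phi (iter p (iter s tau) (iter (q * P) tau x)))).
    apply/funext => phi; congr (cov_functional _ _ _); apply/funext => x.
    by rewrite mulSn iterD /P iterM.
  rewrite e; split.
    exact: (wv_comp sS p ihv).
  rewrite exprSr mulrA (mulrA _ _ 2^-1) mulr1; apply: (pP _ _ ihv _ ihb).
  by rewrite !mulr_ge0// exprn_ge0// ltW.
have [_ lbq] := iterq (k %/ P)%N.
have tP : (k %% P < P)%N by rewrite ltn_pmod.
have [Bt0 lyt] := BfP (k %% P)%N.
have b1i : bm (\1_(`]a, b]%classic) : R -> R) by exact: bitv.
have [u [rem [bu br eq uc rc]]] := lyt _ _ b1i (prim_le_indic a0 ab b1).
have ba0 : 0 <= b - a by rewrite subr_ge0.
have pt : prim_le (fun x => \1_(`]a, b]%classic) (iter (k %% P) tau x) : R) ((5 + Bm) * (b - a)).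
  rewrite (_ : (fun x => _) = (fun x => u x + rem x)); last by apply/funext => x; rewrite eq.
  rewrite mulrDl; apply: prim_leD => //.
    apply: (prim_leW uc); apply: ler_wpM2r => //.
    by rewrite ler_piMr// exprn_ile1// ltW.
  apply: prim_le_bound => //; first exact: mulr_ge0.
  move=> x _; apply: (le_trans (rc x)); apply: ler_wpM2r => //.
  rewrite /Bm (bigD1_seq (k %% P)%N) ?iota_uniq//=; last by rewrite mem_index_iota.
  by rewrite lerDl sumr_ge0// => t _; case: (BfP t).
have bt : bm (fun x => \1_(`]a, b]%classic) (iter (k %% P) tau x) : R).
  by apply: (bm_comp (mtau _)); exact: bitv.
have := lbq _ _ bt pt.
rewrite (_ : (fun x => \1_(`]a, b]%classic) (iter (k %% P) tau (iter (k %/ P * P) tau x)) : R) =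
   (fun x => \1_(`]a, b]%classic) (iter k tau x))); last first.
  by apply/funext => x; rewrite -iterD addnC -divn_eq.
by move/le_trans; apply; rewrite le_eqVlt; apply/orP; left; apply/eqP; ring.
Qed.

Lemma sum_half_power (P N : nat) : (0 < P)%N ->
  \sum_(0 <= d < N) (1 / 2 : R) ^+ (d %/ P) <= 2 * P%:R.
Proof.
move=> P0; have h0 : 0 <= 1 / 2 :> R by lra.
have block q : \sum_(0 <= d < q * P) (1 / 2 : R) ^+ (d %/ P) = 2 * P%:R * (1 - (1 / 2) ^+ q).
  elim: q => [|q ih]; first by rewrite mul0n big_geq// expr0 subrr mulr0.
  rewrite (@big_cat_nat _ _ _ (q * P))//=; last by rewrite leq_mul2r leqnSn orbT.
  rewrite ih (_ : \sum_(q * P <= i < q.+1 * P) _ = \sum_(q * P <= i < q.+1 * P) (1 / 2) ^+ q); last first.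
    apply: eq_big_nat => i /andP[qi iq]; congr (_ ^+ _); apply/eqP.
    by rewrite eqn_leq leq_divRL// qi andbT -ltnS ltn_divLR.
  rewrite big_const_nat iter_addr_0 -mulnBl subSnn mul1n -mulr_natl exprS.
  by field.
apply: (@le_trans _ _ (\sum_(0 <= d < N * P) (1 / 2 : R) ^+ (d %/ P))).
  rewrite (@big_cat_nat _ _ _ N 0 (N * P))//=; last by rewrite leq_pmulr.
  by rewrite lerDl sumr_ge0// => i _; rewrite exprn_ge0.
rewrite block mulrBr mulr1 gerBl !mulr_ge0// exprn_ge0//.
Qed.

Definition deviation (a b : R) (n : nat) (y : R) : R :=
  \sum_(1 <= k < n.+1) (\1_(`]a, b]%classic) (iter k tau y) - fine (nu `]a, b]%classic)).

Lemma bm_deviation a b n : bm (deviation a b n).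
Proof.
by apply: bm_sum => k; exact: (bm_comp (mtau k) (bcent a b)).
Qed.

(** Stationarity reduces the covariance at times [k] and [l] to the covariance at
    times [0] and [l - k]. *)
Lemma deviation_pair a b k l : (k <= l)%N ->
  \int[nu]_y ((\1_(`]a, b]%classic) (iter k tau y) - fine (nu `]a, b]%classic)) *
    (\1_(`]a, b]%classic) (iter l tau y) - fine (nu `]a, b]%classic))) =
  cov_functional a b (fun x => \1_(`]a, b]%classic) (iter (l - k) tau x)).
Proof.
move=> kl; set p := fine _.
have bc := bcent a b; have bi := bitv a b.
have b1 : bm (fun x => \1_(`]a, b]%classic) (iter (l - k) tau x) : R) by exact: bm_comp.
pose f x := (\1_(`]a, b]%classic) x - p) *
  (\1_(`]a, b]%classic) (iter (l - k) tau x) - p).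
have bf : bm f by apply: bmM => //; apply: bmB => //; exact: bm_cst.
transitivity (\int[nu]_y f (iter k tau y)).
  by apply: eq_Rintegral => y _; rewrite /f -iterD subnK.
rewrite expectation_invariant// /f /cov_functional.
under eq_Rintegral => x _ do rewrite mulrBr.
rewrite bm_intB//; [|exact: bmM|by apply: bmM => //; exact: bm_cst].
suff -> : \int[nu]_x ((\1_(`]a, b]%classic) x - p) * p) = 0 by rewrite subr0.
under eq_Rintegral => x _ do rewrite mulrC.
rewrite bm_intZ// bm_intB//; last exact: bm_cst.
rewrite integral_indic_prob; last exact: measurable_itv.
by rewrite bm_int_cst// [X in _ - _ * fine X]probability_setT mulr1 subrr mulr0.
Qed.

(** By induction on [n]: the increment of the variance is a sum of covariances
    with the last time, which is bounded independently of [n] by a geometric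
    series. *)
Theorem deviation_variance : exists2 V, 0 <= V & forall a b n,
  0 <= a -> a <= b -> b <= 1 ->
  \int[nu]_y (deviation a b n y ^+ 2) <= V * (b - a) * n%:R.
Proof.
have [C1 [P [C10 P0 covP]]] := decay_of_correlations.
exists (4 * P%:R * C1); first by rewrite !mulr_ge0.
move=> a b n a0 ab b1; have ba0 : 0 <= b - a by rewrite subr_ge0.
elim: n => [|n ih].
  rewrite mulr0 /deviation; under eq_Rintegral do rewrite big_geq// expr0n/=.
  by rewrite Rintegral_cst ?mul0r//; exact: measurableT.
pose X k y := \1_(`]a, b]%classic) (iter k tau y) - fine (nu `]a, b]%classic).
have bX k : bm (X k) by exact: (bm_comp (mtau k) (bcent a b)).
have bD := bm_deviation a b n.
pose Dd d := C1 * (1 / 2) ^+ (d %/ P) * (b - a).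
have XX k l : (k <= l)%N -> `|\int[nu]_y (X k y * X l y)| <= Dd (l - k)%N.
  by move=> kl; rewrite /X deviation_pair//; exact: covP.
have e : \int[nu]_y (deviation a b n.+1 y ^+ 2) =
    \int[nu]_y (deviation a b n y ^+ 2) +
    (2 * \sum_(1 <= k < n.+1) \int[nu]_y (X k y * X n.+1 y) +
    \int[nu]_y (X n.+1 y * X n.+1 y)).
  have b2 : bm (fun y => deviation a b n y ^+ 2).
    by under eq_fun do rewrite expr2; exact: bmM.
  rewrite -bm_int_sum//; last by move=> k; exact: bmM.
  have bS : bm (fun y => \sum_(1 <= k < n.+1) X k y * X n.+1 y).
    by apply: bm_sum => k; exact: bmM.
  rewrite -bm_intZ// -bm_intD//; [|exact: bmZ|exact: bmM].
  rewrite -bm_intD//; last by apply: bmD; [exact: bmZ|exact: bmM].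
  apply: eq_Rintegral => y _; rewrite -mulr_suml.
  rewrite /deviation big_nat_recr//= -/(X n.+1 y).
  by rewrite -[\sum_(1 <= k < n.+1) X k y]/(deviation a b n y) /deviation; ring.
have S0 : \sum_(1 <= k < n.+2) Dd (n.+1 - k)%N <= 2 * P%:R * C1 * (b - a).
  rewrite (_ : \sum_(_ <= _ < _) _ = \sum_(0 <= d < n.+1) Dd d); last first.
    rewrite big_add1/= big_nat_rev/=; apply: eq_big_nat => i /andP[_ iN].
    by rewrite add0n subSS subKn// -ltnS.
  rewrite /Dd -mulr_suml -mulr_sumr; apply: ler_wpM2r => //.
  by rewrite mulrC; apply: ler_wpM2r => //; exact: sum_half_power.
have S1 : 2 * \sum_(1 <= k < n.+1) \int[nu]_y (X k y * X n.+1 y) +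
    \int[nu]_y (X n.+1 y * X n.+1 y) <= 2 * \sum_(1 <= k < n.+2) Dd (n.+1 - k)%N.
  rewrite [in leRHS]big_nat_recr//= subnn mulrDr; apply: lerD.
    rewrite ler_pM2l//; apply: ler_sum_nat => k /andP[_ kn].
    by apply: (le_trans (ler_norm _)); apply: XX; exact: ltnW.
  apply: (le_trans (ler_norm _)); apply: (le_trans (XX _ _ (leqnn _))).
  rewrite subnn ler_peMl//; last lra.
  by rewrite /Dd !mulr_ge0// exprn_ge0//; lra.
rewrite e -[n.+1%:R]natr1 mulrDr mulr1; apply: lerD => //.
apply: (le_trans S1); lra.
Qed.

End invariant_density.

(** * The bias of the histogram *)

Section bias.
Variable R : realType.
Notation leb := (@lebesgue_measure R).
Notation bm := (@bounded_measurable R).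
Variables (nu : probability (measurableTypeR R) R) (h : R -> R).
Hypotheses (dnu : density nu h) (nu01 : nu `[0, 1]%classic = 1%E).
Variable B' : R.
Hypotheses (nu_bv : bv_dual (fun psi => \int[nu]_x psi x) B').

Lemma bin_sub01 (m i : nat) : (0 < i <= m)%N -> @bin R m i `<=` `[0, 1].
Proof.
move=> /andP[i0 im]; have m0 : (0 < m)%N by exact: leq_trans im.
have m0' : (0 : R) < m%:R by rewrite ltr0n.
move=> t; rewrite /bin /= !in_itv/= => /andP[t1 t2].
have h1 : 0 <= (i%:R - 1) / m%:R :> R by rewrite divr_ge0// subr_ge0 ler1n.
have h2 : i%:R / m%:R <= 1 :> R by rewrite ler_pdivrMr// mul1r ler_nat.
by rewrite ltW ?(le_lt_trans h1)//= (le_trans t2).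
Qed.

(** Averaging over bins is self-adjoint; here it is moved from the measure [nu]
    to the test function. *)
Lemma step_expectation_swap (m : nat) (phi : R -> R) : bm phi ->
  \int[leb]_(x in `[0, 1]) (step m (fun i => m%:R * fine (nu (@bin R m i))) x * phi x) =
  \int[nu]_x step m (fun i => m%:R * \int[leb]_(t in bin m i) phi t) x.
Proof.
move=> bphi; have s01 := bm_set_cc (0 : R) 1.
have mbin i : measurable (@bin R m i) by exact: measurable_itv.
have bbin i : bm (\1_(@bin R m i) : R -> R) by exact: (bm_indic (mbin i)).
have snu := bm_set_prob nu measurableT.
rewrite /step bm_int_sum//; last by move=> i; exact: bmZ.
under eq_Rintegral => x _ do rewrite mulr_suml.
rewrite bm_int_sum//; last by move=> i; apply: bmM => //; exact: bmZ.
apply: eq_big_nat => i im.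
under eq_Rintegral => x _ do rewrite -mulrA.
rewrite bm_intZ//; last exact: bmM.
rewrite (bm_int_indic phi s01 (mbin i)) setIidr; last exact: bin_sub01.
rewrite bm_intZ// (integral_indic_prob nu (mbin i)).
by rewrite mulrAC.
Qed.

(** The [L1] norm is the integral against the sign [phi] of the difference. By
    self-adjointness this is the [nu]-integral of [phi] minus its averages over
    the bins, a function whose primitive is at most [2/m], so the dual norm of
    [nu] concludes. *)
Lemma histogram_bias (m : nat) : (0 < m)%N ->
  \int[leb]_(x in `[0, 1])
    `|step m (fun i => m%:R * fine (nu (@bin R m i))) x - h x| <= 2 * B' / m%:R.
Proof.
move=> m0; set H := step m _.
have bH : bm H by exact: bm_step.
have s01 := bm_set_cc (0 : R) 1.
have [mh h0 hE] := dnu.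
have mh' : measurable_fun [set: R] (h \_ `[0, 1]).
  by apply/(measurable_restrictT _ (measurable_itv `[0, 1])).
pose N : set R := [set x | H x < (h \_ `[0, 1]) x].
have mN : measurable N.
  rewrite (_ : N = [set: R] `&` (fun x => H x < (h \_ `[0, 1]) x) @^-1` [set true]); last first.
    by rewrite setTI; apply/seteqP; split.
  by apply: (measurable_fun_ltr _ mh') => //; case: bH.
pose phi x : R := 1 - 2 * \1_N x.
have bphi : bm phi.
  apply: bmB; first exact: bm_cst.
  by apply: bmZ; exact: bm_indic.
have phi1 x : `|phi x| <= 1.
  rewrite /phi indicE; case: (_ \in _); rewrite ?mulr1 ?mulr0 ?subr0 ?normr1//.
  by rewrite ler_norml; apply/andP; split; lra.
have ih := integrable_density dnu nu01.
have iphih : leb.-integrable `[0, 1] (EFin \o (fun x => phi x * h x)).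
  apply: (@le_integrable _ _ _ leb _ s01.1 _ (EFin \o h)) => //.
  - apply/measurable_EFinP; apply: measurable_realfun.measurable_funM => //.
    by apply: measurable_funTS; case: bphi.
  - by move=> x _ /=; rewrite lee_fin normrM ler_piMl.
have -> : \int[leb]_(x in `[0, 1]) `|H x - h x| =
    \int[leb]_(x in `[0, 1]) (H x * phi x - phi x * h x).
  apply: eq_Rintegral => x; rewrite inE/= => x01; rewrite (mulrC (phi x)) -mulrBl.
  rewrite /phi indicE.
  have -> : (x \in N) = (H x < h x).
    by apply/idP/idP; rewrite inE /N/= patchE mem_set.
  case: ltP => Hh /=; first by rewrite ltr0_norm ?subr_lt0//; ring.
  by rewrite ger0_norm ?subr_ge0//; ring.
rewrite RintegralB//; last exact: (bm_integrable s01 (bmM bH bphi)).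
rewrite step_expectation_swap// -(expectation_density dnu bphi).
rewrite -bm_intB//; [|exact: bm_set_prob|exact: bm_step].
set E := step m _.
apply: (le_trans (ler_norm _)).
have -> : 2 * B' / m%:R = B' * (2 * 1 / m%:R) by ring.
have -> : \int[nu]_x (E x - phi x) = - \int[nu]_x (phi x - E x).
  rewrite -mulN1r -bm_intZ//; [|exact: bm_set_prob|by apply: bmB => //; exact: bm_step].
  by apply: eq_Rintegral => x _; ring.
rewrite normrN; apply: nu_bv; first by apply: bmB => //; exact: bm_step.
exact: prim_le_step.
Qed.

End bias.

(** * Histograms and total variation *)

Section upper_integral.
Context d (X : measurableType d) (R : realType) (mu : {measure set X -> \bar R}).
Local Open Scope ereal_scope.

(** The integral of a nonnegative function is a supremum over simple functions
    below it, hence monotone even for functions that are not known to be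
    measurable. This applies to the iterated integral and to the variation norm
    as functions of [y]. *)
Lemma ge0_le_integral_any (D : set X) (f g : X -> \bar R) :
  (forall x, D x -> 0 <= f x) -> (forall x, D x -> f x <= g x) ->
  \int[mu]_(x in D) f x <= \int[mu]_(x in D) g x.
Proof.
move=> f0 fg; have g0 x : D x -> 0 <= g x.
  by move=> Dx; apply: le_trans (f0 x Dx) (fg x Dx).
rewrite (integral_mkcond D f) (integral_mkcond D g).
rewrite !ge0_integralTE; [|exact: erestrict_ge0..].
apply: le_ereal_sup => _ [s /= sf <-]; exists s => // x.
apply: (le_trans (sf x)); rewrite !patchE; case: ifPn => // /[!inE] Dx.
exact: fg.
Qed.
End upper_integral.

Section histogram_step.
Variable R : realType.
Notation leb := (@lebesgue_measure R).
Notation bm := (@bounded_measurable R).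

Lemma EFin_Rintegral d (X : measurableType d) (mu : {measure set X -> \bar R})
    (D : set X) (f : X -> R) : measurable D -> mu.-integrable D (EFin \o f) ->
  (\int[mu]_(x in D) (f x)%:E)%E = (\int[mu]_(x in D) f x)%:E.
Proof. by move=> mD iF; rewrite /Rintegral fineK//; exact: integrable_fin_num. Qed.

Lemma histogram_stepE (T : R -> R) (m n : nat) (x y : R) :
  histogram T m n x y = step m (fun i => m%:R * (n%:R^-1 *
    \sum_(1 <= k < n.+1) \1_(@bin R m i) (iter k T y))) x.
Proof.
apply: eq_bigr => i _; rewrite /bin_coef /bin_fun -mulr_sumr.
have e : Num.sqrt m%:R * Num.sqrt m%:R = m%:R :> R by rewrite -expr2 sqr_sqrtr.
by rewrite -[in RHS]e /bin; ring.
Qed.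

Lemma stepD m (al be : nat -> R) x :
  step m (fun i => al i + be i) x = step m al x + step m be x.
Proof. by rewrite /step -big_split/=; apply: eq_bigr => i _; rewrite mulrDl. Qed.

Lemma step_norm m (al : nat -> R) x : 
  `|step m al x| <= step m (fun i => `|al i|) x.
Proof.
apply: (le_trans (ler_norm_sum _ _ _)); apply: ler_sum => i _.
by rewrite normrM ler_wpM2l// indicE; case: (_ \in _); rewrite ?normr1 ?normr0.
Qed.

(** At [x = 0], which belongs to no bin, the step function vanishes; this is why
    [M] has to be nonnegative. *)
Lemma step_le_max m (al : nat -> R) (M x : R) : (0 < m)%N -> 0 <= M ->
  (forall i, (0 < i <= m)%N -> al i <= M) -> 0 <= x <= 1 -> step m al x <= M.
Proof.
move=> m0 M0 alM /andP[x0 x1]; have [->|x0'] := eqVneq x 0.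
  rewrite /step big1_seq// => i /andP[_]; rewrite mem_index_iota => /andP[i0 _].
  rewrite indicE memNset ?mulr0// /bin/= in_itv/= => /andP[h _].
  have : 0 <= (i%:R - 1) / m%:R :> R by rewrite divr_ge0// subr_ge0 ler1n.
  by rewrite leNgt h.
have x01 : 0 < x <= 1 by rewrite lt_neqAle eq_sym x0' x0.
have [i [im xi]] := bin_cover m0 x01.
by rewrite (step_bin _ m0 im xi); exact: alM.
Qed.

Lemma int_step (m : nat) (al : nat -> R) : (0 < m)%N ->
  \int[leb]_(x in `[0, 1]) step m al x = \sum_(1 <= i < m.+1) al i / m%:R.
Proof.
move=> m0; have m0' : (0 : R) < m%:R by rewrite ltr0n.
have s01 := bm_set_cc (0 : R) 1.
have mbin i : measurable (@bin R m i) by exact: measurable_itv.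
have bbin i : bm (\1_(@bin R m i) : R -> R) by exact: (bm_indic (mbin i)).
have len i := @bin_length R m i m0.
rewrite /step bm_int_sum//; last by move=> i; exact: bmZ.
apply: eq_big_nat => i im; rewrite bm_intZ//; congr (_ * _).
under eq_Rintegral => x _ do rewrite -[\1_(bin m i) x]mulr1.
rewrite (@bm_int_indic _ leb _ _ (fun=> 1) s01 (mbin i)).
rewrite setIidr; last exact: bin_sub01.
rewrite bm_int_cst ?mul1r; last exact: (bm_setS s01 (mbin i) (bin_sub01 im)).
by rewrite len.
Qed.

End histogram_step.

(** Only the values of the charge on the two parts of some Hahn decomposition
    enter, so a bound valid for all pairs of disjoint measurable sets suffices. *)
Lemma variation_norm_hahn d (X : measurableType d) (R : realType)
    (mu : {charge set X -> \bar R}) : exists P N : set X,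
  [/\ measurable P, measurable N, P `&` N = set0 &
      variation_norm mu = (mu P - mu N)%E].
Proof.
rewrite /variation_norm; set P := cid _; set N := cid _.
have [[mP _] [mN _] _ PN0] := projT2 N.
exists (projT1 P), (projT1 N); split => //.
rewrite /charge_variation jordan_posE cjordan_posE jordan_negE cjordan_negE.
by rewrite /crestr0 mem_set//= /crestr !setTI.
Qed.

Lemma variation_norm_ge0 d (X : measurableType d) (R : realType)
    (mu : {charge set X -> \bar R}) : (0 <= variation_norm mu)%E.
Proof. by rewrite /variation_norm /charge_variation; exact: adde_ge0. Qed.

Section total_variation.
Variable R : realType.
Notation leb := (@lebesgue_measure R).
Notation bm := (@bounded_measurable R).
Variables (nu : probability (measurableTypeR R) R) (h : R -> R).
Hypotheses (dnu : density nu h) (nu01 : nu `[0, 1]%classic = 1%E).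

Lemma histogram_outside (T : R -> R) (m n : nat) (x y : R) : ~ `[0, 1]%classic x ->
  histogram T m n x y = 0.
Proof.
move=> nx; rewrite histogram_stepE /step big1_seq// => i /andP[_].
rewrite mem_index_iota ltnS => im; rewrite indicE memNset ?mulr0// => xi.
by apply: nx; exact: (bin_sub01 im).
Qed.

Lemma bm_histogram (T : R -> R) (m n : nat) (y : R) : bm (fun x => histogram T m n x y).
Proof. by under eq_fun do rewrite histogram_stepE; exact: bm_step. Qed.

Lemma integrable_histogram_error (T : R -> R) (m n : nat) (y : R) :
  leb.-integrable `[0, 1] (EFin \o (fun x => histogram T m n x y - h x)).
Proof.
under [X in _.-integrable _ X]eq_fun do rewrite /= EFinB.
apply: integrableB => //; last exact: (integrable_density dnu nu01).
exact: (bm_integrable (bm_set_cc 0 1) (bm_histogram _ _ _ _)).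
Qed.

(** Both the histogram and [nu] are concentrated on [0, 1], so nothing is lost by
    restricting the difference of the densities to it. *)
Lemma charge_diff_histogramE (T : R -> R) (m n : nat) (y : R) (A : set R) :
  measurable A ->
  charge_diff (histogram_measure T m n y) (charge_of_finite_measure nu) A =
  (\int[leb]_(x in A `&` `[0%R, 1%R]) (histogram T m n x y - h x)%:E)%E.
Proof.
move=> mA; have [mh h0 hE] := dnu.
have m01 : measurable (`[0, 1]%classic : set R) by exact: measurable_itv.
have mA1 : measurable (A `&` `[0, 1]%classic) by exact: measurableI.
rewrite /charge_diff /cadd /copp /= /charge_of_finite_measure.
rewrite [X in (_ + - X)%E = _]hE//.
under [in RHS]eq_integral do rewrite EFinB.
rewrite integralB//; last 2 first.
- apply: bm_integrable (bm_histogram _ _ _ _).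
  by apply: (bm_setS (bm_set_cc 0 1) mA1); exact: subIsetr.
- apply: (@integrableS _ _ _ leb `[0, 1]%classic) => //.
  exact: (integrable_density dnu nu01).
congr (_ - _)%E.
rewrite /histogram_measure /induced_charge integral_mkcondr.
apply: eq_integral => x _; rewrite patchE; case: ifPn => //.
by rewrite notin_setE => /histogram_outside ->.
Qed.

Lemma variation_histogram_le (T : R -> R) (m n : nat) (y : R) :
  (variation_norm (charge_diff (histogram_measure T m n y) (charge_of_finite_measure nu))
   <= (\int[leb]_(x in `[0, 1]) `|histogram T m n x y - h x|)%:E)%E.
Proof.
have [P [N [mP mN PN0 ->]]] := variation_norm_hahn
  (charge_diff (histogram_measure T m n y) (charge_of_finite_measure nu)).
rewrite !charge_diff_histogramE//.
have m01 : measurable (`[0, 1]%classic : set R) by exact: measurable_itv.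
have mP1 : measurable (P `&` `[0, 1]%classic) by exact: measurableI.
have mN1 : measurable (N `&` `[0, 1]%classic) by exact: measurableI.
have iF := integrable_histogram_error T m n y.
set f := fun x => histogram T m n x y - h x in iF *.
have mf : measurable_fun (`[0, 1]%classic : set R) f by case/integrableP : iF => /measurable_EFinP.
have msub (A : set R) : measurable (A `&` `[0, 1]%classic) ->
    measurable_fun (A `&` (`[0, 1]%classic : set R)) (EFin \o f).
  by move=> mA; apply/measurable_EFinP; apply: measurable_funS mf => //; exact: subIsetr.
rewrite -EFin_Rintegral//; last exact: (integrable_norm iF).
have mabs (A : set R) : A `<=` `[0, 1] -> measurable_fun A (fun x => `|(f x)%:E|%E).
  move=> A1; apply: (measurable_funS m01 A1); apply: measurableT_comp => //.
  exact/measurable_EFinP.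
apply: (@le_trans _ _ (\int[leb]_(x in (P `&` `[0%R, 1%R]) `|` (N `&` `[0%R, 1%R])) `|(f x)%:E|)%E).
  rewrite ge0_integral_setU//=; last 2 first.
  - by apply: mabs; rewrite subUset; split; exact: subIsetr.
  - by apply/disj_set2P; rewrite setIACA setIid PN0 set0I.
  apply: leeD.
    apply: (le_trans (lee_abs _)); apply: le_abse_integral => //; exact: msub.
  rewrite -[X in (- X)%E]/(\int[leb]_(x in N `&` `[0%R, 1%R]) (f x)%:E)%E.
  apply: (le_trans (lee_abs _)); rewrite abseN; apply: le_abse_integral => //; exact: msub.
have sU : (P `&` `[0, 1]) `|` (N `&` `[0, 1]) `<=` `[0, 1].
  by rewrite subUset; split; exact: subIsetr.
apply: ge0_subset_integral => //; [exact: measurableU|exact: mabs].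
Qed.

End total_variation.

(** * The rate of convergence *)

Section histogram_error.
Variable R : realType.
Notation leb := (@lebesgue_measure R).
Notation bm := (@bounded_measurable R).
Variables (T : R -> R) (nu : probability (measurableTypeR R) R) (h : R -> R).
Hypotheses (dnu : density nu h) (nu01 : nu `[0, 1]%classic = 1%E).
Hypotheses (inu : invariant_measure T nu).
Hypotheses (T01 : forall x, x \in `[0, 1] -> T x \in `[0, 1]).
Notation tau := (extend01 T).
Hypothesis stau : selfmap01 tau.
Variables (V B' : R).
Hypotheses (V0 : 0 <= V) (variance : forall a b n, 0 <= a -> a <= b -> b <= 1 ->
  \int[nu]_y (deviation T nu a b n y ^+ 2) <= V * (b - a) * n%:R).
Hypotheses (nu_bv : bv_dual (fun psi => \int[nu]_x psi x) B').

Let s01 : bm_set leb `[0, 1] := bm_set_cc 0 1.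
Let snu : bm_set nu (`[0, 1]%classic : set (measurableTypeR R)) :=
  bm_set_prob nu (measurable_itv _).

Definition mean_histogram (m : nat) : R -> R :=
  step m (fun i => m%:R * fine (nu (@bin R m i))).

(** The error in the height of the histogram over the bin [i]. *)
Definition bin_deviation (m n i : nat) (y : R) : R :=
  m%:R / n%:R * deviation T nu ((i%:R - 1) / m%:R) (i%:R / m%:R) n y.

Lemma bm_bin_deviation m n i : bm (bin_deviation m n i).
Proof. by apply: bmZ; exact: bm_deviation. Qed.

Lemma histogram_deviation m n x y : (0 < n)%N -> y \in `[0, 1] ->
  histogram T m n x y = mean_histogram m x + step m (bin_deviation m n ^~ y) x.
Proof.
move=> n0 y01; rewrite histogram_stepE -stepD; apply: eq_bigr => i _.
congr (_ * _); rewrite /bin_deviation /deviation sumrB sumr_const_nat subn1/=.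
rewrite -/(@bin R m i).
have -> : \sum_(1 <= k < n.+1) \1_(bin m i) (iter k tau y) =
    \sum_(1 <= k < n.+1) \1_(bin m i) (iter k T y) :> R.
  by apply: eq_bigr => k _; have [-> _] := iter_extend01 T01 k y01.
rewrite -mulr_natr; field; by rewrite pnatr_eq0 -lt0n.
Qed.

Lemma integral01_le f : bm f -> (forall x, 0 <= f x) ->
  \int[nu]_(x in `[0, 1]) f x <= \int[nu]_x f x.
Proof.
move=> bf f0; have m01 : measurable (`[0, 1]%classic : set R) by exact: measurable_itv.
rewrite [leRHS](bm_int_setID (bm_set_prob nu measurableT) m01 bf) setTI lerDl.
by apply: Rintegral_ge0.
Qed.

Section rate.
Variables (C kappa : R) (m n : nat).
Hypotheses (m0 : (0 < m)%N) (n0 : (0 < n)%N) (kappa0 : 0 < kappa).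
Hypotheses (nk : n%:R * kappa ^+ 3 = 1) (mk : m%:R * kappa <= C).
Let K1 : R := (C * V + 1) / 2.

Let m0' : (0 : R) < m%:R. Proof. by rewrite ltr0n. Qed.
Let n0' : (0 : R) < n%:R. Proof. by rewrite ltr0n. Qed.

(** The variance of the deviation is at most [V m / n], that is [V m kappa^3],
    which is of order [kappa^2] since [m kappa <= C]. The mean is deduced from
    [|z| <= (z^2 / kappa + kappa) / 2], which avoids square roots. *)
Lemma mean_bin_deviation i : (0 < i <= m)%N ->
  \int[nu]_(y in `[0, 1]) `|bin_deviation m n i y| <= K1 * kappa.
Proof.
move=> /andP[i0 im].
have bz := bm_bin_deviation m n i.
have bzz : bm (fun y => bin_deviation m n i y ^+ 2).
  by under eq_fun do rewrite expr2; exact: bmM.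
have sq : \int[nu]_(y in `[0, 1]) bin_deviation m n i y ^+ 2 <= V * C * kappa ^+ 2.
  apply: (le_trans (integral01_le bzz (fun y => sqr_ge0 _))).
  rewrite /bin_deviation; under eq_Rintegral do rewrite exprMn.
  rewrite bm_intZ; [|exact: bm_set_prob|]; last first.
    by under eq_fun do rewrite expr2; apply: bmM; exact: bm_deviation.
  have a0 : 0 <= (i%:R - 1) / m%:R :> R by rewrite divr_ge0// subr_ge0 ler1n.
  have b1 : i%:R / m%:R <= 1 :> R by rewrite ler_pdivrMr// mul1r ler_nat.
  have ab : (i%:R - 1) / m%:R <= i%:R / m%:R :> R.
    by rewrite ler_pM2r ?invr_gt0//; lra.
  apply: (le_trans (ler_wpM2l _ (variance n a0 ab b1))); first exact: sqr_ge0.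
  have -> : i%:R / m%:R - (i%:R - 1) / m%:R = m%:R^-1 :> R by ring.
  have -> : (m%:R / n%:R) ^+ 2 * (V * m%:R^-1 * n%:R) = V * (m%:R / n%:R) :> R.
    by field; rewrite !gt_eqF.
  rewrite -mulrA ler_wpM2l// ler_pdivrMr//.
  have -> : C * kappa ^+ 2 * n%:R = C / kappa.
    by rewrite -[RHS]mulr1 -[in RHS]nk; field; rewrite gt_eqF.
  by rewrite ler_pdivlMr.
have k1 : 0 < 2^-1 / kappa by rewrite divr_gt0.
(* The upper bound of [|z|] is [|z| + (|z| - kappa)^2 / (2 kappa)]. *)
pose g y := 2^-1 / kappa * bin_deviation m n i y ^+ 2 + kappa / 2.
apply: (@le_trans _ _ (\int[nu]_(y in `[0, 1]) g y)).
  apply: bm_le_int => //; first exact: bm_norm.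
    by apply: bmD; [exact: bmZ|exact: bm_cst].
  move=> y _; rewrite /g; set z := bin_deviation m n i y.
  rewrite -real_normK ?num_real//; set t := `|z|.
  rewrite -subr_ge0.
  have -> : 2^-1 / kappa * t ^+ 2 + kappa / 2 - t = 2^-1 / kappa * (t - kappa) ^+ 2.
    by field; rewrite gt_eqF.
  by rewrite mulr_ge0 ?sqr_ge0// ltW.
rewrite /g bm_intD//; [|exact: bmZ|exact: bm_cst].
rewrite bm_int_cst// [X in fine X]nu01 mulr1 bm_intZ//.
apply: (@le_trans _ _ (2^-1 / kappa * (V * C * kappa ^+ 2) + kappa / 2)).
  by rewrite lerD2r ler_wpM2l// ltW.
by rewrite /K1 le_eqVlt; apply/orP; left; apply/eqP; field; rewrite gt_eqF.
Qed.

Lemma K1_kappa_ge0 : 0 <= K1 * kappa.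
Proof.
have h1 : (0 < 1 <= m)%N by rewrite m0.
by apply: le_trans (mean_bin_deviation h1); apply: Rintegral_ge0.
Qed.

Lemma pointwise_error x : x \in `[0, 1] ->
  (\int[nu]_(y in `[0%R, 1%R]) (`|histogram T m n x y - h x|%R)%:E <=
   (K1 * kappa + `|mean_histogram m x - h x|)%:E)%E.
Proof.
move=> x01; set c := `|mean_histogram m x - h x|.
pose g y := step m (fun i => `|bin_deviation m n i y|) x + c.
have bs : bm (fun y => step m (fun i => `|bin_deviation m n i y|) x).
  apply: bm_sum => i; under eq_fun do rewrite mulrC.
  by apply: bmZ; apply: bm_norm; exact: bm_bin_deviation.
have bg : bm g by apply: bmD => //; exact: bm_cst.
apply: (@le_trans _ _ (\int[nu]_(y in `[0%R, 1%R]) (g y)%:E)%E).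
  apply: ge0_le_integral_any => y; first by rewrite lee_fin.
  move=> y01; rewrite lee_fin histogram_deviation// addrAC addrC /g.
  by apply: (le_trans (ler_normD _ _)); rewrite lerD2r step_norm.
rewrite (@EFin_Rintegral R _ _ nu)//; last exact: (bm_integrable snu bg).
rewrite lee_fin /g bm_intD//; last exact: bm_cst.
rewrite bm_int_cst// [X in fine X]nu01 mulr1 lerD2r /step.
rewrite bm_int_sum//; last first.
  move=> i; under eq_fun do rewrite mulrC.
  by apply: bmZ; apply: bm_norm; exact: bm_bin_deviation.
have -> : \sum_(1 <= i < m.+1)
    \int[nu]_(y in `[0, 1]) (`|bin_deviation m n i y| * \1_(bin m i) x) =
    step m (fun i => \int[nu]_(y in `[0, 1]) `|bin_deviation m n i y|) x.
  apply: eq_bigr => i _; under eq_Rintegral do rewrite mulrC.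
  by rewrite bm_intZ 1?mulrC//; apply: bm_norm; exact: bm_bin_deviation.
apply: step_le_max => //; first exact: K1_kappa_ge0.
exact: mean_bin_deviation.
Qed.

Let bias_integrable :
  leb.-integrable `[0, 1] (EFin \o (fun x => `|mean_histogram m x - h x|)).
Proof.
apply: (@integrable_norm _ _ _ leb).
under [X in _.-integrable _ X]eq_fun do rewrite /= EFinB.
apply: integrableB => //; last exact: (integrable_density dnu nu01).
by apply: (bm_integrable s01); exact: bm_step.
Qed.

Lemma histogram_error :
  (\int[leb]_(x in `[0%R, 1%R]) \int[nu]_(y in `[0%R, 1%R])
     (`|histogram T m n x y - h x|%R)%:E <= (K1 * kappa + 2 * B' / m%:R)%:E)%E.
Proof.
apply: (@le_trans _ _ (\int[leb]_(x in `[0%R, 1%R])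
   (K1 * kappa + `|mean_histogram m x - h x|)%:E)%E).
  apply: ge0_le_integral_any => x x01; last exact: pointwise_error.
  by apply: integral_ge0 => y _; rewrite lee_fin.
have icst : leb.-integrable `[0, 1] (EFin \o (fun=> K1 * kappa)).
  exact: (bm_integrable s01 (bm_cst _)).
rewrite EFin_Rintegral//; last first.
  under [X in _.-integrable _ X]eq_fun do rewrite /= EFinD.
  exact: integrableD.
rewrite lee_fin RintegralD//; apply: lerD; last exact: histogram_bias.
by rewrite bm_int_cst// fine_leb_cc// subr0 mulr1.
Qed.

(** The fluctuations over the bins are averaged with weights [1/m] before [y] is
    integrated out. *)
Lemma variation_error :
  (\int[nu]_(y in `[0%R, 1%R]) variation_norm
     (charge_diff (histogram_measure T m n y) (charge_of_finite_measure nu))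
   <= (K1 * kappa + 2 * B' / m%:R)%:E)%E.
Proof.
pose g y := \sum_(1 <= i < m.+1) m%:R^-1 * `|bin_deviation m n i y| + 2 * B' / m%:R.
have bz i : bm (fun y => m%:R^-1 * `|bin_deviation m n i y|).
  by apply: bmZ; apply: bm_norm; exact: bm_bin_deviation.
have bg : bm g by apply: bmD; [exact: bm_sum|exact: bm_cst].
apply: (@le_trans _ _ (\int[nu]_(y in `[0%R, 1%R]) (g y)%:E)%E).
  apply: ge0_le_integral_any => y y01; first exact: variation_norm_ge0.
  apply: (le_trans (variation_histogram_le dnu nu01 T m n y)).
  rewrite lee_fin /g.
  set z := fun i => `|bin_deviation m n i y|.
  apply: (@le_trans _ _ (\int[leb]_(x in `[0, 1])
    (step m z x + `|mean_histogram m x - h x|))).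
    apply: le_Rintegral => //.
    - exact: (integrable_norm (integrable_histogram_error dnu nu01 T m n y)).
    - under [X in _.-integrable _ X]eq_fun do rewrite /= EFinD.
      by apply: integrableD => //; exact: (bm_integrable s01 (bm_step _ _)).
    - move=> x _; rewrite histogram_deviation// addrAC addrC.
      by apply: (le_trans (ler_normD _ _)); rewrite lerD2r step_norm.
  rewrite RintegralD//; last exact: (bm_integrable s01 (bm_step _ _)).
  apply: lerD; last exact: histogram_bias.
  by rewrite int_step//; under eq_bigr do rewrite mulrC.
rewrite (@EFin_Rintegral R _ _ nu)//; last exact: (bm_integrable snu bg).
rewrite lee_fin /g bm_intD//; [|exact: bm_sum|exact: bm_cst].
rewrite bm_int_cst// [X in fine X]nu01 mulr1 lerD2r bm_int_sum//.
apply: (@le_trans _ _ (\sum_(1 <= i < m.+1) m%:R^-1 * (K1 * kappa))).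
  apply: ler_sum_nat => i im; rewrite bm_intZ//; last first.
    by apply: bm_norm; exact: bm_bin_deviation.
  by rewrite ler_wpM2l ?invr_ge0//; exact: mean_bin_deviation.
by rewrite sumr_const_nat subn1/= -mulrnAl -[_ *+ m]mulr_natr mulVf ?mul1r ?gt_eqF.
Qed.

End rate.

(** The bins cover the half-open interval from [0] to [1]: an orbit that avoids [0]
    falls in exactly one bin at each time. Orbits through [0] lose mass. *)
Lemma histogram_mass m n y : (0 < m)%N -> (0 < n)%N ->
  (forall k, 0 < iter k T y <= 1) ->
  histogram_measure T m n y [set: R] = 1%E.
Proof.
move=> m0 n0 y01; have m0' : (0 : R) < m%:R by rewrite ltr0n.
rewrite /histogram_measure /induced_charge.
transitivity (\int[leb]_(x in `[0%R, 1%R]) (histogram T m n x y)%:E)%E.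
  rewrite [RHS]integral_mkcond; apply: eq_integral => x _; rewrite patchE; case: ifPn => //.
  by rewrite notin_setE => /histogram_outside ->.
rewrite EFin_Rintegral//; last exact: (bm_integrable s01 (bm_histogram _ _ _ _)).
congr EFin; under eq_Rintegral do rewrite histogram_stepE.
rewrite int_step//.
under eq_bigr => i _ do rewrite mulrC mulKf ?gt_eqF// mulr_sumr.
rewrite exchange_big/=.
rewrite (eq_bigr (fun=> n%:R^-1)).
  by rewrite sumr_const_nat subn1/= -[_ *+ n]mulr_natr mulVf// pnatr_eq0 -lt0n.
move=> k _; have [i [im ki]] := bin_cover m0 (y01 k).
by rewrite -[RHS](@step_bin _ _ (fun=> n%:R^-1) _ _ m0 im ki).
Qed.

(** By invariance each iterate hits [0] with the [nu]-probability of the point [0],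
    which vanishes because [nu] has a density. *)
Lemma ae_iterates_positive : {ae nu, forall y, forall k, 0 < iter k T y <= 1}.
Proof.
have nu0 : nu [set 0] = 0%E.
  have [mh _ ->] := dnu; last exact: measurable_set1.
  have m0 : measurable ([set 0] `&` `[0, 1]%classic : set R).
    by apply: measurableI => //; exact: measurable_set1.
  apply: null_set_integral => //.
    apply/measurable_EFinP; apply: measurable_funS mh => //; exact: measurable_itv.
  apply/eqP; rewrite -measure_le0 -(@lebesgue_measure_set1 R 0).
  by apply: le_measure; rewrite ?inE//.
apply: ae_foralln => k.
have m01 : measurable (`[0, 1]%classic : set R) by exact: measurable_itv.
have mk : measurable (iter k tau @^-1` [set 0]).
  by apply: mtau_preimage => //; exact: measurable_set1.
exists (~` `[0, 1]%classic `|` iter k tau @^-1` [set 0]); split.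
- by apply: measurableU => //; exact: measurableC.
- apply/eqP; rewrite -measure_le0.
  apply: (le_trans (@measureU2 _ _ _ nu _ _ _ mk)); first exact: measurableC.
  rewrite [X in (X + _ <= _)%E](probability_setC nu m01) [X in (_ - X + _ <= _)%E]nu01.
  rewrite subee// add0e -nu0.
  elim: k {mk} => [|k ih]; first by [].
  rewrite (_ : _ @^-1` _ = tau @^-1` (iter k tau @^-1` [set 0])); last first.
    by apply/seteqP; split => x /=; rewrite -iterS iterSr.
  have mk : measurable (iter k tau @^-1` [set 0]).
    by apply: mtau_preimage => //; exact: measurable_set1.
  by apply: le_trans ih; rewrite [leLHS](invariant_extend01 nu01 inu T01 stau mk).
- move=> y /=; apply: contra_notP => /not_orP[/contrapT y01 yk].
  have [e k01] := iter_extend01 T01 k y01.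
  move: k01 yk; rewrite /= e in_itv/= => /andP[k0 ->]; rewrite andbT lt_neqAle k0 andbT.
  by move=> k1; rewrite eq_sym; exact/eqP.
Qed.

End histogram_error.

(** The last two bounds say that [m] is of order [1 / k]; the lower one uses that
    the integer part of [t >= 1] is at least [t / 2]. *)
Lemma bin_number_rate (R : realType) (C : R) : 0 < C -> \forall n \near \oo,
  let k := n%:R `^ (- 3%:R^-1) : R in
  [/\ (0 < n)%N, (0 < bin_number C n)%N, 0 < k, n%:R * k ^+ 3 = 1 &
      (bin_number C n)%:R * k <= C /\ (bin_number C n)%:R^-1 <= 2 / C * k].
Proof.
move=> C0.
near=> n.
have n0 : (0 < n)%N by near: n; exact: nbhs_infty_gt.
have n0' : (0 : R) < n%:R by rewrite ltr0n.
have nC : C ^- 3 <= n%:R by near: n; exact: nbhs_infty_ger.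
rewrite /bin_number powRN; set q := n%:R `^ _; set m := Num.truncn _.
have q0 : 0 < q by exact: powR_gt0.
have q3 : q ^+ 3 = n%:R.
  by rewrite -powR_mulrn ?ltW// -powRrM mulVf ?powRr1 ?ltW// pnatr_eq0.
have Cq : 1 <= C * q.
  rewrite leNgt; apply/negP => h.
  have : (C * q) ^+ 3 < 1 by rewrite exprn_ilt1 ?mulr_ge0 ?ltW.
  rewrite exprMn q3 mulrC -ltr_pdivlMr ?exprn_gt0// mul1r.
  by rewrite ltNge nC.
have /andP[mle mgt] := truncn_itv (ltW (lt_le_trans ltr01 Cq)).
rewrite -/m in mle mgt.
have m0 : (0 < m)%N by rewrite -(ltr_nat R) -(ltrD2r 1) add0r natr1 (le_lt_trans Cq).
have m1 : (1 : R) <= m%:R by rewrite ler1n.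
have m0' : (0 : R) < m%:R by rewrite ltr0n.
split=> //; [by rewrite invr_gt0| |split].
- by rewrite -q3 exprVn mulfV// expf_neq0// gt_eqF.
- by rewrite ler_pdivrMr.
rewrite -mulrA -invfM ler_pdivlMr ?mulr_gt0// mulrC ler_pdivrMr//.
by move: mgt; rewrite -natr1; lra.
Unshelve. all: by end_near. Qed.

Unset Implicit Arguments.
Set Strict Implicit.
Set Printing Implicit Defensive.

Theorem mainTheorem10 (R : realType) (T : R -> R)
    (nu : probability (measurableTypeR R) R) (h : R -> R) (C : R) :
  uniformly_expanding T nu h -> 0 < C ->
  [/\ exists K : R, \forall n \near \oo,
        (\int[lebesgue_measure]_(x in `[0%R, 1%R])
           \int[nu]_(y in `[0%R, 1%R])
             (`|histogram T (bin_number C n) n x y - h x|%R)%:E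
         <= (K * n%:R `^ (- 3%:R^-1))%:E)%E,
      \forall n \near \oo, {ae nu, forall y,
        histogram_measure T (bin_number C n) n y [set: R] = 1%E} &
      exists K : R, \forall n \near \oo,
        (\int[nu]_(y in `[0%R, 1%R])
           variation_norm
             (charge_diff (histogram_measure T (bin_number C n) n y)
                          (charge_of_finite_measure nu))
         <= (K * n%:R `^ (- 3%:R^-1))%:E)%E].
Proof.
move=> [expT [nu01 _ inu] _ mixT [dnu _]] C0.
have T01 := expT.1.
have [stau [eta eta01 ly]] := lasota_yorke_iter expT.
have [B' B'0 nu_bv] := invariant_bv dnu nu01 inu T01 stau eta01 ly.
have [V V0 variance] := deviation_variance nu01 inu mixT T01 stau eta01 ly B'0 nu_bv.
have rate := bin_number_rate C0.
have KE (k m : R) : m <= 2 / C * k ->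
    (C * V + 1) / 2 * k + 2 * B' * m <= ((C * V + 1) / 2 + 2 * B' * (2 / C)) * k.
  by move=> h1; rewrite [leRHS]mulrDl lerD2l -[leRHS]mulrA ler_wpM2l// mulr_ge0.
split.
- exists ((C * V + 1) / 2 + 2 * B' * (2 / C)).
  apply: filterS rate => n [n0 m0 k0 nk [mk m1]].
  apply: (le_trans (histogram_error dnu nu01 T01 stau V0 variance nu_bv m0 n0 k0 nk mk)).
  by rewrite lee_fin KE.
- apply: filterS rate => n [n0 m0 _ _ _].
  apply: negligibleS (ae_iterates_positive dnu nu01 inu T01 stau) => y.
  by apply: contra_not => y01; exact: histogram_mass.
- exists ((C * V + 1) / 2 + 2 * B' * (2 / C)).
  apply: filterS rate => n [n0 m0 k0 nk [mk m1]].
  apply: (le_trans (variation_error dnu nu01 T01 stau V0 variance nu_bv m0 n0 k0 nk mk)).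
  by rewrite lee_fin KE.
Qed.
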